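(* Let $\beta$ be an indeterminate. There exists a basis $\{\tilde J_\Lambda\}_\Lambda$, indexed by all superpartitions $\Lambda$, of the $\mathbb{Q}(\beta)$-algebra $\mathscr{P}^{S_\infty}(\beta)$ of symmetric superfunctions such that: (1) (triangularity) for every superpartition $\Lambda$, $\tilde J_\Lambda = m_\Lambda + \sum_{\Omega<\Lambda} \tilde c_{\Lambda\Omega}(\beta)\, m_\Omega$ for some $\tilde c_{\Lambda\Omega}(\beta)\in\mathbb{Q}(\beta)$, where $<$ is the Bruhat order on superpartitions; (2) (orthogonality) $\langle\!\langle \tilde J_\Lambda | \tilde J_\Omega\rangle\!\rangle_\beta = 0$ whenever $\Lambda\neq\Omega$.
   Context: Superpartitions. A superpartition of $(n|m)$ is $\Lambda=(\Lambda^a;\Lambda^s)=(\Lambda_1,\dots,\Lambda_m;\Lambda_{m+1},\Lambda_{m+2},\dots)$ with nonnegative integer entries, $\Lambda_1>\dots>\Lambda_m\ge 0$, $\Lambda_{m+1}\ge\Lambda_{m+2}\ge\dots\ge0$ (finitely many nonzero; trailing zeros of $\Lambda^s$ are ignored) and $\sum_i\Lambda_i=n$. Its length is $\ell(\Lambda)=m+\#\{\text{nonzero parts of }\Lambda^s\}$. Bruhat order. For two superpartitions $\Lambda,\Omega$ of the same $(n|m)$, let $\Lambda^c$, $\Omega^c$ be the compositions obtained by replacing the semicolon by a comma (padded with zeros to a common length). For compositions $\lambda,\mu$ let $\lambda^+$ be the decreasing rearrangement of $\lambda$ and $w_\lambda$ the minimal-length permutation with $\lambda=w_\lambda\lambda^+$;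 then $\lambda\ge\mu$ iff either $\lambda^+>\mu^+$ in dominance order, or $\lambda^+=\mu^+$ and $w_\lambda\le w_\mu$ in the Bruhat order of the symmetric group. Set $\Omega\le\Lambda$ iff $\Omega^c\le\Lambda^c$. Superpartitions with different $(n|m)$ are not comparable. Symmetric superfunctions. Let $x_1,x_2,\dots$ be commuting variables and $\theta_1,\theta_2,\dots$ anticommuting variables ($\theta_i\theta_j=-\theta_j\theta_i$, $\theta_i^2=0$) commuting with the $x_i$. $\mathscr{P}^{S_\infty}(\beta)$ is the algebra over $\mathbb{Q}(\beta)$ of formal series of bounded degree in $(x,\theta)$ that are invariant under simultaneous permutations of the pairs $(x_i,\theta_i)$. The supermonomial $m_\Lambda$ is the sum of all distinct terms obtained from $\theta_1\cdots\theta_m x_1^{\Lambda_1}x_2^{\Lambda_2}\cdots$ by simultaneous permutations of the pairs $(x_i,\theta_i)$. Power sums: $p_n=\sum_i x_i^n$ ($n\ge1$), $\tilde p_n=\sum_i\theta_i x_i^n$ ($n\ge 0$), $p_\Lambda=\tilde p_{\Lambda_1}\cdots\tilde p_{\Lambda_m}\,p_{\Lambda_{m+1}}\cdots p_{\Lambda_{\ell(\Lambda)}}$. The $p_\Lambda$ form a basis of $\mathscr{P}^{S_\infty}(\beta)$. Scalar product. For $f$ homogeneous of degree $m$ in $\theta$ put $\overleftarrow{f}=(-1)^{m(m-1)/2}f$ (reversal of the order of the $\theta$'s) and extend linearly. $\langle\!\langle\cdot|\cdot\rangle\!\rangle_\beta$ is the $\mathbb{Q}(\beta)$-bilinear form with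 $\langle\!\langle \overleftarrow{p_\Lambda}|p_\Omega\rangle\!\rangle_\beta=\beta^{-\ell(\Lambda)}z_\Lambda\,\delta_{\Lambda,\Omega}$, where $z_\Lambda=\prod_{k\ge1}k^{n_k}n_k!$ and $n_k$ is the number of parts of $\Lambda^s$ equal to $k$. *)

(* Defs.v *)
From HB Require Import structures.
From mathcomp Require Import all_boot all_order all_fingroup all_algebra.
From mathcomp Require Import finmap monalg.
From mathcomp Require Import boolp classical_sets functions cardinality fsbigop.

Set Implicit Arguments.
Unset Strict Implicit.
Unset Printing Implicit Defensive.

Import GRing.Theory.
Local Open Scope classical_set_scope.
Local Open Scope ring_scope.

Notation Qbeta := {fraction {poly rat}}.

Definition beta : Qbeta := tofrac 'X.

(* Superpartitions [(a; s)]; the trailing zeros of [s] are dropped, so that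
   Leibniz equality is equality of superpartitions. *)

Definition is_superpart (L : seq nat * seq nat) : bool :=
  [&& sorted gtn L.1, sorted geq L.2 & 0%N \notin L.2].

Record superpart :=
  Superpart { sp_val : seq nat * seq nat ; _ : is_superpart sp_val }.

HB.instance Definition _ := [isSub for sp_val].
HB.instance Definition _ := [Countable of superpart by <:].

Definition sp_a (L : superpart) : seq nat := (sp_val L).1.
Definition sp_s (L : superpart) : seq nat := (sp_val L).2.
Definition sp_seq (L : superpart) : seq nat := sp_a L ++ sp_s L.
Definition sp_degree (L : superpart) : nat := sumn (sp_seq L).
Definition sp_fermionic_degree (L : superpart) : nat := size (sp_a L).
Definition sp_length (L : superpart) : nat := size (sp_seq L).

Definition perm_length N (w : 'S_N) : nat :=
  #|[pred p : 'I_N * 'I_N | (p.1 < p.2)%N && (w p.2 < w p.1)%N]|.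

(* [tperm i j] ranges over all reflections of the symmetric group. *)
Definition bruhat_step N (u v : 'S_N) : bool :=
  [exists i, exists j, v == (u * tperm i j)%g]
    && (perm_length u < perm_length v)%N.

Definition bruhat_le N (u v : 'S_N) : bool := connect (@bruhat_step N) u v.

(* Replacing [w^-1] by [w] would replace [min_perm l] by its inverse, which
   affects neither the length nor the Bruhat order. *)
Definition perm_comp N (w : 'S_N) (l : N.-tuple nat) : N.-tuple nat :=
  [tuple tnth l ((w^-1)%g i) | i < N].

Definition comp_plus N (l : N.-tuple nat) : N.-tuple nat :=
  [tuple of sort geq l].

(* The default value [1] is never used: [l] is a rearrangement of
   [comp_plus l]. *)
Definition min_perm N (l : N.-tuple nat) : 'S_N :=
  [arg min_(w < 1%g | l == perm_comp w (comp_plus l)) perm_length w].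

Definition dominates (l m : seq nat) : Prop :=
  sumn l = sumn m /\ forall k, (sumn (take k m) <= sumn (take k l))%N.

Definition comp_ge N (l m : N.-tuple nat) : Prop :=
  (comp_plus l <> comp_plus m /\ dominates (comp_plus l) (comp_plus m))
  \/ (comp_plus l = comp_plus m /\ bruhat_le (min_perm l) (min_perm m)).

Definition sp_comp (N : nat) (L : superpart) : N.-tuple nat :=
  [tuple nth 0%N (sp_seq L) i | i < N].

Definition sp_le (O L : superpart) : Prop :=
  [/\ sp_degree O = sp_degree L,
      sp_fermionic_degree O = sp_fermionic_degree L &
      let N := maxn (sp_length O) (sp_length L) in
      comp_ge (sp_comp N L) (sp_comp N O)].

Definition sp_lt (O L : superpart) : Prop := sp_le O L /\ O <> L.

(* The variables are indexed from 0. The pair [(I, a)] stands for the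
   monomial [theta_i1 ... theta_ik * x^a], where [I = {i1 < ... < ik}]. *)
Definition smonom : Type := ({fset nat} * {cmonom nat})%type.
HB.instance Definition _ := Choice.on smonom.

Definition smonom_degree (M : smonom) : nat := (#|` M.1| + mdeg M.2)%N.

(* Formal series in (x, theta), given by their coefficients on the monomials
   above. *)
Definition superseries : Type := smonom -> Qbeta^o.
HB.instance Definition _ := GRing.Lmodule.on superseries.

Definition smonom_series (M : smonom) : superseries := fun N => (N == M)%:R.

(* For disjoint [I] and [J],
   theta_I * theta_J = (-1) ^ theta_inv I J * theta_(I u J). *)
Definition theta_inv (I J : {fset nat}) : nat :=
  (\sum_(i <- I) \sum_(j <- J) (j < i)%N)%N.

Definition series1 : superseries := smonom_series (fset0, mone).

(* The coefficient of [N] collects the finitely many products of monomials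
   equal to [N] up to sign; the others are products with a repeated theta. *)
Definition series_mul (f g : superseries) : superseries := fun N =>
  \sum_(p \in [set p : smonom * smonom |
                 [disjoint p.1.1 & p.2.1]%fset
                 /\ ((p.1.1 `|` p.2.1)%fset, mmul p.1.2 p.2.2) = N])
    (-1) ^+ theta_inv p.1.1 p.2.1 * (f p.1 * g p.2).

(* The group S_oo of finitary permutations of the indices. *)
Definition finitary_perm (s : nat -> nat) : Prop :=
  bijective s /\ finite_set [set i | s i <> i].

(* [s] maps the monomial [M] to
   (-1) ^ perm_theta_inv s M.1 * perm_smonom s M. *)
Definition perm_smonom (s : nat -> nat) (M : smonom) : smonom :=
  ([fset s i | i in M.1]%fset,
   \big[mmul/mone]_(i <- finsupp M.2) expcmn (ucm (s i)) (M.2 i)).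

Definition perm_theta_inv (s : nat -> nat) (I : {fset nat}) : nat :=
  (\sum_(i <- I) \sum_(j <- I) ((i < j) && (s j < s i)))%N.

Definition perm_series (s : nat -> nat) (f : superseries) : superseries :=
  fun N => \sum_(M \in [set M | perm_smonom s M = N])
             (-1) ^+ perm_theta_inv s M.1 * f M.

Definition bounded_degree (f : superseries) : Prop :=
  exists d, forall M, f M != 0 -> (smonom_degree M <= d)%N.

(* The underlying vector space of the algebra of symmetric superfunctions. *)
Definition sym_superfun : set superseries :=
  [set f | bounded_degree f
           /\ forall s, finitary_perm s -> perm_series s f = f].

Definition is_basis (K : nzRingType) (V : lmodType K) (W : set V)
    (I : choiceType) (b : I -> V) : Prop :=
  (forall i, W (b i))
  /\ forall f, W f ->
       exists! c : {fsfun I -> K with 0},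
         f = \sum_(i <- finsupp c) c i *: b i.

(* The term theta_1 ... theta_m x_1^L_1 x_2^L_2 ... *)
Definition leading_smonom (L : superpart) : smonom :=
  ([fset i | i in iota 0 (sp_fermionic_degree L)]%fset,
   \big[mmul/mone]_(i < sp_length L) expcmn (ucm (val i)) (nth 0%N (sp_seq L) i)).

(* The sum, taken coefficientwise, is over a set, so that each distinct term
   is counted once. *)
Definition supermonomial (L : superpart) : superseries := fun M =>
  \sum_(t \in [set perm_series s (smonom_series (leading_smonom L)) |
                 s in finitary_perm]) t M.

Definition power_sum (n : nat) : superseries := fun M =>
  \sum_(i \in [set: nat]) smonom_series (fset0, expcmn (ucm i) n) M.

Definition fermionic_power_sum (n : nat) : superseries := fun M =>
  \sum_(i \in [set: nat]) smonom_series ([fset i]%fset, expcmn (ucm i) n) M.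

(* The factors of the first product do not commute; they are multiplied from
   left to right. *)
Definition sp_power_sum (L : superpart) : superseries :=
  series_mul
    (\big[series_mul/series1]_(n <- sp_a L) fermionic_power_sum n)
    (\big[series_mul/series1]_(n <- sp_s L) power_sum n).

Definition theta_reversal (f : superseries) : superseries := fun M =>
  (-1) ^+ (#|` M.1| * #|` M.1|.-1)./2 * f M.

Definition sp_z (L : superpart) : nat :=
  (\prod_(k <- undup (sp_s L))
     (k ^ count_mem k (sp_s L) * (count_mem k (sp_s L))`!))%N.

(* The default value is used only outside the span of the power sums, hence
   never on [sym_superfun]. *)
Definition power_sum_coord (f : superseries) :
    {fsfun superpart -> Qbeta with 0} :=
  xget [fsfun]
    [set c : {fsfun superpart -> Qbeta with 0} |
       f = \sum_(L <- finsupp c) c L *: sp_power_sum L].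

(* Since [theta_reversal] is a linear involution, this is the bilinear form
   whose value at [(theta_reversal (sp_power_sum L), sp_power_sum O)] is
   beta ^- sp_length L * z_L if L = O, and 0 otherwise; see
   [scalar_product_power_sum]. *)
Definition scalar_product (f g : superseries) : Qbeta :=
  let c := power_sum_coord (theta_reversal f) in
  let d := power_sum_coord g in
  \sum_(L <- finsupp c) c L * d L * (beta ^- sp_length L * (sp_z L)%:R).

Lemma scalar_product_power_sum (L O : superpart) :
  is_basis sym_superfun sp_power_sum ->
  scalar_product (theta_reversal (sp_power_sum L)) (sp_power_sum O)
    = if L == O then beta ^- sp_length L * (sp_z L)%:R else 0.
Proof.
move=> [symp basisp].
have revK f : theta_reversal (theta_reversal f) = f.
  by apply/funext => M; rewrite /theta_reversal mulrA -expr2 sqrr_sign mul1r.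
pose e A : {fsfun superpart -> Qbeta with 0} :=
  [fsfun B in [fset A]%fset => 1 | 0].
have eE A B : e A B = (A == B)%:R.
  by rewrite /e fsfunE inE [B == A]eq_sym; case: (A == B).
have supp_e A : finsupp (e A) = [fset A]%fset.
  apply/fsetP => B; rewrite mem_finsupp eE inE [B == A]eq_sym.
  by case: (A == B); rewrite ?oner_neq0 ?eqxx.
have coordE A : power_sum_coord (sp_power_sum A) = e A.
  have [c [_ cuniq]] := basisp _ (symp A).
  have eP : sp_power_sum A
      = \sum_(B <- finsupp (e A)) e A B *: sp_power_sum B.
    by rewrite supp_e big_seq_fset1 eE eqxx scale1r.
  rewrite -(cuniq _ eP); apply/esym/cuniq.
  by have := @xgetPex _ [fsfun]
    [set c | sp_power_sum A = \sum_(B <- finsupp c) c B *: sp_power_sum B]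
    (ex_intro _ (e A) eP).
rewrite /scalar_product revK !coordE supp_e big_seq_fset1 !eE eqxx eq_sym.
by case: eqP => _; rewrite !(mul1r, mulr0, mul0r).
Qed.

(* Main.v *)
(** The superfunctions of degree [(n|m)] are determined by the coefficient of
    [theta_1 ... theta_m], which in finitely many variables is a polynomial that
    is antisymmetric in [x_1, ..., x_m] and symmetric in the other variables. On
    such polynomials acts
    [H = sum_(i <= m) f(xi_i) + sum_(i > m) x_i g(xi_i) B_i],
    with [xi_i] a Cherednik operator, [B_i] a partial Dunkl operator and [f], [g]
    arbitrary polynomials. Three properties of [H] give the theorem.
    - [H] is triangular on supermonomials for a relation contained in the Bruhat
      order.
    - [H] lifts to the free module on the pairs (monomial [x^a], power sum [p_s]),
      where it is self-adjoint for the form that extends the scalar product of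
      the power sums and makes the monomials orthonormal. The polynomials of
      degree [(n|m)] embed in this module.
    - The eigenvalues at [beta = 0] are the sums of [f(a)] over the fermionic
      parts and of [k g(k - 1)] over the bosonic parts. For suitable [f] and [g]
      the digits of this number are the multiplicities of the parts, so that the
      eigenvalues are distinct.
    The eigenvectors of [H] then form a unitriangular orthogonal basis. *)

Require Import Defs.
From HB Require Import structures.
From mathcomp Require Import all_boot all_order all_fingroup all_algebra.
From mathcomp Require Import finmap monalg mpoly.
From mathcomp Require Import boolp classical_sets functions cardinality fsbigop.
From mathcomp Require Import zify ring.

Set Implicit Arguments.
Unset Strict Implicit.
Unset Printing Implicit Defensive.

Import GRing.Theory.
Local Open Scope classical_set_scope.
Local Open Scope ring_scope.

(** The scalar product is defined through power sums, which satisfy relations in finitely many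
    variables, so it does not carry over directly to polynomials. On formal products [x^a p_s] a
    Cherednik operator only moves parts between an exponent and [s] or exchanges exponents, and
    these moves are adjoint to each other up to the factor [b] that a part of [s] costs in the form.
    In the bosonic term the symmetry of the argument reduces the sum over [i] to the first bosonic
    variable, of index [m]. There the Dunkl operator [D] acts on vectors free of that variable, and
    multiplication by the variable followed by the sum over the bosonic exchanges is the adjoint of
    [D] divided by [b]. The term is thus [g(xi)] between [D] and its adjoint, hence symmetric for
    every [g]; this explains the order of its three factors. The relation used for triangularity
    compares sums over all exponents or over the fermionic ones. Such sums are constant on the
    monomials of a supermonomial, so the relation descends to superpartitions, and permutations
    enter only when it is compared with the Bruhat order. *)

Local Notation "{ 'mpoly' T [ n ] }" := (mpoly.mpoly n T) : type_scope.

Local Notation "u @[ k ]" := (monalg.mcoeff k u) (at level 3, left associativity).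

(** * Cherednik and Dunkl operators *)

Section LinearExtension.
Variables (R : comNzRingType) (N : nat).

Section Mlin.
Variables (V : lmodType R) (F : 'X_{1..N} -> V).

Definition mlin (p : {mpoly R[N]}) : V := \sum_(v <- msupp p) p@_v *: F v.

Lemma mlin_wide (s : seq 'X_{1..N}) p : uniq s -> {subset msupp p <= s} ->
  mlin p = \sum_(v <- s) p@_v *: F v.
Proof.
move=> us sub; rewrite /mlin (bigID (mem (msupp p)) xpredT) /=.
rewrite [in RHS](bigID (mem (msupp p)) xpredT) /=.
rewrite [X in _ + X = _]big1 ?[X in _ = _ + X]big1.
- rewrite !addr0 -big_filter -[RHS]big_filter; apply/perm_big/uniq_perm.
  + by rewrite filter_uniq.
  + by rewrite filter_uniq.
  move=> v; rewrite !mem_filter; apply: andb_id2l => vp.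
  by rewrite (sub v vp).
- by move=> v /memN_msupp_eq0 ->; rewrite scale0r.
- by move=> v /memN_msupp_eq0 ->; rewrite scale0r.
Qed.

Lemma mlin_is_linear : linear mlin.
Proof.
move=> a p q; pose s := undup (msupp p ++ msupp q ++ msupp (a *: p + q)).
have us : uniq s by exact: undup_uniq.
rewrite !(@mlin_wide s) //; try by move=> v h; rewrite mem_undup !mem_cat h ?orbT.
rewrite scaler_sumr -big_split /=; apply: eq_bigr => v _.
by rewrite mcoeffD mcoeffZ scalerDl scalerA.
Qed.

HB.instance Definition _ :=
  GRing.isLinear.Build R {mpoly R[N]} V _ mlin mlin_is_linear.

Lemma mlinX v : mlin 'X_[v] = F v.
Proof. by rewrite /mlin msuppX big_seq1 mcoeffX eqxx scale1r. Qed.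

End Mlin.

Lemma mpoly_lin_ext (V : lmodType R) (f g : {linear {mpoly R[N]} -> V}) :
  (forall v, f 'X_[v] = g 'X_[v]) -> f =1 g.
Proof.
move=> fg p; rewrite [p]mpolyE !linear_sum; apply: eq_bigr => v _.
by rewrite !linearZ fg.
Qed.

End LinearExtension.

(** * Divided differences *)

Section DividedDifference.
Variables (R : idomainType) (N : nat).
Implicit Types (i j l : 'I_N) (v w : 'X_{1..N}) (p q : {mpoly R[N]}).

Definition upd2 v i j (c d : nat) : 'X_{1..N} :=
  [multinom if k == i then c else if k == j then d else v k | k < N].

Lemma upd2E v i j c d k :
  upd2 v i j c d k = if k == i then c else if k == j then d else v k.
Proof. exact: mnmE. Qed.

Lemma upd2_id v i j : upd2 v i j (v i) (v j) = v.
Proof. by apply/mnmP => k; rewrite upd2E; case: eqP => [->|_] //; case: eqP => [->|]. Qed.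

(* The divided difference [(1 - K_ij) / (x_i - x_j)], see [ddiffP]. *)
Definition ddiff_mono i j v : {mpoly R[N]} :=
  \sum_(c < v i) 'X_[upd2 v i j c ((v i + v j).-1 - c)]
  - \sum_(c < v j) 'X_[upd2 v i j c ((v i + v j).-1 - c)].

Definition ddiff i j : {mpoly R[N]} -> {mpoly R[N]} := mlin (ddiff_mono i j).

HB.instance Definition _ i j := GRing.Linear.on (ddiff i j).

(** A geometric sum. The two sums of [ddiff_mono] have the same lower end, which cancels in their
    difference, so that only [x^v] and its image under the exchange remain. *)
Lemma ddiff_telescope v i j (a s : nat) : i != j -> (a <= s)%N ->
  ('X_i - 'X_j) * \sum_(c < a) 'X_[upd2 v i j c (s.-1 - c)]
    = 'X_[upd2 v i j a (s - a)] - 'X_[upd2 v i j 0 s] :> {mpoly R[N]}.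
Proof.
move=> nij; elim: a => [|a IH] le_as; first by rewrite big_ord0 mulr0 subn0 subrr.
rewrite big_ord_recr /= mulrDr IH ?(ltnW le_as) // mulrBl -!mpolyXD.
have -> : (U_(i) + upd2 v i j a (s.-1 - a))%MM = upd2 v i j a.+1 (s - a.+1).
  apply/mnmP => k; rewrite mnmDE mnmE !upd2E eq_sym; case: eqP => [_|_] //=.
  by rewrite add0n; case: eqP => //; lia.
have -> : (U_(j) + upd2 v i j a (s.-1 - a))%MM = upd2 v i j a (s - a).
  apply/mnmP => k; rewrite mnmDE mnmE !upd2E [j == k]eq_sym; case: (k =P i) => [->|_].
    by rewrite (negbTE nij).
  by case: eqP => //= _; lia.
by rewrite addrC addrA subrK.
Qed.

Lemma tperm_upd2 v i j : i != j ->
  [multinom v (tperm i j k) | k < N] = upd2 v i j (v j) (v i).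
Proof.
move=> nij; apply/mnmP => k; rewrite mnmE upd2E.
by case: tpermP => [->|->|/eqP/negbTE -> /eqP/negbTE ->] //; rewrite eqxx // eq_sym (negbTE nij).
Qed.

Lemma msym_tpermX v i j : i != j ->
  msym (tperm i j) ('X_[v] : {mpoly R[N]}) = 'X_[upd2 v i j (v j) (v i)].
Proof. by move=> nij; rewrite msymX tpermV -tperm_upd2. Qed.

Lemma ddiffP i j p : i != j ->
  ('X_i - 'X_j) * ddiff i j p = p - msym (tperm i j) p.
Proof.
move=> nij; pose f := fun p => ('X_i - 'X_j) * ddiff i j p.
pose g := fun p : {mpoly R[N]} => p - msym (tperm i j) p.
have lf : linear f by move=> a x y; rewrite /f linearP mulrDr scalerAr.
have lg : linear g.
  by move=> a x y; rewrite /g linearP scalerBr opprD addrACA.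
pose F : {linear {mpoly R[N]} -> {mpoly R[N]}} :=
  HB.pack f (GRing.isLinear.Build _ _ _ _ f lf).
pose G : {linear {mpoly R[N]} -> {mpoly R[N]}} :=
  HB.pack g (GRing.isLinear.Build _ _ _ _ g lg).
apply: (@mpoly_lin_ext R N _ F G) => v; rewrite /= /f /g /ddiff mlinX /ddiff_mono.
rewrite mulrBr !ddiff_telescope ?leq_addr ?leq_addl // msym_tpermX //.
rewrite addKn addnK upd2_id.
by rewrite opprB addrA subrK.
Qed.

Lemma mpolyX_subr_neq0 i j : i != j -> 'X_i - 'X_j != 0 :> {mpoly R[N]}.
Proof.
move=> nij; apply/eqP => /mpolyP/(_ U_(i)%MM).
by rewrite mcoeffB !mcoeffX mcoeff0 eqxx eq_mnm1 eq_sym (negbTE nij) subr0 => /eqP; rewrite oner_eq0.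
Qed.

(** Polynomials form a domain, so [ddiffP] characterises [ddiff]. Its equivariance and its linearity
    over symmetric factors follow without another computation on monomials. *)
Lemma ddiff_uniq i j p q : i != j ->
  ('X_i - 'X_j) * q = p - msym (tperm i j) p -> q = ddiff i j p.
Proof.
by move=> nij; rewrite -ddiffP //; apply: mulfI; apply: mpolyX_subr_neq0.
Qed.

Lemma ddiff_mulr i j p q : i != j -> msym (tperm i j) q = q ->
  ddiff i j (q * p) = q * ddiff i j p.
Proof.
move=> nij sq; apply/esym/ddiff_uniq => //.
by rewrite mulrCA ddiffP // msymM sq mulrBr.
Qed.

Lemma msymXi (s : 'S_N) i : msym s ('X_i : {mpoly R[N]}) = 'X_(s i).
Proof.
rewrite msymX; congr 'X_[_]; apply/mnmP => k; rewrite !mnmE.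
by rewrite -(inj_eq (@perm_inj _ s)) permKV.
Qed.

Lemma msym_msym (s t : 'S_N) p : msym s (msym t p) = msym (t * s)%g p.
Proof. by apply/mpolyP => v; rewrite !mcoeff_sym mpermM. Qed.

Lemma msym_ddiff (s : 'S_N) i j p : i != j ->
  msym s (ddiff i j p) = ddiff (s i) (s j) (msym s p).
Proof.
move=> nij; apply: ddiff_uniq; first by rewrite (inj_eq perm_inj).
rewrite -!msymXi -msymB -msymM ddiffP // msymB; congr (_ - _).
rewrite !msym_msym; congr (msym _ _).
by rewrite -tpermJ conjgE mulgA mulgA mulgV mul1g.
Qed.

Lemma msym_deriv (s : 'S_N) i p : msym s p^`M(i) = (msym s p)^`M(s i).
Proof.
apply/mpolyP => v; rewrite mcoeff_sym !mcoeff_deriv mcoeff_sym mnmE; congr (p@__ *+ _).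
by apply/mnmP => k; rewrite !mnmE (inj_eq perm_inj).
Qed.

End DividedDifference.

(** * The triangularity relation on exponent vectors *)

Section Lower.
Variables (N m : nat).
Implicit Types (i j : 'I_N) (v w u : 'X_{1..N}).

(* [excess c v] for all [c] determines the multiset of exponents, and the
   dominance order is the pointwise order on these numbers. *)
Definition excess c v : nat := \sum_(i < N) (v i - c).
Definition fermi_count c v : nat := \sum_(i < N | (i < m)%N) (c <= v i).

(** A lexicographic comparison: the fermionic counts matter only when the multisets of exponents
    agree. Among superpartitions with the same parts they are later compared with the Bruhat
    order. *)
Definition lower w v : Prop :=
  [/\ mdeg w = mdeg v, forall c, (excess c w <= excess c v)%N
    & (forall c, excess c w = excess c v) ->
      forall c, (fermi_count c w <= fermi_count c v)%N].

Lemma lower_refl v : lower v v. Proof. by split. Qed.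

Lemma lower_trans u v w : lower u v -> lower v w -> lower u w.
Proof.
move=> [d1 e1 f1] [d2 e2 f2]; split; first by rewrite d1.
  by move=> c; apply: leq_trans (e1 c) (e2 c).
move=> e3 c; apply: (leq_trans (f1 _ c) (f2 _ c)) => c'.
  by apply/eqP; rewrite eqn_leq e1 e3 e2.
by apply/eqP; rewrite eqn_leq e2 -e3 e1.
Qed.

Lemma sum_upd2 (F : 'I_N -> nat -> nat) v i j c d : i != j ->
  (\sum_k F k (upd2 v i j c d k) + (F i (v i) + F j (v j))
    = \sum_k F k (v k) + (F i c + F j d))%N.
Proof.
move=> nij; rewrite (bigD1 i) //= (bigD1 j) 1?eq_sym //= upd2E eqxx upd2E eqxx.
rewrite [j == i]eq_sym (negbTE nij) [in RHS](bigD1 i) //= [in RHS](bigD1 j) 1?eq_sym //=.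
rewrite (eq_bigr (fun k => F k (v k))); first by lia.
by move=> k /andP [/negbTE ki /negbTE kj]; rewrite upd2E ki kj.
Qed.

(** Moving two exponents towards each other at constant sum cannot raise a convex sum, in particular
    no excess. If no excess drops, the pair is unchanged or swapped, and the last hypothesis says
    that a swap across the boundary [m] takes the larger exponent out of the fermionic variables. *)
Lemma lower_upd2 v i j c d : i != j -> (c + d = v i + v j)%N ->
    (minn (v i) (v j) <= c <= maxn (v i) (v j))%N ->
    (c = v j -> d = v i -> ((i < m <= j -> v j <= v i)
                         /\ (j < m <= i -> v i <= v j))%N) ->
  lower (upd2 v i j c d) v.
Proof.
move=> nij cd cb sw; split.
- by rewrite !mdegE; have := @sum_upd2 (fun _ x => x) v i j c d nij => /=; lia.
- by move=> e; rewrite /excess; have := @sum_upd2 (fun _ x => x - e)%N v i j c d nij => /=; lia.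
move=> eqe e.
(* Within the pair only an exponent equal to the maximum has positive excess at this level, so
   equality there keeps the maximum in the new pair. *)
have := eqe (maxn (v i) (v j)).-1; rewrite /excess.
have := @sum_upd2 (fun _ x => x - (maxn (v i) (v j)).-1)%N v i j c d nij => /= h1 h2.
have cases : (c = v i /\ d = v j) \/ (c = v j /\ d = v i) by lia.
rewrite /fermi_count big_mkcond [leqRHS]big_mkcond /=.
have := @sum_upd2 (fun k x => if (k < m)%N then (e <= x)%N : nat else 0%N) v i j c d nij => /=.
move: sw; case: (ltnP i m) => im; case: (ltnP j m) => jm sw h3; lia.
Qed.

End Lower.

Section DdiffSupport.
Variables (R : idomainType) (N : nat).
Implicit Types (i j : 'I_N) (v w : 'X_{1..N}).

(** The two sums of [ddiff_mono] have the same summands and differ only in the range of [c], so the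
    values of [c] between the two exponents survive. The excluded upper end decides later in which
    direction a swap can occur. *)
Lemma ddiff_supp i j v w : (ddiff i j ('X_[v] : {mpoly R[N]}))@_w != 0 ->
  exists2 c, (minn (v i) (v j) <= c < maxn (v i) (v j))%N
    & w = upd2 v i j c ((v i + v j).-1 - c).
Proof.
rewrite /ddiff mlinX /ddiff_mono -!(big_mkord xpredT (fun c => 'X_[upd2 v i j c ((v i + v j).-1 - c)] : {mpoly R[N]})).
have H a a' : (a <= a')%N ->
   ((\sum_(0 <= c < a') 'X_[upd2 v i j c ((v i + v j).-1 - c)]
   - \sum_(0 <= c < a) 'X_[upd2 v i j c ((v i + v j).-1 - c)] : {mpoly R[N]}))@_w != 0 ->
  exists2 c, (a <= c < a')%N & w = upd2 v i j c ((v i + v j).-1 - c).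
  move=> le; rewrite (big_cat_nat (leq0n a) le) /= addrAC subrr add0r raddf_sum /=.
  apply: contraNP => nex; apply/eqP/big1_seq => c /andP [_].
  rewrite mem_index_iota mcoeffX => cb; case: eqP => // e; case: nex.
  by exists c.
case/orP: (leq_total (v i) (v j)) => le nz; last first.
  by have [c cb ->] := H _ _ le nz; exists c => //; lia.
have nz' : (\sum_(0 <= c < v j) 'X_[upd2 v i j c ((v i + v j).-1 - c)]
   - \sum_(0 <= c < v i) 'X_[upd2 v i j c ((v i + v j).-1 - c)] : {mpoly R[N]})@_w != 0.
  by rewrite -opprB mcoeffN oppr_eq0.
by have [c cb ->] := H _ _ le nz'; exists c => //; lia.
Qed.

End DdiffSupport.

(** * Cherednik operators, Dunkl operators and the Hamiltonian *)

Section Operators.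
Variables (K : idomainType) (N m : nat) (b : K).
Implicit Types (i j l : 'I_N) (v w : 'X_{1..N}) (p q : {mpoly K[N]}).
Implicit Types (L : {mpoly K[N]} -> {mpoly K[N]}).

(** The factor is [X_j] for every [j], on both sides of [i], rather than depending on the order of
    [i] and [j]. This makes the operators equivariant under all permutations, see
    [msym_cherednik]. *)
Definition cherednik i p :=
  'X_i * p^`M(i) + b *: \sum_(j < N | j != i) 'X_j * ddiff i j p.

(* Only the exchanges with the antisymmetric variables are kept: this is the full
   Dunkl operator on the polynomials symmetric in the variables [m, m + 1, ...]. *)
Definition dunkl i p := p^`M(i) + b *: \sum_(l < N | (l < m)%N) ddiff i l p.

Lemma cherednik_is_linear i : linear (cherednik i).
Proof.
move=> a p q; rewrite /cherednik linearP mulrDr -scalerAr !scalerDr addrACA; congr (_ + _ + _).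
rewrite !scaler_sumr -big_split; apply: eq_bigr => j _ /=.
by rewrite linearP mulrDr -scalerAr scalerDr !scalerA mulrC.
Qed.
HB.instance Definition _ i :=
  GRing.isLinear.Build K {mpoly K[N]} {mpoly K[N]} _ (cherednik i) (cherednik_is_linear i).

Lemma dunkl_is_linear i : linear (dunkl i).
Proof.
move=> a p q; rewrite /dunkl linearP !scalerDr addrACA; congr (_ + _ + _).
rewrite !scaler_sumr -big_split; apply: eq_bigr => j _ /=.
by rewrite linearP scalerDr !scalerA mulrC.
Qed.
HB.instance Definition _ i :=
  GRing.isLinear.Build K {mpoly K[N]} {mpoly K[N]} _ (dunkl i) (dunkl_is_linear i).

Definition mulX i p : {mpoly K[N]} := 'X_i * p.
Lemma mulX_is_linear i : linear (mulX i).
Proof. by move=> a p q; rewrite /mulX mulrDr scalerAr. Qed.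
HB.instance Definition _ i :=
  GRing.isLinear.Build K {mpoly K[N]} {mpoly K[N]} _ (mulX i) (mulX_is_linear i).

End Operators.

Section OpPoly.
Variables (K : comNzRingType) (V : lmodType K).

Definition op_poly (f : {poly K}) (L : V -> V) (x : V) : V :=
  \sum_(r < size f) f`_r *: iter r L x.

Lemma iter_is_linear (L : {linear V -> V}) r : linear (iter r L).
Proof. by move=> a x y; elim: r => //= r ->; rewrite linearP. Qed.

Lemma op_poly_is_linear f (L : {linear V -> V}) : linear (op_poly f L).
Proof.
move=> a x y; rewrite /op_poly scaler_sumr -big_split; apply: eq_bigr => r _ /=.
by rewrite iter_is_linear scalerDr !scalerA mulrC.
Qed.
HB.instance Definition _ f (L : {linear V -> V}) :=
  GRing.isLinear.Build K V V _ (op_poly f L) (op_poly_is_linear f L).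

End OpPoly.

Section Hamiltonian.
Variables (K : idomainType) (N m : nat) (b : K) (f g : {poly K}).
Implicit Types (i j l : 'I_N) (v w : 'X_{1..N}) (p q : {mpoly K[N]}).

Definition fermi_op i : {mpoly K[N]} -> {mpoly K[N]} := op_poly f (cherednik b i).
HB.instance Definition _ i := GRing.Linear.on (fermi_op i).
Definition bose_op i : {mpoly K[N]} -> {mpoly K[N]} :=
  @mulX K N i \o (op_poly g (cherednik b i) \o dunkl m b i).
HB.instance Definition _ i := GRing.Linear.on (bose_op i).

Definition hamiltonian p :=
  \sum_(i < N | (i < m)%N) fermi_op i p + \sum_(i < N | (m <= i)%N) bose_op i p.

Lemma hamiltonian_is_linear : linear hamiltonian.
Proof.
move=> a p q; rewrite /hamiltonian scalerDr addrACA !scaler_sumr -!big_split.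
by congr (_ + _); apply: eq_bigr => i _; rewrite linearP.
Qed.
HB.instance Definition _ :=
  GRing.isLinear.Build K {mpoly K[N]} {mpoly K[N]} _ hamiltonian hamiltonian_is_linear.

Lemma msym_sum (s : 'S_N) (I : Type) (r : seq I) (P : pred I) (F : I -> {mpoly K[N]}) :
  msym s (\sum_(i <- r | P i) F i) = \sum_(i <- r | P i) msym s (F i).
Proof. exact: (big_morph _ (msymD s) (msym0 _ s)). Qed.

Lemma msym_cherednik (s : 'S_N) i p :
  msym s (cherednik b i p) = cherednik b (s i) (msym s p).
Proof.
rewrite /cherednik msymD msymM msymXi msym_deriv; congr (_ + _).
rewrite msymZ msym_sum; congr (_ *: _).
rewrite [RHS](reindex_perm s) /=; apply: eq_big => [j|j nj].
  by rewrite (inj_eq perm_inj).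
by rewrite msymM msymXi msym_ddiff // eq_sym.
Qed.

Lemma msym_op_poly (s : 'S_N) h i p :
  msym s (op_poly h (cherednik b i) p) = op_poly h (cherednik b (s i)) (msym s p).
Proof.
rewrite /op_poly msym_sum; apply: eq_bigr => r _ /=.
rewrite msymZ; congr (_ *: _).
by elim: (r : nat) => //= k IH; rewrite msym_cherednik IH.
Qed.

Lemma msym_dunkl (s : 'S_N) i p : (forall l, (s l < m)%N = (l < m)%N) ->
  (m <= i)%N -> msym s (dunkl m b i p) = dunkl m b (s i) (msym s p).
Proof.
move=> sm mi; rewrite /dunkl msymD msym_deriv; congr (_ + _).
rewrite msymZ msym_sum; congr (_ *: _).
rewrite [RHS](reindex_perm s) /=; apply: eq_big => [j|j jm]; first by rewrite sm.
by rewrite msym_ddiff //; apply: contraTneq jm => <-; rewrite -leqNgt.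
Qed.

Lemma msym_bose (s : 'S_N) i p : (forall l, (s l < m)%N = (l < m)%N) ->
  (m <= i)%N -> msym s (bose_op i p) = bose_op (s i) (msym s p).
Proof.
by move=> sm mi; rewrite /bose_op /= /mulX msymM msymXi msym_op_poly msym_dunkl.
Qed.

Lemma msym_hamiltonian (s : 'S_N) p : (forall l, (s l < m)%N = (l < m)%N) ->
  msym s (hamiltonian p) = hamiltonian (msym s p).
Proof.
move=> sm; rewrite /hamiltonian msymD !msym_sum; congr (_ + _).
  rewrite [RHS](reindex_perm s) /=; apply: eq_big => [j|j jm]; first by rewrite sm.
  by rewrite /fermi_op msym_op_poly.
rewrite [RHS](reindex_perm s) /=; apply: eq_big => [j|j jm]; first by rewrite [RHS]leqNgt sm -leqNgt.
by rewrite msym_bose.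
Qed.

Definition trig (rel : 'X_{1..N} -> 'X_{1..N} -> Prop)
    (L : {mpoly K[N]} -> {mpoly K[N]}) :=
  forall v w, (L 'X_[v])@_w != 0 -> rel w v.

Lemma mcoeff_sum_neq0 (I : Type) (r : seq I) (P : pred I) (F : I -> {mpoly K[N]}) w :
  (\sum_(i <- r | P i) F i)@_w != 0 -> exists2 i, P i & (F i)@_w != 0.
Proof.
rewrite raddf_sum /=; apply: contraNP => nex; apply/eqP/big1 => i Pi.
by apply/eqP; apply: contra_notT nex => nz; exists i.
Qed.

Lemma trig_comp r1 r2 (L1 : {linear {mpoly K[N]} -> {mpoly K[N]}}) L2 v w :
  trig r1 L1 -> trig r2 L2 -> (L1 (L2 'X_[v]))@_w != 0 ->
  exists2 u, r1 w u & r2 u v.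
Proof.
move=> t1 t2; rewrite [L2 _]mpolyE linear_sum => /mcoeff_sum_neq0 [u _].
rewrite linearZ mcoeffZ mulf_eq0 negb_or => /andP [n2 n1].
by exists u; [apply: t1 | apply: t2].
Qed.

Lemma trig_op_poly rel (L : {linear {mpoly K[N]} -> {mpoly K[N]}}) h :
  (forall v, rel v v) -> (forall u v w, rel u v -> rel v w -> rel u w) ->
  trig rel L -> trig rel (op_poly h L).
Proof.
move=> rr rt tL; have titer k : trig rel (iter k L).
  elim: k => [|k IH] v w /=.
    by rewrite mcoeffX; case: (v =P w) => [->|_]; rewrite ?eqxx.
  by move=> /(trig_comp tL IH) [u /rt h1 h2]; apply: h1.
move=> v w /mcoeff_sum_neq0 [r _]; rewrite mcoeffZ mulf_eq0 negb_or.
by move=> /andP [_]; apply: titer.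
Qed.

End Hamiltonian.

(** * Triangularity of the Hamiltonian *)

Section Triangularity.
Variables (K : idomainType) (N m : nat) (b : K) (f g : {poly K}).
Implicit Types (i j l : 'I_N) (v w : 'X_{1..N}) (p q : {mpoly K[N]}).

Lemma trig_mulX i : trig (fun w v => w = (U_(i) + v)%MM) (@mulX K N i).
Proof.
by move=> v w; rewrite /mulX -mpolyXD mcoeffX; case: (_ =P w) => [<-|_]; rewrite ?eqxx.
Qed.

Lemma mulX_ddiff_supp i j l v w : ('X_l * ddiff i j ('X_[v] : {mpoly K[N]}))@_w != 0 ->
  exists2 c, (minn (v i) (v j) <= c < maxn (v i) (v j))%N
    & w = (U_(l) + upd2 v i j c ((v i + v j).-1 - c))%MM.
Proof.
have tD : trig (fun w v => exists2 c, (minn (v i) (v j) <= c < maxn (v i) (v j))%N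
    & w = upd2 v i j c ((v i + v j).-1 - c)) (@ddiff K N i j).
  by move=> u u'; apply: ddiff_supp.
by move=> /(trig_comp (@trig_mulX l) tD) [u -> [c cb ->]]; exists c.
Qed.

Lemma mulX_deriv_supp i v w : ('X_i * ('X_[v] : {mpoly K[N]})^`M(i))@_w != 0 ->
  w = v.
Proof.
rewrite mderivX -scalerAr mcoeffZ mulf_eq0 negb_or => /andP [vi].
rewrite -mpolyXD mcoeffX; case: (_ =P w) => [<- _|]; last by rewrite eqxx.
rewrite addmC submK // lep1mP; apply: contraNneq vi => ->; exact/eqP.
Qed.

Lemma cherednik_supp i v w : (cherednik b i 'X_[v])@_w != 0 ->
  w = v \/ exists j c, [/\ j != i,
    (minn (v i) (v j) <= c < maxn (v i) (v j))%N
    & w = upd2 v i j c (v i + v j - c)].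
Proof.
rewrite /cherednik mcoeffD; have [z|nz] := eqVneq ('X_i * ('X_[v] : {mpoly K[N]})^`M(i))@_w 0.
  rewrite z add0r mcoeffZ mulf_eq0 negb_or => /andP [_ /mcoeff_sum_neq0 [j nj]].
  move=> /mulX_ddiff_supp [c cb ->]; right; exists j, c; split=> //.
  apply/mnmP => k; rewrite mnmDE mnm1E !upd2E [j == k]eq_sym.
  case: (k =P i) => [->|_]; first by rewrite eq_sym (negbTE nj).
  by case: eqP => //= _; lia.
by move=> _; left; apply: mulX_deriv_supp nz.
Qed.

(** As [c] stays below the maximum, a swap happens only if [x_i] carried the larger exponent, so the
    fermionic variable [x_i] can only lose by it. *)
Lemma trig_cherednik_fermi i : (i < m)%N -> trig (@lower N m) (cherednik b i).
Proof.
move=> im v w /cherednik_supp [->|[j [c [nj cb ->]]]]; first exact: lower_refl.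
by apply: lower_upd2; rewrite 1?eq_sym //; lia.
Qed.

(** For a bosonic [i] a swap could hand the larger exponent to a fermionic [x_j]. Comparing after
    multiplication by [x_i] shifts the range of [c] by one and excludes this; in [bose_op] that
    factor is always present. *)
Lemma trig_cherednik_bose i : (m <= i)%N ->
  trig (fun w v => lower m (w + U_(i))%MM (v + U_(i))%MM) (cherednik b i).
Proof.
move=> mi v w /cherednik_supp [->|[j [c [nj cb ->]]]]; first exact: lower_refl.
have -> : (upd2 v i j c (v i + v j - c) + U_(i))%MM =
   upd2 (v + U_(i))%MM i j c.+1 (v i + v j - c).
  apply/mnmP => k; rewrite mnmDE mnm1E !upd2E mnmDE mnm1E [i == k]eq_sym.
  by case: (k =P i) => [_|_]; rewrite ?addn1 ?addn0.
by apply: lower_upd2; rewrite ?mnmDE ?mnm1E ?eqxx ?[i == j]eq_sym ?(negbTE nj) //=; lia.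
Qed.

Lemma trig_dunkl i : (m <= i)%N ->
  trig (fun w v => lower m (w + U_(i))%MM v) (dunkl m b i).
Proof.
move=> mi v w; rewrite /dunkl mcoeffD; have [z|nz] := eqVneq (('X_[v] : {mpoly K[N]})^`M(i))@_w 0.
  rewrite z add0r mcoeffZ mulf_eq0 negb_or => /andP [_ /mcoeff_sum_neq0 [j jm]].
  have nj : i != j by apply: contraTneq jm => <-; rewrite -leqNgt.
  move=> /ddiff_supp [c cb ->].
  have -> : (upd2 v i j c ((v i + v j).-1 - c) + U_(i))%MM =
     upd2 v i j c.+1 ((v i + v j).-1 - c).
    apply/mnmP => k; rewrite mnmDE mnm1E !upd2E [i == k]eq_sym.
    by case: (k =P i) => [_|_]; rewrite ?addn1 ?addn0.
  by apply: lower_upd2 => //; lia.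
move=> _; rewrite addmC.
have : ('X_i * ('X_[v] : {mpoly K[N]})^`M(i))@_(U_(i) + w) != 0.
  by rewrite mulrC mcoeffMX.
by move=> /mulX_deriv_supp ->; apply: lower_refl.
Qed.

Lemma trig_fermi i : (i < m)%N -> trig (@lower N m) (fermi_op b f i).
Proof.
move=> im; apply: trig_op_poly; [exact: lower_refl|exact: lower_trans|].
exact: trig_cherednik_fermi.
Qed.

Lemma trig_bose i : (m <= i)%N -> trig (@lower N m) (bose_op m b g i).
Proof.
move=> mi; have tg : trig (fun w v => lower m (w + U_(i))%MM (v + U_(i))%MM)
    (op_poly g (cherednik b i)).
  apply: trig_op_poly; [by move=> v; exact: lower_refl| |].
    by move=> u v w; exact: lower_trans.
  exact: trig_cherednik_bose.
have tgd : trig (fun w v => lower m (w + U_(i))%MM v)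
    (fun p => op_poly g (cherednik b i) (dunkl m b i p)).
  move=> v w /(trig_comp tg (trig_dunkl mi)) [u h1 h2]; exact: lower_trans h1 h2.
move=> v w /(trig_comp (@trig_mulX i) tgd) [u ->]; by rewrite addmC.
Qed.

Lemma trig_hamiltonian : trig (@lower N m) (hamiltonian m b f g).
Proof.
move=> v w; rewrite /hamiltonian mcoeffD.
have [z|nz _] := eqVneq (\sum_(i < N | (i < m)%N) fermi_op b f i 'X_[v])@_w 0.
  by rewrite z add0r => /mcoeff_sum_neq0 [i mi /(trig_bose mi)].
by move: nz => /mcoeff_sum_neq0 [i mi /(trig_fermi mi)].
Qed.

End Triangularity.

(* [S] is the subring over which reduction modulo [b] makes sense; it is
   instantiated with [Q[beta]] in [Q(beta)]. *)
Section ModB.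
Variables (K : idomainType) (N m : nat) (b : K) (f g : {poly K}).
Variable (S : K -> Prop).
Hypotheses (S1 : S 1) (SB : forall x y, S x -> S y -> S (x - y))
  (SM : forall x y, S x -> S y -> S (x * y)) (Sb : S b).
Hypotheses (Sf : forall r, S f`_r) (Sg : forall r, S g`_r).
Implicit Types (i j l : 'I_N) (v w : 'X_{1..N}) (p q : {mpoly K[N]}).

Let S0 : S 0. Proof. by rewrite -(subrr 1); apply: SB. Qed.
Let SN x : S x -> S (- x). Proof. by move=> Sx; rewrite -sub0r; apply: SB. Qed.
Let SD x y : S x -> S y -> S (x + y).
Proof. by move=> Sx Sy; rewrite -[y]opprK; apply: SB => //; apply: SN. Qed.
Let Sn n : S n%:R. Proof. by elim: n => [|n IH] //; rewrite mulrS; apply: SD. Qed.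

Definition over p := forall w, S p@_w.

Lemma over_mon v : over 'X_[v].
Proof. by move=> w; rewrite mcoeffX; apply: Sn. Qed.
Lemma overD p q : over p -> over q -> over (p + q).
Proof. by move=> Sp Sq w; rewrite mcoeffD; apply: SD. Qed.
Lemma overN p : over p -> over (- p).
Proof. by move=> Sp w; rewrite mcoeffN; apply: SN. Qed.
Lemma overZ a p : S a -> over p -> over (a *: p).
Proof. by move=> Sa Sp w; rewrite mcoeffZ; apply: SM. Qed.
Lemma over0 : over 0. Proof. by move=> w; rewrite mcoeff0. Qed.
Lemma over_sum (I : Type) (r : seq I) (P : pred I) (F : I -> {mpoly K[N]}) :
  (forall t, P t -> over (F t)) -> over (\sum_(t <- r | P t) F t).
Proof. by move=> h; elim/big_rec: _ => [|t p Pt Sp]; [apply: over0 | apply: overD => //; apply: h]. Qed.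

Lemma over_linear (L : {linear {mpoly K[N]} -> {mpoly K[N]}}) :
  (forall v, over (L 'X_[v])) -> forall p, over p -> over (L p).
Proof.
move=> h p Sp; rewrite [p]mpolyE linear_sum; apply: over_sum => v _.
by rewrite linearZ; apply: overZ.
Qed.

Lemma over_mulX i p : over p -> over ('X_i * p).
Proof.
by apply: (@over_linear (@mulX K N i)) => v; rewrite /= /mulX -mpolyXD; apply: over_mon.
Qed.

Lemma over_ddiff i j p : over p -> over (ddiff i j p).
Proof.
apply: (@over_linear (@ddiff K N i j)) => v; rewrite /= /ddiff mlinX.
by apply: overD; [|apply: overN]; apply: over_sum => c _; apply: over_mon.
Qed.

Lemma over_deriv i p : over p -> over p^`M(i).
Proof.
apply: (@over_linear (@mderiv N K i)) => v; rewrite /= mderivX.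
by apply: overZ => //; apply: over_mon.
Qed.

Lemma over_cherednik i p : over p -> over (cherednik b i p).
Proof.
move=> Sp; apply: overD; first exact/over_mulX/over_deriv.
by apply: overZ => //; apply: over_sum => j _; apply/over_mulX/over_ddiff.
Qed.

Definition eq_modb p q := exists2 h, over h & p = q + b *: h.

Lemma eq_modb_refl p : eq_modb p p.
Proof. by exists 0; [exact: over0 | rewrite scaler0 addr0]. Qed.
Lemma eq_modb_trans p q r : eq_modb p q -> eq_modb q r -> eq_modb p r.
Proof.
move=> [h Sh ->] [h' Sh' ->]; exists (h' + h); first exact: overD.
by rewrite scalerDr addrA.
Qed.
Lemma eq_modbD p q p' q' : eq_modb p q -> eq_modb p' q' -> eq_modb (p + p') (q + q').
Proof.
move=> [h Sh ->] [h' Sh' ->]; exists (h + h'); first exact: overD.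
by rewrite scalerDr addrACA.
Qed.
Lemma eq_modbZ a p q : S a -> eq_modb p q -> eq_modb (a *: p) (a *: q).
Proof.
move=> Sa [h Sh ->]; exists (a *: h); first exact: overZ.
by rewrite scalerDr !scalerA mulrC.
Qed.
Lemma eq_modb_sum (I : Type) (r : seq I) (P : pred I) (F G : I -> {mpoly K[N]}) :
  (forall t, P t -> eq_modb (F t) (G t)) ->
  eq_modb (\sum_(t <- r | P t) F t) (\sum_(t <- r | P t) G t).
Proof.
move=> h; elim/big_rec2: _ => [|t p q Pt pq]; first exact: eq_modb_refl.
by apply: eq_modbD => //; apply: h.
Qed.
Lemma eq_modb_linear (L : {linear {mpoly K[N]} -> {mpoly K[N]}}) p q :
  (forall p, over p -> over (L p)) -> eq_modb p q -> eq_modb (L p) (L q).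
Proof. by move=> SL [h Sh ->]; exists (L h); [apply: SL | rewrite linearD linearZ]. Qed.

Lemma mulX_derivX i v : 'X_i * ('X_[v] : {mpoly K[N]})^`M(i) = (v i)%:R *: 'X_[v].
Proof.
rewrite mderivX -scalerAr -mpolyXD; case: (posnP (v i)) => [->|vi]; first by rewrite !scale0r.
by rewrite addmC submK // lep1mP -lt0n.
Qed.

Lemma eq_modb_cherednik i v : eq_modb (cherednik b i 'X_[v]) ((v i)%:R *: 'X_[v]).
Proof.
exists (\sum_(j < N | j != i) 'X_j * ddiff i j 'X_[v]); last by rewrite -mulX_derivX.
by apply: over_sum => j _; apply/over_mulX/over_ddiff/over_mon.
Qed.

Lemma eq_modb_op_poly (h : {poly K}) i v : (forall r, S h`_r) ->
  eq_modb (op_poly h (cherednik b i) 'X_[v]) (h.[(v i)%:R] *: 'X_[v]).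
Proof.
move=> Sh; rewrite horner_coef scaler_suml; apply: eq_modb_sum => r _.
rewrite -scalerA; apply: eq_modbZ => //.
elim: (r : nat) => [|k IH] /=; first by rewrite expr0 scale1r; exact: eq_modb_refl.
apply: eq_modb_trans (eq_modb_linear (@over_cherednik i) IH) _.
rewrite linearZ exprSr -scalerA; apply: eq_modbZ; last exact: eq_modb_cherednik.
by rewrite -natrX.
Qed.

(** At [b = 0] the Hamiltonian is the sum of [f(x_i d_i)] over the fermionic and of
    [x_i g(x_i d_i) d_i] over the bosonic variables, so monomials are eigenvectors. The derivative
    acts before [g], hence the argument [v i - 1]. *)
Definition eigen_leading v : K :=
  \sum_(i < N | (i < m)%N) f.[(v i)%:R] +
  \sum_(i < N | (m <= i)%N) (v i)%:R * g.[(v i).-1%:R].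

Lemma eq_modb_hamiltonian v :
  eq_modb (hamiltonian m b f g 'X_[v]) (eigen_leading v *: 'X_[v]).
Proof.
rewrite scalerDl !scaler_suml; apply: eq_modbD; apply: eq_modb_sum => i im.
  exact: eq_modb_op_poly.
rewrite /bose_op /=.
have -> : ((v i)%:R * g.[(v i).-1%:R]) *: ('X_[v] : {mpoly K[N]})
   = 'X_i * ((v i)%:R *: (g.[(v i).-1%:R] *: 'X_[v - U_(i)])).
  rewrite scalerA -scalerAr -mpolyXD; case: (posnP (v i)) => [->|vi].
    by rewrite !mul0r !scale0r.
  by rewrite addmC submK // lep1mP -lt0n.
apply: (eq_modb_linear (L := @mulX K N i)) => [p|]; first exact: over_mulX.
have Sop p : over p -> over (op_poly g (cherednik b i) p).
  move=> Sp; apply: over_sum => r _; apply: overZ => //.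
  by elim: (r : nat) => //= k IH; apply: over_cherednik.
apply: (@eq_modb_trans _ (op_poly g (cherednik b i) ((v i)%:R *: 'X_[v - U_(i)]))).
  apply: (eq_modb_linear (L := op_poly g (cherednik b i))) => //.
  exists (\sum_(l < N | (l < m)%N) ddiff i l 'X_[v]); last by rewrite /dunkl mderivX.
  by apply: over_sum => j _; apply/over_ddiff/over_mon.
rewrite linearZ; apply: eq_modbZ => //.
have -> : (v i).-1 = (v - U_(i))%MM i by rewrite mnmBE mnm1E eqxx subn1.
exact: eq_modb_op_poly.
Qed.

End ModB.

(** * Polynomials antisymmetric in the fermionic and symmetric in the bosonic variables *)

Section Sector.
Variables (K : idomainType) (N m : nat).
Implicit Types (i j : 'I_N) (v w : 'X_{1..N}) (p q : {mpoly K[N]}).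

Definition in_sector p := forall i j, j = i.+1 :> nat ->
  ((j < m)%N -> msym (tperm i j) p = - p) /\ ((m <= i)%N -> msym (tperm i j) p = p).

Definition sector_lead v := forall i j, j = i.+1 :> nat ->
  ((j < m)%N -> (v j < v i)%N) /\ ((m <= i)%N -> (v j <= v i)%N).

Lemma in_sector_sum (I : Type) (r : seq I) (P : pred I) (F : I -> {mpoly K[N]}) :
  (forall t, P t -> in_sector (F t)) -> in_sector (\sum_(t <- r | P t) F t).
Proof.
move=> h i j ij; split=> c; rewrite msym_sum -?sumrN; apply: eq_bigr => t Pt.
  by apply: (h t Pt i j ij).1.
by apply: (h t Pt i j ij).2.
Qed.

Lemma in_sectorZ a p : in_sector p -> in_sector (a *: p).
Proof. by move=> h i j /h [h1 h2]; split=> c; rewrite msymZ; [rewrite h1 // scalerN | rewrite h2]. Qed.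

Lemma in_sectorB p q : in_sector p -> in_sector q -> in_sector (p - q).
Proof.
move=> hp hq i j ij; have [h1 h2] := hp i j ij; have [h3 h4] := hq i j ij.
by split=> c; rewrite msymB; [rewrite h1 // h3 // opprD | rewrite h2 // h4].
Qed.

Lemma in_sector_hamiltonian b f g p :
  in_sector p -> in_sector (hamiltonian m b f g p).
Proof.
move=> h i j ij; have [h1 h2] := h i j ij.
by split=> c; (rewrite msym_hamiltonian; last by move=> l; case: tpermP => [->|->|//]; lia);
  [rewrite h1 // linearN | rewrite h2].
Qed.

(** Sorting by adjacent exchanges: putting the larger exponent first lowers [sum i * v_i] and
    changes the coefficient at most by a sign. Two equal neighbouring fermionic exponents make a
    coefficient equal to its negative. *)
Lemma in_sector0P p : 2%:R != 0 :> K -> in_sector p ->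
  (forall v, sector_lead v -> p@_v = 0) -> p = 0.
Proof.
move=> nz2 sp lead0; apply/mpolyP => v; rewrite mcoeff0.
have [n] := ubnP (\sum_(i < N) i * v i)%N; elim: n v => // n IH v vn.
case: (pselect (sector_lead v)) => [/lead0 //|].
move=> /existsNP [i /existsNP [j /not_implyP [ij nh]]].
have nij : i != j by apply/eqP => e; move: ij; rewrite e; lia.
pose vt := upd2 v i j (v j) (v i).
have swap : (v i < v j)%N -> (\sum_(k < N) k * vt k < n)%N.
  move=> lt; have := @sum_upd2 N (fun k x => k * x)%N v i j (v j) (v i) nij => /=.
  move: vn; rewrite ltnS ij !mulSn /vt => h1 h2; apply: leq_trans h1.
  by rewrite -(ltn_add2r (i * v i + (v j + i * v j))%N) h2 ltn_add2l; lia.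
have [s1 s2] := sp i j ij.
have pt : (msym (tperm i j) p)@_v = p@_vt by rewrite mcoeff_sym tperm_upd2.
have [jm|mj] := ltnP j m.
  have : (v i <= v j)%N by rewrite leqNgt; apply/negP => lt; apply: nh; split=> //; lia.
  move: pt; rewrite s1 // mcoeffN => pt.
  rewrite leq_eqVlt => /orP [/eqP e|lt]; last first.
    by apply: oppr_inj; rewrite pt IH ?oppr0 //; apply: swap.
  move: pt; rewrite (_ : vt = v) => [/eqP|]; last by rewrite /vt {1}e -{1}e upd2_id.
  by rewrite eq_sym -addr_eq0 -mulr2n -mulr_natl mulf_eq0 (negbTE nz2) => /eqP.
have [mi|im] := leqP m i; last by exfalso; apply: nh; split; lia.
move: pt; rewrite s2 // => ->; apply: IH; apply: swap.
by rewrite ltnNge; apply/negP => le; apply: nh; split=> // ; lia.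
Qed.

End Sector.

(** * The free module on monomials and power sums *)

Section FreeLinear.
Variables (K : comNzRingType) (I : choiceType) (V : lmodType K) (F : I -> V).
Implicit Types (u v : {malg K[I]}).

Definition flin u : V := \sum_(k <- monalg.msupp u) monalg.mcoeff k u *: F k.

Lemma flin_wide (s : seq I) u : uniq s -> {subset monalg.msupp u <= s} ->
  flin u = \sum_(k <- s) monalg.mcoeff k u *: F k.
Proof.
move=> us sub; rewrite /flin (bigID (mem (monalg.msupp u)) xpredT) /=.
rewrite [in RHS](bigID (mem (monalg.msupp u)) xpredT) /=.
rewrite [X in _ + X = _]big1 ?[X in _ = _ + X]big1.
- rewrite !addr0 -big_filter -[RHS]big_filter; apply/perm_big/uniq_perm.
  + by rewrite filter_uniq // fset_uniq.
  + by rewrite filter_uniq.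
  move=> k; rewrite !mem_filter; apply: andb_id2l => vk.
  by rewrite (sub k vk) vk.
- by move=> k nk; rewrite mcoeff_outdom // scale0r.
- by move=> k nk; rewrite mcoeff_outdom // scale0r.
Qed.

Lemma flin_is_linear : linear flin.
Proof.
move=> a u v; pose s := undup (monalg.msupp u ++ monalg.msupp v ++ monalg.msupp (a *: u + v)).
have us : uniq s by exact: undup_uniq.
rewrite !(@flin_wide s) //; try by move=> k h; rewrite mem_undup !mem_cat h ?orbT.
rewrite scaler_sumr -big_split /=; apply: eq_bigr => k _.
by rewrite monalg.mcoeffD monalg.mcoeffZ scalerDl scalerA.
Qed.

HB.instance Definition _ :=
  GRing.isLinear.Build K {malg K[I]} V _ flin flin_is_linear.

Lemma flin_sum (T : Type) (r : seq T) (P : pred T) (G : T -> {malg K[I]}) :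
  flin (\sum_(t <- r | P t) G t) = \sum_(t <- r | P t) flin (G t).
Proof. exact: (linear_sum flin). Qed.

Lemma flinU k : flin (monalg.mkmalgU k 1) = F k.
Proof. by rewrite /flin msuppU oner_eq0 big_seq_fset1 mcoeffUU scale1r. Qed.

End FreeLinear.

(** * Diagonal forms and adjoint operators *)

Section Pairing.
Variables (K : comNzRingType) (I : choiceType) (wt : I -> K).
Implicit Types (u v : {malg K[I]}).

Lemma malg_lin_ext (V : lmodType K) (f g : {linear {malg K[I]} -> V}) :
  (forall k, f (monalg.mkmalgU k 1) = g (monalg.mkmalgU k 1)) -> f =1 g.
Proof.
move=> fg u; rewrite [u]monalgE !linear_sum; apply: eq_bigr => k _.
have -> : monalg.mkmalgU k u@[k] = u@[k] *: monalg.mkmalgU k 1.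
  by apply/malgP => l; rewrite monalg.mcoeffZ !mcoeffU mulrnAr mulr1.
by rewrite !linearZ fg.
Qed.

Definition wform u v : K := \sum_(k <- monalg.msupp u) u@[k] * v@[k] * wt k.

Lemma wform_wide (s : seq I) u v : uniq s -> {subset monalg.msupp u <= s} ->
  wform u v = \sum_(k <- s) u@[k] * v@[k] * wt k.
Proof.
move=> us sub; have := @flin_wide K I K^o (fun k => v@[k] * wt k) s u us sub.
rewrite /flin /wform /GRing.scale /= => h.
by under eq_bigr do rewrite -mulrA; rewrite h; apply: eq_bigr => k _; rewrite mulrA.
Qed.

Lemma wformC u v : wform u v = wform v u.
Proof.
pose s := undup (monalg.msupp u ++ monalg.msupp v).
have us : uniq s by exact: undup_uniq.
rewrite !(@wform_wide s) //; try by move=> k h; rewrite mem_undup !mem_cat h ?orbT.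
by apply: eq_bigr => k _; rewrite [u@[k] * _]mulrC.
Qed.

Lemma wform_linear v : linear_for *%R (wform^~ v).
Proof.
move=> a u w; pose s := undup (monalg.msupp u ++ monalg.msupp w ++ monalg.msupp (a *: u + w)).
have us : uniq s by exact: undup_uniq.
rewrite /= !(@wform_wide s) //; try by move=> k h; rewrite mem_undup !mem_cat h ?orbT.
rewrite mulr_sumr -big_split /=; apply: eq_bigr => k _.
by rewrite monalg.mcoeffD monalg.mcoeffZ !mulrDl !mulrA.
Qed.

Definition supported (P : I -> Prop) u := forall k, u@[k] != 0 -> P k.

Lemma supportedD P u v : supported P u -> supported P v -> supported P (u + v).
Proof.
move=> Pu Pv k; rewrite monalg.mcoeffD => nz; have [z|/Pu //] := eqVneq u@[k] 0.
by apply: Pv; rewrite z add0r in nz.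
Qed.

Lemma supportedZ P a u : supported P u -> supported P (a *: u).
Proof.
move=> Pu k; rewrite monalg.mcoeffZ => nz; apply: Pu.
by apply: contraNneq nz => ->; rewrite mulr0.
Qed.

Lemma supportedN P u : supported P u -> supported P (- u).
Proof. by rewrite -scaleN1r; apply: supportedZ. Qed.

Lemma supported0 P : supported P 0.
Proof. by move=> k; rewrite monalg.mcoeff0 eqxx. Qed.

Lemma supported_sum P (T : Type) (r : seq T) (Q : pred T) (F : T -> {malg K[I]}) :
  (forall t, Q t -> supported P (F t)) -> supported P (\sum_(t <- r | Q t) F t).
Proof.
move=> h; elim/big_rec: _ => [|t u Qt Pu]; first exact: supported0.
by apply: supportedD => //; apply: h.
Qed.

Lemma supportedU (P : I -> Prop) k : P k -> supported P (monalg.mkmalgU k 1).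
Proof. by move=> Pk l; rewrite mcoeffU; case: (k =P l) => [<-|_]; rewrite ?eqxx. Qed.

Lemma supported_flin (P Q : I -> Prop) (F : I -> {malg K[I]}) u :
  (forall k, P k -> supported Q (F k)) -> supported P u -> supported Q (flin F u).
Proof.
move=> h Pu; rewrite /flin big_seq; apply: supported_sum => k ku.
have Pk : P k by apply: Pu; rewrite mcoeff_neq0.
exact: supportedZ (h k Pk).
Qed.

Lemma supported_ext (V : lmodType K) (f g : {linear {malg K[I]} -> V}) (P : I -> Prop) u :
  (forall k, P k -> f (monalg.mkmalgU k 1) = g (monalg.mkmalgU k 1)) ->
  supported P u -> f u = g u.
Proof.
move=> fg Pu; rewrite [u]monalgE !linear_sum; apply: eq_big_seq => k.
rewrite -mcoeff_neq0 => /Pu Pk.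
have -> : monalg.mkmalgU k u@[k] = u@[k] *: monalg.mkmalgU k 1.
  by apply/malgP => l; rewrite monalg.mcoeffZ !mcoeffU mulrnAr mulr1.
by rewrite !linearZ fg.
Qed.

(** The form is diagonal, so adjointness is a comparison of two matrix entries for each pair of
    indices. Restricting the pairs to the supports admits operators that are adjoint only on vectors
    without certain variables. *)
Lemma wform_adjoint (P Q : I -> Prop) (F G : I -> {malg K[I]}) u v :
  (forall k l, P k -> Q l -> (F k)@[l] * wt l = (G l)@[k] * wt k) ->
  supported P u -> supported Q v ->
  wform (flin F u) v = wform u (flin G v).
Proof.
move=> FG Pu Qv; rewrite wformC /wform.
have cf H w l : (flin H w)@[l] = \sum_(k <- monalg.msupp w) w@[k] * (H k)@[l].
  rewrite /flin raddf_sum; apply: eq_bigr => k _; exact: monalg.mcoeffZ.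
under eq_bigr do rewrite cf mulr_sumr mulr_suml.
rewrite exchange_big /= big_seq [RHS]big_seq; apply: eq_bigr => k ku.
rewrite cf mulr_sumr mulr_suml big_seq [RHS]big_seq; apply: eq_bigr => l lv.
have := FG k l (Pu k _) (Qv l _); rewrite !mcoeff_neq0 => /(_ ku lv) h.
by rewrite mulrA -mulrA h; ring.
Qed.

End Pairing.

Section SumRem.
Lemma sum_seq_single (V : nmodType) (I : eqType) (s : seq I) (r : I) (F : I -> V) :
  (forall x, x \in s -> x != r -> F x = 0) ->
  \sum_(x <- s) F x = F r *+ count_mem r s.
Proof.
elim: s => [|x s IH] h; first by rewrite big_nil mulr0n.
rewrite big_cons IH; last by move=> y ys; apply: h; rewrite inE ys orbT.
rewrite /= mulrnDr; congr (_ + _); case: (x =P r) => [->|/eqP nx]; first by rewrite mulr1n.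
by rewrite mulr0n h // mem_head.
Qed.

Definition zee (s : seq nat) : nat :=
  \prod_(k <- undup s) (k ^ count_mem k s * (count_mem k s)`!).

Lemma zee_wide (t s : seq nat) : uniq t -> {subset s <= t} ->
  zee s = (\prod_(k <- t) (k ^ count_mem k s * (count_mem k s)`!))%N.
Proof.
move=> ut sub; rewrite (bigID (mem s)) /= [X in (_ * X)%N]big1 ?muln1.
  rewrite -big_filter; apply/perm_big/uniq_perm; rewrite ?undup_uniq ?filter_uniq //.
  by move=> k; rewrite mem_undup mem_filter; case: (boolP (k \in s)) => //= /sub ->.
by move=> k nk; rewrite (count_memPn nk).
Qed.

Lemma zee_perm s t : perm_eq s t -> zee s = zee t.
Proof.
move=> st; rewrite (@zee_wide (undup t)) ?undup_uniq // => [|k]; last first.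
  by rewrite (perm_mem st) mem_undup.
by apply: eq_bigr => k _; rewrite (seq.permP st).
Qed.

Lemma zee_cons r s : zee (r :: s) = (r * (count_mem r s).+1 * zee s)%N.
Proof.
pose t := undup (r :: s).
rewrite (@zee_wide t) ?(@zee_wide t s) ?undup_uniq //; first last.
- by move=> k; rewrite mem_undup.
- by move=> k ks; rewrite mem_undup inE ks orbT.
rewrite (bigD1_seq r) ?undup_uniq ?mem_undup ?mem_head //=.
rewrite [in RHS](bigD1_seq r) ?undup_uniq ?mem_undup ?mem_head //=.
rewrite eqxx add1n expnS factS (eq_bigr (fun k => k ^ count_mem k s * (count_mem k s)`!)%N).
  by rewrite !mulnA; congr (_ * _)%N; lia.
by move=> k nk; rewrite eq_sym (negbTE nk).
Qed.

(** Applying [r d/dp_r] to [p_s] also produces [r] times the multiplicity of [r]. This agreement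
    makes the derivation adjoint to multiplication by [p_r], up to [b]. *)
Lemma zee_rem r s : r \in s -> zee s = (r * count_mem r s * zee (rem r s))%N.
Proof.
move=> rs; rewrite (zee_perm (perm_to_rem rs)) zee_cons; congr (_ * _ * _)%N.
by have /seq.permP -> := perm_to_rem rs; rewrite /= eqxx.
Qed.

End SumRem.

(** * Lifts of the operators to the free module *)

Section Formal.
Variables (K : fieldType) (N m : nat) (b : K).
Implicit Types (i j l : 'I_N) (a c : 'X_{1..N}) (s t : seq nat).

(* The index [(a, s)] stands for [x^a * p_s]. These products are not linearly
   independent polynomials, and only on the free module spanned by the indices is
   the form with the weights [wt] well defined. *)
Definition fidx := ('X_{1..N} * seq nat)%type.
HB.instance Definition _ := Choice.on fidx.
Local Notation FF := {malg K[fidx]}.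
Local Notation "'b_ k" := (monalg.mkmalgU (k : fidx) 1 : FF) (at level 8, k at level 2).

Definition upd1 a i (x : nat) : 'X_{1..N} :=
  [multinom if k == i then x else a k | k < N].
Definition ins r s := sort geq (r :: s).

Definition psum r : {mpoly K[N]} := \sum_(i < N) 'X_i ^+ r.
Definition psums s : {mpoly K[N]} := \prod_(r <- s) psum r.
Definition phi_mono (k : fidx) : {mpoly K[N]} := 'X_[k.1] * psums k.2.
Definition phi : FF -> {mpoly K[N]} := flin phi_mono.
HB.instance Definition _ := GRing.Linear.on phi.

(** The derivative of [x^a p_s] gives [a_i] and turns a part [r] into [r x_i^r]. In the exchanges,
    the positive half of the divided differences would give [p_(a_i - x)] if summed over all [j];
    the term [j = i], which is [x^a p_s] for each [x < a_i], is subtracted. The negative half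
    exchanges exponents and leaves [s] alone. *)
Definition fcher_mono i (k : fidx) : FF :=
  (k.1 i)%:R *: 'b_k
  + \sum_(r <- k.2) r%:R *: 'b_(upd1 k.1 i (k.1 i + r), rem r k.2)
  + b *: (\sum_(x < k.1 i) 'b_(upd1 k.1 i x, ins (k.1 i - x) k.2)
          - (k.1 i)%:R *: 'b_k
          - \sum_(l < N | l != i) \sum_(x < k.1 l)
              'b_(upd2 k.1 i l x (k.1 i + k.1 l - x), k.2)).
Definition fcher i : FF -> FF := flin (fcher_mono i).
HB.instance Definition _ i := GRing.Linear.on (fcher i).

(** Meant for [a_i = 0]: then the derivative reaches only the power sums, and the positive half of
    each divided difference is empty. *)
Definition fdunkl_mono i (k : fidx) : FF :=
  \sum_(r <- k.2) r%:R *: 'b_(upd1 k.1 i (k.1 i + r).-1, rem r k.2)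
  - b *: \sum_(l < N | (l < m)%N) \sum_(x < k.1 l)
              'b_(upd2 k.1 i l x ((k.1 l).-1 - x), k.2).
Definition fdunkl i : FF -> FF := flin (fdunkl_mono i).
HB.instance Definition _ i := GRing.Linear.on (fdunkl i).

(** The power [x_i^(a_i + 1)] is replaced by the sum of the same powers of the bosonic variables,
    written as a full power sum minus its fermionic terms. *)
Definition fsum_mono i (k : fidx) : FF :=
  'b_(upd1 k.1 i 0, ins (k.1 i).+1 k.2)
  - \sum_(l < N | (l < m)%N) 'b_(upd2 k.1 i l 0 (k.1 l + k.1 i).+1, k.2).
Definition fsum i : FF -> FF := flin (fsum_mono i).
HB.instance Definition _ i := GRing.Linear.on (fsum i).

Definition wt (k : fidx) : K := b ^- size k.2 * (zee k.2)%:R.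

Lemma upd1E a i x j : upd1 a i x j = if j == i then x else a j.
Proof. exact: mnmE. Qed.

Lemma perm_ins r s : perm_eq (ins r s) (r :: s).
Proof. by rewrite perm_sort. Qed.

Lemma psums_perm s t : perm_eq s t -> psums s = psums t.
Proof. exact: perm_big. Qed.

Lemma psums_cons r s : psums (r :: s) = psum r * psums s.
Proof. exact: big_cons. Qed.

Lemma psums_ins r s : psums (ins r s) = psum r * psums s.
Proof. by rewrite (psums_perm (perm_ins r s)) psums_cons. Qed.

Lemma psums_rem r s : r \in s -> psums s = psum r * psums (rem r s).
Proof. by move=> /perm_to_rem/psums_perm ->; rewrite psums_cons. Qed.

Lemma msym_psum (g : 'S_N) r : msym g (psum r) = psum r.
Proof.
rewrite /psum msym_sum [RHS](reindex_perm g) /=; apply: eq_bigr => i _.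
by rewrite rmorphXn /= msymXi.
Qed.

Lemma msym_psums (g : 'S_N) s : msym g (psums s) = psums s.
Proof.
elim: s => [|r s IH]; first by rewrite /psums big_nil msym1.
by rewrite psums_cons msymM msym_psum IH.
Qed.

Lemma mpolyX_upd1D a i x : 'X_[upd1 a i (a i + x)] = 'X_i ^+ x * 'X_[a] :> {mpoly K[N]}.
Proof.
rewrite mpolyXn -mpolyXD; congr 'X_[_]; apply/mnmP => k.
rewrite !mnmDE !mulmnE !mnm1E upd1E [i == k]eq_sym; case: (k =P i) => [->|_]; first by rewrite !mul1n addnC.
by rewrite !mul0n add0n.
Qed.

Lemma deriv_psum i r : (psum r)^`M(i) = r%:R *: 'X_i ^+ r.-1.
Proof.
rewrite /psum linear_sum (bigD1 i) //= big1 ?addr0 => [|j nj].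
  rewrite mpolyXn mderivX mulmnE mnm1E eqxx mul1n mpolyXn; congr (_ *: 'X_[_]).
  apply/mnmP => k; rewrite mnmBE !mulmnE mnm1E; case: eqP => _; lia.
by rewrite mpolyXn mderivX mulmnE mnm1E (negbTE nj) mul0n scale0r.
Qed.

Lemma deriv_psums i s :
  (psums s)^`M(i) = \sum_(r <- s) r%:R *: ('X_i ^+ r.-1 * psums (rem r s)).
Proof.
elim: s => [|r s IH]; first by rewrite /psums !big_nil -[1]/(1%:MP) mderivC.
rewrite psums_cons mderivM deriv_psum IH big_cons /= eqxx -scalerAl; congr (_ + _).
rewrite mulr_sumr; apply: eq_big_seq => x xs; rewrite -scalerAr mulrCA; congr (_ *: (_ * _)).
by case: (r =P x) => [->|_]; rewrite ?psums_cons // -psums_rem.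
Qed.

Lemma mulX_ddiff_mono i j a : j != i ->
  'X_j * ddiff i j 'X_[a] = \sum_(x < a i) 'X_[upd1 a i x] * 'X_j ^+ (a i - x)
    - \sum_(x < a j) 'X_[upd2 a i j x (a i + a j - x)] :> {mpoly K[N]}.
Proof.
move=> nj; rewrite /ddiff mlinX mulrBr !mulr_sumr; congr (_ - _); apply: eq_bigr => x _.
  rewrite mpolyXn -!mpolyXD; congr 'X_[_]; apply/mnmP => k.
  rewrite !mnmDE mulmnE mnm1E upd2E upd1E [j == k]eq_sym; case: (k =P i) => [->|_].
    by rewrite eq_sym (negbTE nj) mul0n addn0.
  by case: (k =P j) => [->|_] //=; have := ltn_ord x; lia.
rewrite -mpolyXD; congr 'X_[_]; apply/mnmP => k; rewrite mnmDE mnm1E !upd2E [j == k]eq_sym.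
case: (k =P i) => [->|_]; first by rewrite eq_sym (negbTE nj).
by case: (k =P j) => [_|_] //=; have := ltn_ord x; lia.
Qed.

Lemma mpolyX_upd1_sub a i (x : 'I_(a i)) :
  'X_[upd1 a i x] * 'X_i ^+ (a i - x) = 'X_[a] :> {mpoly K[N]}.
Proof.
rewrite mpolyXn -mpolyXD; congr 'X_[_]; apply/mnmP => k.
rewrite mnmDE mulmnE mnm1E upd1E [i == k]eq_sym; case: (k =P i) => [->|_] //=; last by rewrite addn0.
by have := ltn_ord x; lia.
Qed.

Lemma phi_fcher i u : phi (fcher i u) = cherednik b i (phi u).
Proof.
apply: (malg_lin_ext (f := phi \o fcher i) (g := cherednik b i \o phi)) => -[a s].
rewrite /= /fcher flinU /phi flinU /fcher_mono /= !linearD !linearN !linearZ /=.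
rewrite !flinU -!scalerDr scalerN.
rewrite /cherednik {4}/phi_mono mderivM mulrDr; congr (_ + _ + _).
- by rewrite mulrA mulX_derivX -scalerAl.
- rewrite deriv_psums flin_sum mulrCA !mulr_sumr; apply: eq_big_seq => r rs /=.
  rewrite linearZ /= flinU /phi_mono /= mpolyX_upd1D -!scalerAr; case: r {rs} => [|r].
    by rewrite !scale0r.
  by congr (_ *: _); rewrite exprS; ring.
congr (_ *: _); rewrite !flin_sum /=.
(* The power sums are symmetric, so they pass through the divided differences. *)
transitivity (psums s * \sum_(j < N | j != i) 'X_j * ddiff i j 'X_[a]); last first.
  rewrite mulr_sumr; apply: eq_bigr => j nj; rewrite /phi_mono /= mulrCA; congr (_ * _).
  by rewrite ['X_[a] * _]mulrC ddiff_mulr ?msym_psums // eq_sym.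
under [in RHS]eq_bigr => j nj do rewrite mulX_ddiff_mono //.
rewrite big_split /= [in RHS]sumrN mulrBr; congr (_ - _).
  rewrite exchange_big /= mulr_sumr.
  transitivity (\sum_(x < a i) (phi_mono (upd1 a i x, ins (a i - x) s) - phi_mono (a, s))).
    rewrite sumrB; congr (_ - _); first by apply: eq_bigr => x _; rewrite flinU.
    by rewrite sumr_const card_ord scaler_nat.
  apply: eq_bigr => x _; rewrite /phi_mono /= psums_ins -mulr_sumr.
  rewrite {1}/psum (bigD1 i) //= -(mpolyX_upd1_sub x); ring.
rewrite mulr_sumr; apply: eq_bigr => j nj; rewrite flin_sum mulr_sumr.
by apply: eq_bigr => x _; rewrite /= flinU /phi_mono /= mulrC.
Qed.

End Formal.

Section FormalIntertwine.
Variables (K : fieldType) (N m : nat) (b : K).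
Implicit Types (i j l : 'I_N) (a c : 'X_{1..N}) (s t : seq nat).
Local Notation FF := {malg K[fidx N]}.
Local Notation "'b_ k" := (monalg.mkmalgU (k : fidx N) 1 : FF) (at level 8, k at level 2).

Lemma phi_fdunkl i u : (m <= i)%N -> supported (fun k : fidx N => k.1 i = 0%N) u ->
  phi (fdunkl m b i u) = dunkl m b i (phi u).
Proof.
move=> mi; apply: (supported_ext (f := @phi K N \o fdunkl m b i) (g := dunkl m b i \o @phi K N)).
move=> [a s] /= ai; rewrite /phi /fdunkl !flinU /fdunkl_mono /= linearB linearZ /=.
rewrite /dunkl {4}/phi_mono mderivM /= deriv_psums mderivX ai scale0r mul0r add0r.
congr (_ + _).
  rewrite flin_sum mulr_sumr; apply: eq_bigr => r _; rewrite linearZ /= flinU /phi_mono /= add0n.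
  rewrite -scalerAr; congr (_ *: _); rewrite mulrA; congr (_ * _).
  by rewrite -[r.-1]add0n -{1}ai mpolyX_upd1D mulrC.
rewrite -scalerN; congr (_ *: _); rewrite flin_sum -sumrN; apply: eq_bigr => l lm.
have nl : i != l by apply: contraTneq lm => <-; rewrite -leqNgt.
rewrite flin_sum /phi_mono /= mulrC ddiff_mulr ?msym_psums // /ddiff mlinX /ddiff_mono.
rewrite ai big_ord0 add0r mulrN; congr (- _); rewrite mulr_sumr; apply: eq_bigr => x _.
by rewrite flinU /phi_mono /= add0n mulrC.
Qed.

(** Applied to [g(xi_i) B_i p] with [i] bosonic and [p] symmetric in the bosonic variables, the
    exchange of [i] and [j] turns the term of index [i] into that of index [j], so that the sum is
    the whole bosonic part of the Hamiltonian. *)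
Definition bose_sum i (p : {mpoly K[N]}) : {mpoly K[N]} :=
  \sum_(j < N | (m <= j)%N) msym (tperm i j) ('X_i * p).
Lemma bose_sum_is_linear i : linear (bose_sum i).
Proof.
move=> x p q; rewrite /bose_sum scaler_sumr -big_split; apply: eq_bigr => j _ /=.
by rewrite mulrDr msymD -scalerAr msymZ.
Qed.
HB.instance Definition _ i :=
  GRing.isLinear.Build K {mpoly K[N]} {mpoly K[N]} _ (bose_sum i) (bose_sum_is_linear i).

(** Among the variables from index [m] on, only [x_m] occurs in the monomial, so the exchange with
    [x_j] moves its whole power to [x_j] and fixes the rest. *)
Lemma phi_fsum i u : i = m :> nat ->
  supported (fun k : fidx N => forall j, (m < j)%N -> k.1 j = 0%N) u ->
  phi (fsum m i u) = bose_sum i (phi u).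
Proof.
move=> im; apply: (supported_ext (f := @phi K N \o fsum m i) (g := bose_sum i \o @phi K N)).
move=> [a s] /= aj; rewrite /phi /fsum !flinU /fsum_mono /= linearB /=.
rewrite [X in _ - X]flin_sum; rewrite [X in X - _]flinU; rewrite /bose_sum /phi_mono /= psums_ins.
transitivity ('X_[upd1 a i 0] * psums K N s * \sum_(j < N | (m <= j)%N) 'X_j ^+ (a i).+1).
  rewrite {1}/psum (bigID (fun j : 'I_N => m <= j)%N) /=; set A := \sum_(j < N | _) _.
  rewrite (eq_bigl (fun j : 'I_N => j < m)%N) => [|j]; last by rewrite -ltnNge.
  set B := \sum_(l < N | _) _; set C := \sum_(l < N | _) flin _ _.
  have -> : C = 'X_[upd1 a i 0] * psums K N s * B.
    rewrite mulr_sumr; apply: eq_bigr => l lm; rewrite flinU /phi_mono /= mulrAC; congr (_ * _).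
    rewrite mpolyXn -mpolyXD; congr 'X_[_]; apply/mnmP => k.
    rewrite mnmDE mulmnE mnm1E upd2E upd1E [l == k]eq_sym; case: (k =P i) => [->|_].
      by case: eqP => // e; move: lm; rewrite -e im ltnn.
    by case: (k =P l) => [->|_]; lia.
  by ring.
rewrite mulr_sumr; apply: eq_bigr => j mj.
have E : msym (tperm i j) 'X_[a] = 'X_[upd1 a i 0] * 'X_j ^+ a i :> {mpoly K[N]}.
  have [eij|nij] := eqVneq i j.
    rewrite -eij tperm1 msymX invg1 mpolyXn -mpolyXD; congr 'X_[_]; apply/mnmP => k.
    rewrite mnmE perm1 mnmDE mulmnE mnm1E upd1E [i == k]eq_sym.
    by case: (k =P i) => [->|_]; lia.
  rewrite msym_tpermX // mpolyXn -mpolyXD; congr 'X_[_]; apply/mnmP => k.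
  rewrite mnmDE mulmnE mnm1E upd2E upd1E [j == k]eq_sym.
  have aj0 : a j = 0%N.
    by apply: aj; rewrite ltn_neqAle mj andbT -im; apply: contra_neq nij => /ord_inj.
  case: (k =P i) => [->|_]; first by rewrite aj0 (negbTE nij).
  by case: (k =P j) => [->|_]; lia.
by rewrite !msymM msymXi tpermL msym_psums E exprS; ring.
Qed.

End FormalIntertwine.

(** * Adjointness of the lifted operators *)

Section FormalAdjoint.
Variables (K : fieldType) (N m : nat) (b : K).
Hypothesis b0 : b != 0.
Implicit Types (i j l : 'I_N) (a c : 'X_{1..N}) (s t : seq nat) (k h : fidx N).
Local Notation FF := {malg K[fidx N]}.
Local Notation "'b_ k" := (monalg.mkmalgU (k : fidx N) 1 : FF) (at level 8, k at level 2).

(* [e] is the loss of degree caused by [fdunkl]. *)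
Definition good M e d k := [/\ sorted geq k.2, 0%N \notin k.2,
  forall j, (M <= j)%N -> k.1 j = 0%N & (mdeg k.1 + sumn k.2 + e = d)%N].

Lemma geq_trans : transitive geq. Proof. by move=> x y z /= h1 h2; apply: leq_trans h2 h1. Qed.
Lemma geq_anti : antisymmetric geq. Proof. by move=> x y /=; rewrite andbC => /anti_leq. Qed.
Lemma geq_total : total geq. Proof. by move=> x y; apply: leq_total. Qed.

Lemma eq_ins r s t : sorted geq t -> (ins r s == t) = perm_eq t (r :: s).
Proof.
move=> st; apply/eqP/idP => [<-|p]; first exact: perm_ins.
apply: (sorted_eq geq_trans geq_anti); rewrite ?sort_sorted //; first exact: geq_total.
by rewrite perm_sort perm_sym.
Qed.

Lemma eq_rem r s t : sorted geq s -> sorted geq t -> r \in s ->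
  (rem r s == t) = perm_eq s (r :: t).
Proof.
move=> ss st rs; apply/eqP/idP => [<-|p]; first exact: perm_to_rem.
apply: (sorted_eq geq_trans geq_anti) => //.
  exact: (subseq_sorted geq_trans (rem_subseq r s)).
by rewrite -(perm_cons r) -(permPl (perm_to_rem rs)).
Qed.

Lemma eq_upd1 a c i : (upd1 a i (c i) == c) = (upd1 c i (a i) == a).
Proof.
by apply/eqP/eqP => /mnmP e; apply/mnmP => j; have := e j; rewrite !upd1E;
  case: eqP => [->|].
Qed.

Lemma wt_rem a c r s : r \in s ->
  b * wt b (a, s) = (r * count_mem r s)%:R * wt b (c, rem r s).
Proof.
move=> rs; rewrite /wt /= (zee_rem rs) size_rem //.
case: s rs => // x s rs /=; rewrite exprS invfM !mulrA mulfV // mul1r.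
by rewrite natrM; ring.
Qed.

Lemma mcoeff_b k h : 'b_k @[h] = (k == h)%:R.
Proof. by rewrite mcoeffU. Qed.

Lemma mcoeff_bsum (T : Type) (r : seq T) (P : pred T) (F : T -> fidx N) h :
  (\sum_(x <- r | P x) 'b_(F x)) @[h] = \sum_(x <- r | P x) (F x == h)%:R.
Proof. by rewrite raddf_sum; apply: eq_bigr => x _; rewrite /= mcoeff_b. Qed.

Definition raise_coef i k h : K :=
  \sum_(r <- k.2) r%:R * ((upd1 k.1 i (k.1 i + r), rem r k.2) == h)%:R.
Definition lower_coef i k h : K :=
  \sum_(x < k.1 i) ((upd1 k.1 i x, ins (k.1 i - x) k.2) == h)%:R.
Definition exchange_coef i k h : K :=
  \sum_(l < N | l != i) \sum_(x < k.1 l)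
     ((upd2 k.1 i l x (k.1 i + k.1 l - x), k.2) == h)%:R.

Lemma mcoeff_fcher i k h : (fcher_mono b i k) @[h] =
  (k.1 i)%:R * (k == h)%:R + raise_coef i k h
  + b * (lower_coef i k h - (k.1 i)%:R * (k == h)%:R - exchange_coef i k h).
Proof.
rewrite /fcher_mono monalg.mcoeffD [X in X + _ = _]monalg.mcoeffD [X in X + _ + _]monalg.mcoeffZ.
rewrite [X in _ + X = _]monalg.mcoeffZ 2!monalg.mcoeffB [X in _ - X - _]monalg.mcoeffZ mcoeff_b mcoeff_bsum.
congr (_ + _ + _ * (_ - _ - _)).
  by rewrite raddf_sum; apply: eq_bigr => r _; rewrite /= monalg.mcoeffZ mcoeff_b.
by rewrite raddf_sum; apply: eq_bigr => l _; rewrite /= mcoeff_bsum.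
Qed.

Lemma lower_coefE i k h : sorted geq h.2 -> lower_coef i k h =
  [&& h.1 i < k.1 i, upd1 k.1 i (h.1 i) == h.1 & perm_eq h.2 ((k.1 i - h.1 i) :: k.2)]%N%:R.
Proof.
move=> sh; rewrite /lower_coef; case: ltnP => [lt|le] /=.
  rewrite (bigD1 (Ordinal lt)) //= big1 ?addr0 => [|x nx].
    by rewrite -pair_eqE /pair_eq /= eq_ins.
  rewrite -pair_eqE /pair_eq /=; case: eqP => //= e; case/eqP: nx; apply/val_inj => /=.
  by rewrite -e upd1E eqxx.
rewrite big1 // => x _; rewrite -pair_eqE /pair_eq /=; case: eqP => //= e.
by move: le; rewrite -e upd1E eqxx leqNgt ltn_ord.
Qed.

(** Turning a part [r] into [r x_i^r] and turning [x_i^r] back into a part are adjoint up to [b]: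
    removing the part multiplies the weight by [b] and divides it by [r] times its multiplicity,
    which is the coefficient of the first move. *)
Lemma raise_lower_coef i k h : sorted geq k.2 -> 0%N \notin k.2 -> sorted geq h.2 ->
  raise_coef i k h * wt b h = b * lower_coef i h k * wt b k.
Proof.
move=> sk zk sh; rewrite lower_coefE // /raise_coef; set r0 := (h.1 i - k.1 i)%N.
rewrite (sum_seq_single (r := r0)) => [|x xk nx]; last first.
  rewrite -pair_eqE /pair_eq /=; case: eqP => //= e; last by rewrite mulr0.
  by case/eqP: nx; rewrite /r0 -e upd1E eqxx addKn.
case: ltnP => [lt|le] /=; last first.
  rewrite (_ : r0 = 0%N); last by apply/eqP; rewrite subn_eq0.
  by rewrite mul0r mul0rn mulr0 !mul0r.
have [rk|nrk] := boolP (r0 \in k.2); last first.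
  rewrite (count_memPn nrk) mulr0n mul0r.
  case: (boolP (perm_eq k.2 _)) => [p|_]; last by rewrite andbF mulr0 mul0r.
  by move: nrk; rewrite (perm_mem p) mem_head.
rewrite -pair_eqE /pair_eq /= subnKC ?(ltnW lt) // eq_upd1 eq_rem //.
case: andP => [[e p]|_]; last by rewrite mulr0 mul0rn mulr0 !mul0r.
rewrite !mulr1 (surjective_pairing k) /= (wt_rem _ h.1 rk).
have -> : rem r0 k.2 = h.2 by apply/eqP; rewrite eq_rem.
by rewrite -surjective_pairing natrM mulr_natr.
Qed.

(** A move from [a] to [c] keeps [a_i + a_l] and requires [c_i < a_l]. By conservation of the sum
    this is the same as [a_i < c_l], the condition for the reverse move. *)
Lemma exchange_coefC i k h :
  exchange_coef i k h * wt b h = exchange_coef i h k * wt b k.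
Proof.
rewrite /exchange_coef; case: k h => [a s] [c t] /=.
have [->|nst] := eqVneq s t; last first.
  have Z a' c' s' t' : s' != t' -> \sum_(l < N | l != i) \sum_(x < a' l)
      ((upd2 a' i l x (a' i + a' l - x), s') == (c', t') :> fidx N)%:R = 0 :> K.
    move=> ne; rewrite big1 // => l _; rewrite big1 // => x _.
    by rewrite -pair_eqE /pair_eq /= (negbTE ne) andbF.
  by rewrite !Z ?mul0r // eq_sym.
congr (_ * _); apply: eq_bigr => l nl.
have E a' c' : \sum_(x < a' l) ((upd2 a' i l x (a' i + a' l - x), t) == (c', t) :> fidx N)%:R
   = ((c' i < a' l)%N && (upd2 a' i l (c' i) (a' i + a' l - c' i) == c'))%:R :> K.
  case: ltnP => [lt|le] /=.
    rewrite (bigD1 (Ordinal lt)) //= big1 ?addr0 => [|x nx].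
      by rewrite -pair_eqE /pair_eq /= eqxx andbT.
    rewrite -pair_eqE /pair_eq /=; case: eqP => //= e; case/eqP: nx; apply/val_inj => /=.
    by rewrite -e upd2E eqxx.
  rewrite big1 // => x _; rewrite -pair_eqE /pair_eq /=; case: eqP => //= e.
  by move: le; rewrite -e upd2E eqxx leqNgt ltn_ord.
rewrite !E; congr (nat_of_bool _)%:R.
have H a' c' : (c' i < a' l)%N && (upd2 a' i l (c' i) (a' i + a' l - c' i) == c') ->
     (a' i < c' l)%N && (upd2 c' i l (a' i) (c' i + c' l - a' i) == a').
  case/andP => lt /eqP/mnmP e.
  have := e l; rewrite upd2E (negbTE nl) eqxx => el.
  apply/andP; split; first by lia.
  apply/eqP/mnmP => j; have := e j; rewrite !upd2E; case: eqP => [->|_] //.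
  by case: eqP => [->|_] // _; lia.
by apply/idP/idP; apply: H.
Qed.

(** The coefficient [b] of the moves from exponents to parts is the one that makes them adjoint to
    the moves back; the diagonal and the exchanges are symmetric. *)
Lemma fcher_adjoint M e d i u v : supported (good M e d) u -> supported (good M e d) v ->
  wform (wt b) (fcher b i u) v = wform (wt b) u (fcher b i v).
Proof.
apply: wform_adjoint => k h [sk zk _ _] [sh zh _ _].
have R1 := raise_lower_coef i sk zk sh.
have R2 := raise_lower_coef i sh zh sk.
have X := exchange_coefC i k h.
have D : (k.1 i)%:R * (k == h)%:R * wt b h = (h.1 i)%:R * (h == k)%:R * wt b k.
  by rewrite [h == k]eq_sym; case: eqP => [->//|_]; rewrite !mulr0 !mul0r.
rewrite !mcoeff_fcher.
have dist (A r l x w : K) : (A + r + b * (l - A - x)) * w =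
    A * w + r * w + (b * l * w - b * (A * w) - b * (x * w)) by ring.
by rewrite !dist R1 R2 X D; ring.
Qed.

End FormalAdjoint.

Section FormalDunklAdjoint.
Variables (K : fieldType) (N m : nat) (b : K).
Hypothesis b0 : b != 0.
Implicit Types (i j l : 'I_N) (a c : 'X_{1..N}) (s t : seq nat) (k h : fidx N).
Local Notation FF := {malg K[fidx N]}.
Local Notation "'b_ k" := (monalg.mkmalgU (k : fidx N) 1 : FF) (at level 8, k at level 2).

Lemma fdunkl_raise_coef i k h : sorted geq k.2 -> sorted geq h.2 -> 0%N \notin h.2 ->
  h.1 i = 0%N ->
  b * ((upd1 k.1 i 0, ins (k.1 i).+1 k.2) == h)%:R * wt b h =
  (\sum_(r <- h.2) r%:R * ((upd1 h.1 i (h.1 i + r).-1, rem r h.2) == k)%:R) * wt b k.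
Proof.
move=> sk sh zh hi; rewrite (sum_seq_single (r := (k.1 i).+1)) => [|x xh nx]; last first.
  rewrite -pair_eqE /pair_eq /=; case: eqP => //= e; last by rewrite mulr0.
  case/eqP: nx; rewrite -e upd1E eqxx hi add0n prednK // lt0n.
  by apply: contraNneq zh => <-.
rewrite hi add0n /= -!pair_eqE /pair_eq /= eq_ins // -{1}hi eq_upd1.
have [rh|nrh] := boolP ((k.1 i).+1 \in h.2); last first.
  rewrite (count_memPn nrh) mulr0n mul0r.
  case: (boolP (perm_eq h.2 _)) => [p|_]; last by rewrite andbF mulr0 mul0r.
  by move: nrh; rewrite (perm_mem p) mem_head.
rewrite eq_rem //; case: andP => [[e p]|_]; last by rewrite !mulr0 mul0rn !mul0r.
rewrite !mulr1 (surjective_pairing h) /= (wt_rem b0 _ k.1 rh).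
have -> : rem (k.1 i).+1 h.2 = k.2 by apply/eqP; rewrite eq_rem.
by rewrite -surjective_pairing natrM mulr_natr.
Qed.

Lemma fdunkl_exchange_coef i k h l : i != l -> h.1 i = 0%N ->
  ((upd2 k.1 i l 0 (k.1 l + k.1 i).+1, k.2) == h)%:R * wt b h =
  (\sum_(x < h.1 l) ((upd2 h.1 i l x ((h.1 l).-1 - x), h.2) == k)%:R) * wt b k.
Proof.
move=> nil hi; case: k h hi => [a s] [c t] /= ci.
have [->|nst] := eqVneq s t; last first.
  have Z (F : 'I_(c l) -> 'X_{1..N}) : \sum_x ((F x, t) == (a, s) :> fidx N)%:R = 0 :> K.
    by apply: big1 => x _; rewrite -pair_eqE /pair_eq /= [t == s]eq_sym (negbTE nst) andbF.
  by rewrite Z -pair_eqE /pair_eq /= (negbTE nst) andbF !mul0r.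
congr (_ * _); rewrite -pair_eqE /pair_eq /= eqxx andbT.
have [/eqP/mnmP e|ne] := boolP (upd2 a i l 0 (a l + a i).+1 == c).
  have := e l; rewrite upd2E eq_sym (negbTE nil) eqxx => el.
  have lt : (a i < c l)%N by lia.
  rewrite (bigD1 (Ordinal lt)) //= big1 ?addr0 => [|x nx].
    rewrite andbT (_ : _ == a) //.
    apply/eqP/mnmP => j; rewrite upd2E; have := e j; rewrite upd2E.
    case: eqP => [->//|_]; case: eqP => [->|//]; lia.
  rewrite andbT; case: eqP => //= e'; case/eqP: nx; apply/val_inj => /=.
  by rewrite -e' upd2E eqxx.
rewrite big1 // => x _; rewrite andbT; case: eqP => //= /mnmP e.
case/eqP: ne; apply/mnmP => j; rewrite upd2E; have := e j; rewrite upd2E.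
have := e i; have := e l; rewrite !upd2E eqxx [l == i]eq_sym (negbTE nil) eqxx => el ei.
case: (j =P i) => [->//|_]; case: (j =P l) => [->|//].
by have := ltn_ord x; lia.
Qed.

(** Adding the part [r = a_i + 1] is adjoint, up to [b], to deriving a part [r] into [x_i^(r - 1)].
    Collecting the exponents of [x_i] and [x_l] in [x_l] is adjoint to splitting the exponent of
    [x_l]. *)
Lemma fsum_adjoint i d u v : i = m :> nat ->
  supported (good m.+1 1 d) u -> supported (good m 0 d) v ->
  b * wform (wt b) (fsum m i u) v = wform (wt b) u (fdunkl m b i v).
Proof.
move=> im su sv.
have -> : b * wform (wt b) (fsum m i u) v = wform (wt b) (b *: fsum m i u) v.
  by have := wform_linear (wt b) v b (fsum m i u) 0;
     rewrite /wform monalg.msupp0 big_seq_fset0 !addr0 => ->.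
have -> : b *: fsum m i u = flin (fun k => b *: fsum_mono K m i k) u.
  by rewrite /fsum /flin scaler_sumr; apply: eq_bigr => k _; rewrite !scalerA mulrC.
apply: wform_adjoint su sv => k h [sk zk _ _] [sh zh hm _].
have hi : h.1 i = 0%N by apply: hm; rewrite im.
rewrite monalg.mcoeffZ /fsum_mono monalg.mcoeffB mcoeff_b mcoeff_bsum.
rewrite /fdunkl_mono monalg.mcoeffB monalg.mcoeffZ.
rewrite [X in _ = (X - _) * _]raddf_sum [X in _ = (_ - _ * X) * _]raddf_sum /=.
under [X in _ = (X - _) * _]eq_bigr do rewrite monalg.mcoeffZ mcoeff_b.
under [X in _ = (_ - _ * X) * _]eq_bigr do rewrite mcoeff_bsum.
rewrite mulrBr !mulrBl fdunkl_raise_coef //; congr (_ - _).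
rewrite -!mulrA; congr (_ * _); rewrite !mulr_suml; apply: eq_bigr => l lm.
rewrite fdunkl_exchange_coef //.
by apply: contraTneq lm => <-; rewrite im ltnn.
Qed.

End FormalDunklAdjoint.

(** * Variables and degrees of the lifted vectors *)

Section FormalSupport.
Variables (K : fieldType) (N m : nat) (b : K).
Implicit Types (i j l : 'I_N) (a c : 'X_{1..N}) (s t : seq nat) (k h : fidx N).
Local Notation FF := {malg K[fidx N]}.

Lemma sumn_ins r s : sumn (ins r s) = (r + sumn s)%N.
Proof. by rewrite (perm_sumn (perm_ins r s)). Qed.

Lemma sumn_rem r s : r \in s -> (r + sumn (rem r s) = sumn s)%N.
Proof. by move=> /perm_to_rem/perm_sumn ->. Qed.

Lemma sorted_ins r s : sorted geq (ins r s).
Proof. exact/sort_sorted/geq_total. Qed.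

Lemma ins0 r s : (0 < r)%N -> 0%N \notin s -> 0%N \notin ins r s.
Proof. by move=> r0 zs; rewrite (perm_mem (perm_ins r s)) inE negb_or zs eq_sym -lt0n r0. Qed.

Lemma rem0 r s : 0%N \notin s -> 0%N \notin rem r s.
Proof. by apply: contra; apply: mem_rem. Qed.

Lemma sorted_rem r s : sorted geq s -> sorted geq (rem r s).
Proof. by move=> ss; apply: (subseq_sorted geq_trans (rem_subseq r s)). Qed.

Lemma mdeg_upd1 a i x : (mdeg (upd1 a i x) + a i = mdeg a + x)%N.
Proof.
rewrite !mdegE (bigD1 i) //= [in RHS](bigD1 i) //= upd1E eqxx.
rewrite (eq_bigr (fun j => a j)); first by lia.
by move=> j /negbTE nj; rewrite upd1E nj.
Qed.

Lemma mdeg_upd2 a i l x y : i != l -> (mdeg (upd2 a i l x y) + (a i + a l) = mdeg a + (x + y))%N.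
Proof. by move=> nil; rewrite !mdegE (sum_upd2 (fun _ z => z) a x y nil). Qed.

Lemma supported_fcher M e d i u : (i < M)%N ->
  supported (good M e d) u -> supported (good M e d) (fcher b i u).
Proof.
move=> iM; apply: supported_flin => -[a s] [/= ss zs aM dg].
have iM' j : (M <= j)%N -> j != i by move=> Mj; apply: contraTneq Mj => ->; rewrite -ltnNge.
rewrite /fcher_mono /=; apply: supportedD; [apply: supportedD|(apply: supportedZ; apply: supportedD)].
- by (apply: supportedZ; apply: supportedU).
- rewrite big_seq; apply: supported_sum => r rs; apply: supportedZ; apply: supportedU; split=> /=.
  + exact: sorted_rem.
  + exact: rem0.
  + by move=> j Mj; rewrite upd1E (negbTE (iM' _ Mj)) aM.
  by have := mdeg_upd1 a i (a i + r); have := sumn_rem rs; lia.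
- apply: supportedD; last by (apply: supportedN; apply: supportedZ; apply: supportedU).
  apply: supported_sum => x _; apply: supportedU; have := ltn_ord x => lt; split=> /=.
  + exact: sorted_ins.
  + by apply: ins0 => //; lia.
  + by move=> j Mj; rewrite upd1E (negbTE (iM' _ Mj)) aM.
  by have := mdeg_upd1 a i x; rewrite sumn_ins; lia.
apply: supportedN; apply: supported_sum => l nl; apply: supported_sum => x _.
apply: supportedU; have lt := ltn_ord x; split=> //=.
  move=> j Mj; rewrite upd2E (negbTE (iM' _ Mj)); case: eqP => [ejl|_]; last exact: aM.
  by have := aM j Mj; rewrite ejl; lia.
have nil : i != l by rewrite eq_sym.
by have := mdeg_upd2 a x (a i + a l - x) nil; lia.
Qed.

(** The variable [x_m] may appear and one degree is lost; [supported_fsum] undoes both. *)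
Lemma supported_fdunkl d i u : i = m :> nat ->
  supported (good m 0 d) u -> supported (good m.+1 1 d) (fdunkl m b i u).
Proof.
move=> im; apply: supported_flin => -[a s] [/= ss zs am dg].
have ai : a i = 0%N by apply: am; rewrite im.
have im' j : (m.+1 <= j)%N -> j != i by move=> Mj; apply: contraTneq Mj => ->; rewrite im ltnn.
rewrite /fdunkl_mono /=; apply: supportedD; last (apply: supportedN; apply: supportedZ).
  rewrite big_seq; apply: supported_sum => r rs; apply: supportedZ; apply: supportedU; split=> /=.
  - exact: sorted_rem.
  - exact: rem0.
  - by move=> j Mj; rewrite upd1E (negbTE (im' _ Mj)) am // ltnW.
  have r0 : (0 < r)%N by rewrite lt0n; apply: contraTneq rs => ->.
  by have := mdeg_upd1 a i (a i + r).-1; have := sumn_rem rs; lia.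
apply: supported_sum => l lm; apply: supported_sum => x _.
have nil : i != l by apply: contraTneq lm => <-; rewrite im ltnn.
apply: supportedU; have lt := ltn_ord x; split=> //=.
  move=> j Mj; rewrite upd2E (negbTE (im' _ Mj)); case: eqP => [ejl|_]; last by apply/am/ltnW.
  by have := am j (ltnW Mj); rewrite ejl; lia.
by have := mdeg_upd2 a x ((a l).-1 - x) nil; lia.
Qed.

Lemma supported_fsum d i (u : FF) : i = m :> nat ->
  supported (good m.+1 1 d) u -> supported (good m 0 d) (fsum m i u).
Proof.
move=> im; apply: supported_flin => -[a s] [/= ss zs am dg].
have im' j : (m <= j)%N -> j != i -> (m < j)%N.
  by move=> mj nj; rewrite ltn_neqAle mj andbT -im; apply: contra_neq nj => /ord_inj.
rewrite /fsum_mono /=; apply: supportedD; [|apply: supportedN].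
  apply: supportedU; split=> /=.
  - exact: sorted_ins.
  - exact: ins0.
  - by move=> j mj; rewrite upd1E; case: eqP => [//|/eqP nj]; apply/am/im'.
  by have := mdeg_upd1 a i 0; rewrite sumn_ins; lia.
apply: supported_sum => l lm.
have nil : i != l by apply: contraTneq lm => <-; rewrite im ltnn.
apply: supportedU; split=> //=.
  move=> j mj; rewrite upd2E; case: eqP => [//|/eqP nj].
  by case: eqP => [ejl|_]; [move: lm; rewrite -ejl ltnNge mj | apply/am/im'].
by have := mdeg_upd2 a 0 (a l + a i).+1 nil; lia.
Qed.

End FormalSupport.

(** * The lifted Hamiltonian *)

Section FormalHamiltonian.
Variables (K : fieldType) (N m : nat) (b : K) (f g : {poly K}) (i0 : 'I_N) (d : nat).
Hypotheses (b0 : b != 0) (im : i0 = m :> nat).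
Implicit Types (i j l : 'I_N) (u v : {malg K[fidx N]}).

(** One bosonic variable, of index [m], stands for all of them; the summation over the others is
    contained in [fsum]. *)
Definition fhamiltonian u :=
  \sum_(i < N | (i < m)%N) op_poly f (fcher b i) u
  + fsum m i0 (op_poly g (fcher b i0) (fdunkl m b i0 u)).

Lemma supported_op_poly M e (h : {poly K}) i u : (i < M)%N ->
  supported (good M e d) u -> supported (good M e d) (op_poly h (fcher b i) u).
Proof.
move=> iM su; apply: supported_sum => r _; apply: supportedZ.
by elim: (r : nat) => //= k IH; apply: supported_fcher.
Qed.

Lemma supported_fhamiltonian u :
  supported (good m 0 d) u -> supported (good m 0 d) (fhamiltonian u).
Proof.
move=> su; apply: supportedD.
  by apply: supported_sum => i lim; apply: (@supported_op_poly m 0 f i u lim su).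
have imS : (i0 < m.+1)%N by rewrite im.
have sd : supported (good m.+1 1 d) (fdunkl m b i0 u) by exact: supported_fdunkl.
have so := @supported_op_poly m.+1 1 g i0 _ imS sd.
by apply: supported_fsum => //; apply: so.
Qed.

Lemma wformD u u' v :
  wform (wt b) (u + u') v = wform (wt b) u v + wform (wt b) u' v.
Proof. by have := wform_linear (wt b) v 1 u u'; rewrite /= scale1r mul1r. Qed.

Lemma wform_sum (T : Type) (r : seq T) (P : pred T) (F : T -> {malg K[fidx N]}) v :
  wform (wt b) (\sum_(t <- r | P t) F t) v = \sum_(t <- r | P t) wform (wt b) (F t) v.
Proof.
have p0 : wform (wt b) 0 v = 0 by rewrite /wform monalg.msupp0 big_seq_fset0.
apply: (big_morph (fun u => wform (wt b) u v) _ p0) => x y.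
exact: wformD.
Qed.

Lemma wformZ a u v : wform (wt b) (a *: u) v = a * wform (wt b) u v.
Proof.
have p0 : wform (wt b) 0 v = 0 by rewrite /wform monalg.msupp0 big_seq_fset0.
by have := wform_linear (wt b) v a u 0; rewrite /= p0 !addr0.
Qed.

Lemma op_poly_adjoint M e h i u v : (i < M)%N ->
  supported (good M e d) u -> supported (good M e d) v ->
  wform (wt b) (op_poly h (fcher b i) u) v = wform (wt b) u (op_poly h (fcher b i) v).
Proof.
move=> iM su sv; rewrite /op_poly wform_sum wformC wform_sum; apply: eq_bigr => r _.
rewrite [LHS]wformZ [RHS]wformZ; congr (_ * _); rewrite [RHS]wformC.
have si n w : supported (good M e d) w -> supported (good M e d) (iter n (fcher b i) w).
  by move=> sw; elim: n => //= n IH; apply: supported_fcher.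
elim: (r : nat) v sv => //= k IH v sv.
rewrite (fcher_adjoint b0 (M := M) (e := e) (d := d) i (si k u su) sv) IH -?iterSr //.
exact: supported_fcher.
Qed.

Lemma msym_phi i j u : supported (good m 0 d) u -> (m <= i)%N -> (m <= j)%N ->
  msym (tperm i j) (phi u) = phi u.
Proof.
move=> su mi mj.
apply: (supported_ext (f := msym (tperm i j) \o @phi K N) (g := @phi K N) _ su).
move=> [a s] [/= _ _ am _]; rewrite /phi !flinU /phi_mono /= msymM msym_psums.
have [->|nij] := eqVneq i j; first by rewrite tperm1 msymX invg1; congr ('X_[_] * _); apply/mnmP => k; rewrite mnmE perm1.
rewrite msym_tpermX //; congr ('X_[_] * _); apply/mnmP => k; rewrite upd2E.
by case: eqP => [->|_]; [rewrite !am | case: eqP => [->|_//]; rewrite !am].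
Qed.

Lemma phi_op_poly h i u : phi (op_poly h (fcher b i) u) = op_poly h (cherednik b i) (phi u).
Proof.
rewrite /op_poly /phi flin_sum; apply: eq_bigr => r _; rewrite linearZ; congr (_ *: _).
by elim: (r : nat) => //= k IH; rewrite -IH -/(phi _) phi_fcher.
Qed.

Lemma phi_fhamiltonian u : supported (good m 0 d) u ->
  phi (fhamiltonian u) = hamiltonian m b f g (phi u).
Proof.
move=> su; rewrite /fhamiltonian (linearD (@phi K N)) /hamiltonian; congr (_ + _).
  by rewrite (linear_sum (@phi K N)); apply: eq_bigr => i _; apply: phi_op_poly.
have smi : (m <= i0)%N by rewrite im.
have imS : (i0 < m.+1)%N by rewrite im.
have sd : supported (good m.+1 1 d) (fdunkl m b i0 u) by exact: supported_fdunkl.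
set w := op_poly g _ _.
have sw : supported (fun k : fidx N => forall j, (m < j)%N -> k.1 j = 0%N) w.
  move=> k nk j mj.
  have [_ _ h _] := @supported_op_poly m.+1 1 g i0 _ imS sd k nk.
  by apply: h => //; rewrite im.
rewrite /= (phi_fsum im sw) {sw}/w.
rewrite /bose_sum; apply: eq_bigr => j mj.
rewrite phi_op_poly phi_fdunkl //; last first.
  by move=> k /su [_ _ h _]; apply: h.
transitivity (msym (tperm i0 j) (bose_op m b g i0 (phi u))); first by [].
have tm l : (tperm i0 j l < m)%N = (l < m)%N by case: tpermP => [->|->|//]; lia.
by rewrite (msym_bose b g _ tm smi) tpermL; congr (bose_op m b g j _); apply: msym_phi.
Qed.

(** Moving [fsum] to the other side as [fdunkl] pairs [g(xi)] of one Dunkl image with the other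
    Dunkl image, and this is symmetric in [u] and [v] because [xi] is self-adjoint. *)
Lemma fhamiltonian_adjoint u v :
  supported (good m 0 d) u -> supported (good m 0 d) v ->
  wform (wt b) (fhamiltonian u) v = wform (wt b) u (fhamiltonian v).
Proof.
move=> su sv; rewrite /fhamiltonian wformD [RHS]wformC wformD; congr (_ + _).
  rewrite [LHS]wform_sum [RHS]wform_sum; apply: eq_bigr => i lim.
  by rewrite [RHS]wformC; apply: (op_poly_adjoint (M := m) (e := 0)).
have sdu : supported (good m.+1 1 d) (fdunkl m b i0 u) by exact: supported_fdunkl.
have sdv : supported (good m.+1 1 d) (fdunkl m b i0 v) by exact: supported_fdunkl.
have imS : (i0 < m.+1)%N by rewrite im.
have sou := @supported_op_poly m.+1 1 g i0 _ imS sdu.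
have sov := @supported_op_poly m.+1 1 g i0 _ imS sdv.
apply: (mulfI b0).
have E1 := fsum_adjoint b0 im sou sv; have E2 := fsum_adjoint b0 im sov su.
rewrite [LHS]E1 [RHS]E2 [RHS]wformC; exact: (op_poly_adjoint (M := m.+1) (e := 1)).
Qed.

End FormalHamiltonian.

(** * Injectivity of the map to polynomials in low degree *)

Section PhiInjective.
Variables (K : fieldType) (N m : nat).
Hypothesis char0 : forall n, n.+1%:R != 0 :> K.
Implicit Types (i j l : 'I_N) (a c v w : 'X_{1..N}) (s t : seq nat).

(** The number of ways to place the parts of [s] on the variables so that [x^a] becomes [x^v], which
    is the coefficient of [x^v] in [x^a p_s]. *)
Fixpoint phi_count a s v : nat :=
  if s is r :: s' then
    \sum_(i < N) (if (r <= v i)%N then phi_count a s' (upd1 v i (v i - r)) else 0)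
  else a == v.

Lemma mcoeff_phi_mono a s v : (phi_mono K (a, s))@_v = (phi_count a s v)%:R.
Proof.
rewrite /phi_mono /=; elim: s v => [|r s IH] v /=.
  by rewrite /psums big_nil mulr1 mcoeffX.
rewrite psums_cons mulrCA /psum mulr_suml raddf_sum natr_sum; apply: eq_bigr => i _ /=.
rewrite mpolyXn mulrC; case: leqP => [rv|vr].
  have E : v = (U_(i) *+ r + upd1 v i (v i - r))%MM.
    apply/mnmP => k; rewrite mnmDE mulmnE mnm1E upd1E eq_sym.
    by case: (k =P i) => [->|_]; lia.
  by rewrite {1}E mcoeffMX IH.
apply/eqP; rewrite mcoeff_eq0 -[_ \in _]negbK; apply/negP => /negPn.
move=> /msuppM_le /allpairsP [[x y] /= [_]]; rewrite msuppX inE => /eqP -> ev.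
by move: vr; rewrite ev mnmDE mulmnE mnm1E eqxx mul1n ltnNge leq_addl.
Qed.

Definition bose_mult x v : nat := \sum_(i < N | (m <= i)%N) (v i == x).
Definition bose_support v : nat := \sum_(i < N | (m <= i)%N) (0 < v i).

Lemma bose_sum_upd1 (F : nat -> nat) v i x :
  (\sum_(j < N | (m <= j)%N) F (upd1 v i x j) + (if (m <= i)%N then F (v i) else 0)
   = \sum_(j < N | (m <= j)%N) F (v j) + (if (m <= i)%N then F x else 0))%N.
Proof.
rewrite big_mkcond [in RHS]big_mkcond (bigD1 i) //= [in RHS](bigD1 i) //= upd1E eqxx.
rewrite (eq_bigr (fun j : 'I_N => if (m <= j)%N then F (v j) else 0%N)); first by lia.
by move=> j /negbTE nj; rewrite upd1E nj.
Qed.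

(** Each part of [s] makes at most one more bosonic exponent positive. When as many are positive as
    there are parts, every part sits alone on a bosonic variable, and [v] shows both [a] and [s]. *)
Lemma phi_count_supp a s v : (forall j, (m <= j)%N -> a j = 0%N) -> 0%N \notin s ->
  phi_count a s v != 0%N ->
  (bose_support v <= size s)%N /\
  (bose_support v = size s -> (forall j, (j < m)%N -> v j = a j)
     /\ (forall x, (0 < x)%N -> bose_mult x v = count_mem x s)).
Proof.
move=> am; elim: s v => [|r s IH] v /=.
  case: (a =P v) => // <- _ _; split=> [|_]; last split=> // x x0.
    by rewrite /bose_support big1 // => i /am ->.
  by rewrite /bose_mult big1 // => i /am ->; rewrite eq_sym (gtn_eqF x0).
rewrite inE negb_or => /andP [r0 zs] nz.
have [i] : exists i, (if (r <= v i)%N then phi_count a s (upd1 v i (v i - r)) else 0)%N != 0%N.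
  by apply/existsP; move: nz; apply: contraNT; rewrite negb_exists => /forallP h;
     rewrite big1 // => i _; have := h i; rewrite negbK => /eqP.
case: leqP => // rv /(IH _ zs) [le eq].
have := bose_sum_upd1 (fun y => 0 < y)%N v i (v i - r); rewrite /=.
rewrite -!/(bose_support _) => hs.
have vi0 : (0 < v i)%N by lia.
split; first by move: hs; case: (m <= i)%N; lia.
move=> e; have mi : (m <= i)%N.
  by move: hs; case: (m <= i)%N => //; lia.
rewrite mi vi0 in hs.
have vr : v i = r by move: hs; case: (posnP (v i - r)) => /=; lia.
have [|e1 e2] := eq _; first by move: hs; rewrite vr subnn /=; lia.
split=> [j jm|x x0].
  rewrite -e1 // upd1E; case: eqP => // eji.
  by move: jm; rewrite eji ltnNge mi.
rewrite -e2 //.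
have := bose_sum_upd1 (fun y => y == x : nat) v i (v i - r); rewrite /= mi vr subnn.
rewrite -!/(bose_mult x _) (ltn_eqF x0); lia.
Qed.

Definition lead_mnm a s : 'X_{1..N} :=
  [multinom if (i < m)%N then a i else nth 0%N s (i - m) | i < N].

Lemma phi_count_lead a s : (forall j, (m <= j)%N -> a j = 0%N) -> (m + size s <= N)%N ->
  phi_count a s (lead_mnm a s) != 0%N.
Proof.
move=> am.
(* The induction on [s] removes the parts from the left; the first [e] bosonic variables have
   already been cleared. *)
pose lm e s := [multinom if (i < m)%N then a i else
   if (i < m + e)%N then 0%N else nth 0%N s (i - (m + e)) | i < N].
have -> : lead_mnm a s = lm 0%N s.
  by apply/mnmP => i; rewrite !mnmE addn0; case: ltnP.
suff H e : (m + e + size s <= N)%N -> phi_count a s (lm e s) != 0%N.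
  by move=> le; apply: H; rewrite addn0.
elim: s e => [|r s IH] e /= le.
  suff <- : a = lm e [::] by rewrite eqxx.
  apply/mnmP => i; rewrite mnmE nth_nil if_same; case: ltnP => // /am //.
have lt : (m + e < N)%N by lia.
rewrite (bigD1 (Ordinal lt)) //= mnmE /= ltnNge leq_addr /= ltnn subnn /= leqnn subnn.
have le1 : (m + e.+1 + size s <= N)%N by lia.
have -> : upd1 (lm e (r :: s)) (Ordinal lt) 0 = lm e.+1 s.
  apply/mnmP => i; rewrite upd1E !mnmE -val_eqE /=.
  case: (ltngtP i (m + e)%N) => [lti|gti|->].
  - by rewrite addnS ltnS (ltnW lti).
  - rewrite addnS ltnS [(i <= m + e)%N]leqNgt gti /=; case: ltnP => // mi.
    by rewrite -[(i - (m + e))%N]prednK ?subn_gt0 //= subnS.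
  by rewrite addnS ltnS leqnn /= ltnNge leq_addr.
by have := IH _ le1; rewrite -!lt0n; lia.
Qed.

Lemma sorted_perm_count s t : sorted geq s -> sorted geq t -> 0%N \notin s -> 0%N \notin t ->
  (forall x, (0 < x)%N -> count_mem x s = count_mem x t) -> s = t.
Proof.
move=> ss st zs zt e; apply: (sorted_eq geq_trans geq_anti) => //.
apply/allP => x _ /=; apply/eqP; case: (posnP x) => [->|]; last exact: e.
by rewrite (count_memPn zs) (count_memPn zt).
Qed.

Lemma bose_lead a s : 0%N \notin s -> (m + size s <= N)%N ->
  bose_support (lead_mnm a s) = size s /\
  forall x, (0 < x)%N -> bose_mult x (lead_mnm a s) = count_mem x s.
Proof.
move=> zs le.
have H (F : nat -> nat) : F 0%N = 0%N ->
    (\sum_(i < N | (m <= i)%N) F (lead_mnm a s i) = \sum_(x <- s) F x)%N.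
  move=> F0; rewrite (eq_bigr (fun i : 'I_N => F (nth 0%N s (i - m)))) => [|i mi]; last first.
    by rewrite mnmE ltnNge mi.
  rewrite -(big_mkord (fun i : nat => m <= i)%N (fun i : nat => F (nth 0%N s (i - m)))).
  rewrite (big_cat_nat (n := m)) //=; last by lia.
  rewrite big_nat_cond big1 ?add0n => [|i /andP [/andP [_ im]]]; last by rewrite leqNgt im.
  rewrite big_nat_cond (eq_bigl (fun i : nat => m <= i < N)%N) => [|i]; last by case: (m <= i)%N; rewrite ?andbT ?andbF.
  rewrite -big_nat -{1}[m]add0n big_addn (eq_bigr (fun i : nat => F (nth 0%N s i))) => [|i _]; last by rewrite addnK.
  rewrite (big_cat_nat (n := size s)) //=; last by lia.
  rewrite [X in (_ + X)%N]big_nat_cond [X in (_ + X)%N]big1 ?addn0.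
    by rewrite [RHS](big_nth 0%N).
  by move=> i /andP [/andP [si _] _]; rewrite nth_default.
split.
  rewrite /bose_support (H (fun y => 0 < y)%N) // (eq_big_seq (fun=> 1%N)) ?sum1_size // => x xs.
  by rewrite lt0n; case: eqP => // x0; move: zs; rewrite -x0 xs.
move=> x x0; rewrite /bose_mult (H (fun y => y == x : nat)) ?(ltn_eqF x0) //.
by rewrite -sum1_count [RHS]big_mkcond /=; apply: eq_bigr => y _; case: eqP.
Qed.

(** Among the indices of [u] one with the longest [s] is taken. At the monomial that places its
    parts on separate bosonic variables no other index contributes, and its own count is positive,
    hence nonzero in characteristic 0. The bound [m + d <= N] provides enough bosonic variables. *)
Lemma phi_inj d (u : {malg K[fidx N]}) : (m + d <= N)%N ->
  supported (good m 0 d) u -> phi u = 0 -> u = 0.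
Proof.
move=> dN su pu; apply/malgP => k0; rewrite monalg.mcoeff0.
apply/eqP/negPn/negP; rewrite mcoeff_neq0 => k0u.
have szd (k : fidx N) : good m 0 d k -> (size k.2 <= d)%N.
  case: k => a s [/= _ zs _ <-]; rewrite addn0; apply: leq_trans (leq_addl _ _).
  elim: s zs => //= x s IH; rewrite inE negb_or => /andP [x0 /IH]; lia.
have [k ku kmax] : exists2 k, k \in monalg.msupp u &
    forall h, h \in monalg.msupp u -> (size h.2 <= size k.2)%N.
  have ex : exists n, has (fun k : fidx N => size k.2 == n) (monalg.msupp u).
    by exists (size k0.2); apply/hasP; exists k0.
  have bd n : has (fun k : fidx N => size k.2 == n) (monalg.msupp u) -> (n <= d)%N.
    by move=> /hasP [h hu /eqP <-]; apply/szd/su; rewrite mcoeff_neq0.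
  case: (ex_maxnP ex bd) => n /hasP [k ku /eqP kn] nmax; exists k => // h hu.
  by rewrite kn; apply: nmax; apply/hasP; exists h.
have gk : good m 0 d k by apply: su; rewrite mcoeff_neq0.
move: pu => /mpolyP/(_ (lead_mnm k.1 k.2)); rewrite mcoeff0 /phi /flin raddf_sum /=.
have [sk zk am _] := gk; have szk := szd _ gk.
have le : (m + size k.2 <= N)%N by lia.
have [bs bm] := bose_lead k.1 zk le.
rewrite (bigD1_seq k) ?fset_uniq //= big_seq_cond big1 ?addr0 => [|h /andP [hu nhk]].
  rewrite mcoeffZ {2}[k]surjective_pairing mcoeff_phi_mono => /eqP.
  have nuk : u@[k] != 0 by rewrite mcoeff_neq0.
  rewrite mulf_eq0 (negbTE nuk) /=.
  by have := phi_count_lead am le; case: (phi_count _ _ _) => // n _; apply/negP.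
rewrite mcoeffZ {2}[h]surjective_pairing mcoeff_phi_mono.
have [->|nc] := eqVneq (phi_count h.1 h.2 (lead_mnm k.1 k.2)) 0%N.
  by rewrite mulr0.
have [sh zh hm _] : good m 0 d h by apply: su; rewrite mcoeff_neq0.
have [le1] := phi_count_supp hm zh nc; rewrite bs => eq; case: (eq _) => [|e1 e2].
  by apply/eqP; rewrite eqn_leq kmax // -bs le1.
case/eqP: nhk; rewrite [h]surjective_pairing [k]surjective_pairing; congr (_, _).
  apply/mnmP => j; case: (ltnP j m) => [jm|mj]; last by rewrite am ?hm.
  by rewrite -e1 // mnmE jm.
by apply: sorted_perm_count => // x x0; rewrite -e2 // bm.
Qed.

End PhiInjective.

(** * The Bruhat order on superpartitions *)

Section Bruhat.
Variable N : nat.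
Implicit Types (u v w : 'S_N) (i j k p q r : 'I_N) (l : N.-tuple nat).

(** An injection maps the inversions of [w] to those of the product: a pair that remains an
    inversion is kept, any other has [p] and [q] exchanged in it. The new inversion [(p, q)] is not
    in the image. *)
Lemma perm_length_lt w i j : (i < j)%N -> (w^-1%g i < w^-1%g j)%N ->
  (perm_length w < perm_length (w * tperm i j)%g)%N.
Proof.
move=> ij; set p := w^-1%g i; set q := w^-1%g j => pq.
have wp : w p = i by rewrite permKV.
have wq : w q = j by rewrite permKV.
have wtE x : (w * tperm i j)%g x = w (tperm p q x).
  rewrite permM; case: (tpermP p q x) => [->|->|np nq]; rewrite ?wp ?wq ?tpermL ?tpermR //.
  by rewrite tpermD // eq_sym; apply/eqP => e; [apply: np|apply: nq]; rewrite /p /q -e permK.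
pose A := [set x : 'I_N * 'I_N | (x.1 < x.2)%N && (w x.2 < w x.1)%N]%SET.
pose B := [set x : 'I_N * 'I_N | (x.1 < x.2)%N &&
   ((w * tperm i j)%g x.2 < (w * tperm i j)%g x.1)%N]%SET.
pose f x := if x \in B then x else (tperm p q x.1, tperm p q x.2).
have -> : perm_length w = #|A| by apply: eq_card => x; rewrite !inE.
have -> : perm_length (w * tperm i j)%g = #|B| by apply: eq_card => x; rewrite !inE.
have tt x : tperm p q (tperm p q x) = x by rewrite tpermK.
have fB x : x \in A -> f x \in B.
  rewrite /f; case: ifP => // nB xA; move: nB; rewrite !inE /= !wtE !tt.
  move: xA; rewrite inE => /andP [lt lw]; rewrite lw lt /= andbT => /negbT; rewrite -leqNgt.
  move: lt lw; case: x => r s /=.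
  by case: (tpermP p q r) => [->|->|_ _]; case: (tpermP p q s) => [->|->|_ _]; rewrite ?wp ?wq; lia.
have finj : {in A &, injective f}.
  move=> x y xA yA; rewrite /f; case: ifP => xB; case: ifP => yB //.
  - move=> e; exfalso; move: yB yA xA; rewrite e !inE /= !wtE => yB /andP [y12 _] /andP [_ xw].
    by rewrite y12 xw in yB.
  - move=> e; exfalso; move: xB xA yA; rewrite -e !inE /= !wtE => xB /andP [x12 _] /andP [_ yw].
    by rewrite x12 yw in xB.
  case: x y {xA yA xB yB} => [x1 x2] [y1 y2] /= [/perm_inj -> /perm_inj ->] //.
rewrite -(card_in_imset finj); apply: proper_card; apply/properP; split.
  by apply/fintype.subsetP => _ /imsetP [x xA ->]; apply: fB.
exists (p, q); first by rewrite inE /= pq !wtE tpermL tpermR wp wq ij.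
apply/imsetP => -[x xA]; rewrite /f; case: ifP => xB.
  by move=> e; move: xA; rewrite -e inE /= wp wq pq; lia.
move=> [e1 e2]; move: xA; rewrite inE.
have -> : x.1 = q by apply: (@perm_inj _ (tperm p q)); rewrite -e1 tpermR.
have -> : x.2 = p by apply: (@perm_inj _ (tperm p q)); rewrite -e2 tpermL.
by lia.
Qed.

Lemma tnth_perm_comp w l i : tnth (perm_comp w l) i = tnth l (w^-1%g i).
Proof. by rewrite tnth_mktuple. Qed.

Lemma comp_plus_perm l : perm_eq (comp_plus l) l.
Proof. by rewrite perm_sort. Qed.

Lemma comp_plus_sorted l : sorted geq (comp_plus l).
Proof. by apply: sort_sorted => x y; apply: leq_total. Qed.

Lemma comp_plus_eq l l' : perm_eq l l' -> comp_plus l = comp_plus l'.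
Proof.
move=> pe; apply/val_inj/perm_sortP => //.
- by move=> x y; apply: leq_total.
- by move=> x y z /= h1 h2; apply: leq_trans h2 h1.
by move=> x y /=; rewrite andbC => /anti_leq.
Qed.

Lemma min_permP l : l = perm_comp (min_perm l) (comp_plus l) /\
  forall w, l = perm_comp w (comp_plus l) -> (perm_length (min_perm l) <= perm_length w)%N.
Proof.
have /tuple_permP [s sE] : perm_eq l (comp_plus l) by rewrite perm_sym comp_plus_perm.
have w0P : l == perm_comp s^-1%g (comp_plus l).
  by apply/eqP/eq_from_tnth => i; rewrite tnth_perm_comp invgK; rewrite [l in LHS](val_inj sE) tnth_mktuple.
rewrite /min_perm /arg_min /extremum; case: pickP => [w /andP [/eqP wP /forallP wmin]|none] /=.
  by split=> // w' /eqP w'P; apply: (implyP (wmin w')).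
have [w wP wmin] := @arg_minnP _ _ (fun w => l == perm_comp w (comp_plus l)) (@perm_length N) w0P.
have := none w; rewrite /= wP /= => /negP [].
by apply/forallP => w'; apply/implyP => /wmin.
Qed.

(** Increasing on the blocks of equal entries: this characterises the shortest permutation in a
    coset of the stabiliser of [comp_plus l]. *)
Definition stable l w := forall p q, (p < q)%N ->
  tnth (comp_plus l) p = tnth (comp_plus l) q -> (w p < w q)%N.

Lemma min_perm_stable l : stable l (min_perm l).
Proof.
have [lE lmin] := min_permP l; set w := min_perm l in lE lmin *.
move=> p q pq e; rewrite ltn_neqAle (inj_eq val_inj) (inj_eq perm_inj) -(inj_eq val_inj) (ltn_eqF pq) /=.
rewrite leqNgt; apply/negP => lt.
pose w1 := (w * tperm (w p) (w q))%g.
have E : l = perm_comp w1 (comp_plus l).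
  rewrite {1}lE; apply/eq_from_tnth => x; rewrite !tnth_perm_comp /w1 invMg permM tpermV.
  by case: tpermP => [->|->|//]; rewrite !permK.
have w1V x : (w1^-1%g x) = w^-1%g (tperm (w p) (w q) x) by rewrite /w1 invMg permM tpermV.
have := lmin _ E; rewrite leqNgt => /negP; apply.
have -> : w = (w1 * tperm (w q) (w p))%g by rewrite /w1 tpermC -mulgA tperm2 mulg1.
by apply: perm_length_lt => //; rewrite -/w1 !w1V tpermL tpermR !permK.
Qed.

Lemma stable_id l (s : 'S_N) :
  (forall p q, (p < q)%N -> tnth (comp_plus l) p = tnth (comp_plus l) q -> (s p < s q)%N) ->
  (forall p, tnth (comp_plus l) (s p) = tnth (comp_plus l) p) -> s = 1%g.
Proof.
move=> mono pres; apply/permP => p; rewrite perm1.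
have [n] := ubnP p; elim: n p => // n IH p pn.
have lt r : (r < p)%N -> s r = r by move=> rp; apply: IH; lia.
apply/eqP; case: (ltngtP (s p) p) => [h|h|/val_inj ->] //.
  by have := lt _ h => /perm_inj /(congr1 val) /= e; move: h; rewrite e ltnn.
have sq : s (s^-1%g p) = p by rewrite permKV.
case: (ltngtP (s^-1%g p) p) => [h'|h'|/val_inj e].
- by have := lt _ h'; rewrite sq => e; move: h'; rewrite -e ltnn.
- have : (s p < s (s^-1%g p))%N by apply: mono => //; rewrite -[RHS]pres sq.
  by rewrite sq; lia.
by rewrite -{1}e sq.
Qed.

Lemma min_perm_eq l w : l = perm_comp w (comp_plus l) -> stable l w -> min_perm l = w.
Proof.
move=> wE ws; have [lE _] := min_permP l; have ms := @min_perm_stable l.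
set w' := min_perm l in lE ms *.
have E x : tnth (comp_plus l) (w^-1%g x) = tnth (comp_plus l) (w'^-1%g x).
  by rewrite -!tnth_perm_comp -wE -lE.
suff e : (w' * w^-1)%g = 1%g by rewrite -[LHS]mulg1 -(mulVg w) mulgA e mul1g.
apply: (@stable_id l) => [p q pq e|p]; last by rewrite permM E permK.
rewrite permM permM.
case: (ltngtP (w^-1%g (w' p)) (w^-1%g (w' q))) => // [h|h].
  have := ws _ _ h; rewrite !permKV !E !permK => /(_ (esym e)).
  by have := ms _ _ pq e; lia.
by move: h => /val_inj /perm_inj /perm_inj h; move: pq; rewrite h ltnn.
Qed.

Definition swap i j l : N.-tuple nat := [tuple tnth l (tperm i j k) | k < N].

Lemma tnth_swap i j l k : tnth (swap i j l) k = tnth l (tperm i j k).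
Proof. exact: tnth_mktuple. Qed.

Lemma swap_perm i j l : perm_eq (swap i j l) l.
Proof. by apply/tuple_permP; exists (tperm i j). Qed.

(** If an entry strictly between the two positions equals one of the exchanged values, the swap is a
    composite of two swaps over smaller distances. Otherwise the permutation stays increasing on
    blocks after one reflection, so this product is the new minimal permutation, and its length
    grows. *)
Lemma swap_bruhat i j l : (i < j)%N -> (tnth l j < tnth l i)%N ->
  bruhat_le (min_perm l) (min_perm (swap i j l)).
Proof.
have [n] := ubnP (j - i)%N; elim: n i j l => // n IH i j l jin ij lij.
have [k /andP [/andP [ik kj] /eqP lk]|nk1] :=
    pickP (fun k => (i < k < j)%N && (tnth l k == tnth l i)).
  have tik : tperm k j i = i by rewrite tpermD // -val_eqE /= gtn_eqF // (ltn_trans ik).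
  have -> : swap i j l = swap i k (swap k j l).
    apply/eq_from_tnth => x; rewrite !tnth_swap.
    case: (tpermP i k x) => [->|->|/eqP xi /eqP xk]; rewrite ?tpermL ?tpermR ?tik //.
      by rewrite tpermD -?val_eqE /= ?(ltn_eqF ik) ?(gtn_eqF kj) //.
    case: (tpermP k j x) => [|->|_ xj]; first by move=> e; rewrite e eqxx in xk.
      by rewrite tpermR lk.
    by rewrite tpermD // eq_sym //; apply/eqP.
  apply: (connect_trans (IH k j l _ _ _)) => //; [lia|by rewrite lk|].
  by apply: IH => //; [lia|rewrite !tnth_swap tpermL tik].
have [k /andP [/andP [ik kj] /eqP lk]|nk2] :=
    pickP (fun k => (i < k < j)%N && (tnth l k == tnth l j)).
  have tjk : tperm i k j = j by rewrite tpermD // -val_eqE /= ltn_eqF // (ltn_trans ik).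
  have -> : swap i j l = swap k j (swap i k l).
    apply/eq_from_tnth => x; rewrite !tnth_swap.
    case: (tpermP k j x) => [->|->|/eqP xk /eqP xj]; rewrite ?tpermL ?tpermR ?tjk //.
      by rewrite tpermD -?val_eqE /= ?(ltn_eqF ik) ?(gtn_eqF kj) // lk.
    case: (tpermP i k x) => [->|e|xi _]; last 1 first.
    - by rewrite tpermD // eq_sym //; apply/eqP.
    - by rewrite tpermL lk.
    by rewrite e eqxx in xk.
  apply: (connect_trans (IH i k l _ _ _)) => //; [lia|by rewrite lk|].
  by apply: IH => //; [lia|rewrite !tnth_swap tpermR tjk].
have [lE _] := min_permP l; have ms := @min_perm_stable l.
set w := min_perm l in lE ms *.
have cE : comp_plus (swap i j l) = comp_plus l by apply/comp_plus_eq/swap_perm.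
have -> : min_perm (swap i j l) = (w * tperm i j)%g.
  apply: min_perm_eq.
    rewrite cE; apply/eq_from_tnth => x; rewrite tnth_swap tnth_perm_comp invMg permM tpermV.
    by rewrite {1}lE tnth_perm_comp.
  move=> p q pq; rewrite cE => e; rewrite !permM; have := ms _ _ pq e.
  have V x : tnth l (w x) = tnth (comp_plus l) x by rewrite {1}lE tnth_perm_comp permK.
  rewrite -!V in e; move: (nk1 (w q)) (nk2 (w p)) => /= n1 n2.
  have nat_neq x y : x <> y :> 'I_N -> (x : nat) <> y by move=> h1 h2; apply/h1/val_inj.
  by case: (tpermP i j (w p)) => [ep|ep|/nat_neq np1 /nat_neq np2];
    case: (tpermP i j (w q)) => [eq|eq|/nat_neq nq1 /nat_neq nq2];
    rewrite ?ep ?eq in e n1 n2 *; move: lij ij; lia.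
apply/connect1/andP; split; first by apply/existsP; exists i; apply/existsP; exists j.
apply: perm_length_lt => //; rewrite ltnNge; apply/negP => le.
have V x : tnth l x = tnth (comp_plus l) (w^-1%g x) by rewrite {1}lE tnth_perm_comp.
move: lij; rewrite !V ltnNge => /negP; apply.
have tr : transitive geq by move=> x y z /= h1 h2; apply: leq_trans h2 h1.
have := sorted_leq_nth tr (fun x => leqnn x) 0%N (comp_plus_sorted l).
move=> /(_ (w^-1%g j) (w^-1%g i)); rewrite !inE !size_tuple !ltn_ord -!tnth_nth.
by apply.
Qed.

End Bruhat.

(** * Bruhat comparison by prefix counts *)

Section PrefixCounts.
Variable N : nat.
Implicit Types (i j p : 'I_N) (l : N.-tuple nat) (k c e : nat).

Definition prefix_sum (F : nat -> nat) l k : nat := \sum_(p < N | (p < k)%N) F (tnth l p).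
Definition prefix_count l k c : nat := prefix_sum (fun x => c <= x)%N l k.
Definition prefix_range l k c e : nat := prefix_sum (fun x => c <= x < e)%N l k.

Lemma prefix_sumS F l i : prefix_sum F l i.+1 = (prefix_sum F l i + F (tnth l i))%N.
Proof.
rewrite /prefix_sum (bigD1 i) //= addnC; congr (_ + _)%N.
by apply: eq_bigl => p; rewrite ltnS [RHS]ltn_neqAle -val_eqE /= andbC.
Qed.

Lemma prefix_sum_ext F l l' k : (forall p, (p < k)%N -> tnth l p = tnth l' p) ->
  prefix_sum F l k = prefix_sum F l' k.
Proof. by move=> h; apply: eq_bigr => p /h ->. Qed.

Lemma prefix_sum_mono F l k k' : (k <= k')%N -> (prefix_sum F l k <= prefix_sum F l k')%N.
Proof.
move=> le; rewrite /prefix_sum big_mkcond [leqRHS]big_mkcond /=; apply: leq_sum => p _.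
by case: ltnP => // /leq_trans/(_ le) ->.
Qed.

Lemma prefix_sum_flat F l k k' :
  (forall p, (k <= p < k')%N -> F (tnth l p) = 0%N) -> (prefix_sum F l k' <= prefix_sum F l k)%N.
Proof.
move=> h; rewrite /prefix_sum big_mkcond [leqRHS]big_mkcond /=; apply: leq_sum => p _.
case: (ltnP p k) => [_|kp]; first by case: ifP.
by case: (ltnP p k') => // pk; rewrite h // kp pk.
Qed.

Lemma prefix_sum_perm F l l' : perm_eq l l' -> prefix_sum F l N = prefix_sum F l' N.
Proof.
move=> pe; have E l1 : prefix_sum F l1 N = (\sum_(x <- l1) F x)%N.
  rewrite [RHS]big_tuple; apply: eq_bigl => p; exact: ltn_ord.
by rewrite !E; apply: perm_big.
Qed.

Lemma prefix_count_range l k c e : (c <= e)%N ->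
  prefix_count l k c = (prefix_count l k e + prefix_range l k c e)%N.
Proof. by move=> ce; rewrite -big_split /=; apply: eq_bigr => p _; lia. Qed.

Lemma sum_swap (G : 'I_N -> nat -> nat) i j l : i != j ->
  (\sum_p G p (tnth (swap i j l) p) + (G i (tnth l i) + G j (tnth l j))
   = \sum_p G p (tnth l p) + (G i (tnth l j) + G j (tnth l i)))%N.
Proof.
move=> nij; rewrite (bigD1 i) //= (bigD1 j) 1?eq_sym //=.
rewrite [in RHS](bigD1 i) //= [in RHS](bigD1 j) 1?eq_sym //= !tnth_swap tpermL tpermR.
rewrite (eq_bigr (fun p => G p (tnth l p))); first by lia.
by move=> p /andP [pi pj]; rewrite tnth_swap tpermD // eq_sym.
Qed.

Lemma prefix_sum_swap F i j l k : i != j ->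
  (prefix_sum F (swap i j l) k + ((if i < k then F (tnth l i) else 0)
      + (if j < k then F (tnth l j) else 0))
   = prefix_sum F l k + ((if i < k then F (tnth l j) else 0)
      + (if j < k then F (tnth l i) else 0)))%N.
Proof.
move=> nij; have := sum_swap (fun p x => if (p < k)%N then F x else 0%N) l nij.
by rewrite -!big_mkcond.
Qed.

(** [l] is moved to [l'] by swaps that go up in the Bruhat order. At the first difference [i] the
    entry [a] of [l] exceeds the entry [b] of [l']; it is exchanged with the first later entry in
    [[b, a)], and the prefix counts of the result still dominate those of [l']. *)
Lemma bruhat_of_prefix_count l l' : perm_eq l l' ->
  (forall k c, (prefix_count l' k c <= prefix_count l k c)%N) ->
  bruhat_le (min_perm l) (min_perm l').
Proof.
(* Each swap moves a larger entry to the right and raises [mu], which is bounded by [N] times the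
   sum of the entries. *)
pose mu l1 := (\sum_(p < N) p * tnth l1 p)%N.
have [n] := ubnP (N * \sum_(x <- l') x - mu l)%N.
elim: n l => // n IH l ltn pe h.
have [->|/eqP nll'] := eqVneq l l'; first exact: connect0.
have [i0 ni0] : exists i, tnth l i != tnth l' i.
  by apply/existsP; apply: contra_notT nll'; rewrite negb_exists => /forallP e;
    apply: eq_from_tnth => i; have := e i; rewrite negbK => /eqP.
have [i ni imin] := @arg_minnP _ i0 (fun i => tnth l i != tnth l' i) (fun i => i : nat) ni0.
have pre p : (p < i)%N -> tnth l p = tnth l' p.
  by move=> pi; apply/eqP; apply: contraLR pi => /imin; rewrite -leqNgt.
have preE F : prefix_sum F l i = prefix_sum F l' i by apply: prefix_sum_ext.
set a := tnth l i in ni *; set b := tnth l' i in ni *.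
have ba : (b < a)%N.
  have := h i.+1 b; rewrite /prefix_count !prefix_sumS preE leq_add2l leqnn.
  by rewrite ltn_neqAle eq_sym ni; case: (b <= a)%N.
have rgi : (prefix_range l' i b a + 1 <= prefix_range l' N b a)%N.
  have := @prefix_sum_mono (fun x => b <= x < a)%N l' i.+1 N (ltn_ord i).
  by rewrite /prefix_range prefix_sumS -/b leqnn ba.
have [j0 /andP [ij0 rj0]] : exists j, (i < j)%N && (b <= tnth l j < a)%N.
  apply/existsP; apply: contraLR rgi; rewrite negb_exists -ltnNge => /forallP e.
  rewrite addn1 ltnS /prefix_range -(prefix_sum_perm _ pe) -preE; apply: prefix_sum_flat => p /andP [ip _].
  have := e p; rewrite negb_and; case: (ltngtP i p) ip => // [_ _ /=|/val_inj <- _ _].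
    by move=> /negbTE ->.
  by rewrite -/a ltnn andbF.
have [j /andP [ij /andP [bj ja]] jmin] :=
  @arg_minnP _ j0 (fun j => (i < j)%N && (b <= tnth l j < a)%N) (fun j => j : nat)
    (introT andP (conj ij0 rj0)).
have nij : i != j by rewrite -val_eqE /= ltn_eqF.
apply: (connect_trans (swap_bruhat ij ja)).
apply: IH.
- have E := sum_swap (fun p x => p * x)%N l nij.
  have lm : (mu l < mu (swap i j l))%N.
    rewrite /mu; move: E; rewrite -/a.
    set x := tnth l j; set A := (\sum_p _)%N; set B := (\sum_p _)%N => E.
    have : (i * x + j * a > i * a + j * x)%N.
      have -> : (j : nat) = (i + (j - i))%N by lia.
      rewrite !mulnDl; have : (0 < j - i)%N by lia.
      move: (j - i)%N => d d0; have : (d * x < d * a)%N by rewrite ltn_pmul2l.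
      lia.
    lia.
  have le : (mu (swap i j l) <= N * \sum_(x <- l') x)%N.
    rewrite -(perm_big _ pe) /= -(perm_big _ (swap_perm i j l)) [in leqRHS]big_tuple big_distrr /mu.
    by apply: leq_sum => p _; rewrite leq_mul2r ltnW ?orbT.
  lia.
- exact: perm_trans (swap_perm i j l) pe.
move=> k c; have E := prefix_sum_swap (fun x => c <= x : nat)%N l k nij.
rewrite -/(prefix_count _ _ _) -/(prefix_count _ _ _) -/a in E.
have hk := h k c; move: E.
case: (ltnP i k) => ik; case: (ltnP j k) => jk; rewrite ?addn0; try by lia.
case: (leqP c (tnth l j)) => cj; first by lia.
case: (leqP c a) => ca; last by lia.
(* Here [i < k <= j] and [l_j < c <= a], the one case in which the swap lowers the count, by one.
   The hypothesis at level [b] provides the slack: up to [k], the entries of [l] in [[b, c)] all lie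
   before [i], while [l'] has the additional entry [b] at [i]. *)
have bc : (b <= c)%N by lia.
have := prefix_count_range l k bc; have := prefix_count_range l' k bc.
have := h k b.
have r1 : (prefix_range l k b c <= prefix_range l i b c)%N.
  apply: prefix_sum_flat => p /andP [ip pk].
  case: (ltngtP i p) ip => // [ip _|/val_inj <- _]; last by rewrite -/a ltnNge ca andbF.
  apply/eqP; rewrite eqb0; apply/negP => /andP [bp pc].
  have := jmin p; rewrite ip bp (leq_trans pc ca) => /(_ isT); lia.
have r2 : (prefix_range l' i b c + 1 <= prefix_range l' k b c)%N.
  have := @prefix_sum_mono (fun x => b <= x < c)%N l' i.+1 k ik.
  by rewrite /prefix_range prefix_sumS -/b leqnn (leq_ltn_trans bj cj).
have r3 : prefix_range l i b c = prefix_range l' i b c by exact: preE.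
by lia.
Qed.

End PrefixCounts.

(** * Numerical invariants of superpartitions and the order *)

Section SuperpartOrder.
Implicit Types (L O : superpart).

Definition sp_excess (c : nat) L : nat := (\sum_(x <- sp_seq L) (x - c))%N.
Definition sp_fermi_count (c : nat) L : nat := count (leq c) (sp_a L).

Lemma sp_a_sorted L : sorted gtn (sp_a L).
Proof. by case: L => [[a s] /= H]; case/and3P: (H). Qed.
Lemma sp_s_sorted L : sorted geq (sp_s L).
Proof. by case: L => [[a s] /= H]; case/and3P: (H). Qed.
Lemma sp_s_pos L : 0%N \notin sp_s L.
Proof. by case: L => [[a s] /= H]; case/and3P: (H). Qed.
Lemma sp_a_geq L : sorted geq (sp_a L).
Proof. by apply: sub_sorted (sp_a_sorted L) => x y /= /ltnW. Qed.
Lemma sp_a_uniq L : uniq (sp_a L).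
Proof.
apply: sorted_uniq (sp_a_sorted L); first by move=> x y z /= h1 h2; apply: ltn_trans h2 h1.
by move=> x /=; rewrite ltnn.
Qed.

Lemma superpart_eq L O : sp_a L = sp_a O -> sp_s L = sp_s O -> L = O.
Proof.
move=> ea es; apply/val_inj => /=; move: ea es; rewrite /sp_a /sp_s.
by case: (sp_val L) => a s; case: (sp_val O) => a' s' /= -> ->.
Qed.

Lemma sum_sp_comp N L (F : nat -> nat) : F 0%N = 0%N -> (sp_length L <= N)%N ->
  (\sum_(x <- sp_comp N L) F x = \sum_(x <- sp_seq L) F x)%N.
Proof.
move=> F0 le; rewrite big_tuple /=.
under eq_bigr do rewrite tnth_mktuple.
rewrite -(big_mkord xpredT (fun i => F (nth 0%N (sp_seq L) i))).
rewrite (big_cat_nat (n := sp_length L)) //= [X in (_ + X)%N]big_nat_cond.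
rewrite [X in (_ + X)%N]big1 ?addn0; first by rewrite [RHS](big_nth 0%N).
by move=> i /andP [/andP [si _] _]; rewrite nth_default.
Qed.

(* Summing [(x - c)+] with [c] the [k]-th largest entry recovers the sum of the
   [k] largest entries, so the excesses control the dominance order. *)
Lemma dominates_excess N (p q : N.-tuple nat) : sorted geq p ->
  sumn p = sumn q ->
  (forall c, \sum_(x <- q) (x - c) <= \sum_(x <- p) (x - c))%N -> dominates p q.
Proof.
move=> sp e h; split=> // k; have [Nk|kN] := leqP N k.
  by rewrite !take_oversize ?size_tuple // e.
set c := nth 0%N p k; have := h c.
have gt := sorted_leq_nth geq_trans (fun x => leqnn x) 0%N sp.
have -> : (\sum_(x <- p) (x - c) = \sum_(x <- take k p) (x - c))%N.
  rewrite -{1}(cat_take_drop k p) big_cat /= [X in (_ + X)%N]big1_seq ?addn0 //.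
  move=> x /= /(nthP 0%N) [i]; rewrite size_drop size_tuple => lti <-.
  apply/eqP; rewrite nth_drop subn_eq0 /c; apply: gt; rewrite ?inE ?size_tuple ?leq_addr //.
  by lia.
have {1}-> : (\sum_(x <- take k p) (x - c) = \sum_(x <- take k p) x - k * c)%N.
  have E : (\sum_(x <- take k p) (x - c) + k * c = \sum_(x <- take k p) x)%N.
    have -> : (k * c = \sum_(x <- take k p) c)%N.
      by rewrite big_const_seq iter_addn_0 count_predT size_take size_tuple kN mulnC.
    rewrite -big_split /=; apply: eq_big_seq => x /(nthP 0%N) [i].
    rewrite size_take size_tuple kN => ik <-; rewrite nth_take // subnK // /c.
    by apply: gt; rewrite ?inE ?size_tuple ?(ltnW ik) ?(ltn_trans ik).
  by rewrite -E addnK.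
have le : (\sum_(x <- take k q) x <= \sum_(x <- q) (x - c) + k * c)%N.
  rewrite -{2}(cat_take_drop k q) big_cat /= -addnA addnCA; apply: leq_trans (leq_addl _ _).
  have -> : (k * c = \sum_(x <- take k q) c)%N.
    by rewrite big_const_seq iter_addn_0 count_predT size_take size_tuple kN mulnC.
  by rewrite -big_split /=; apply: leq_sum => x _; lia.
have kc : (k * c <= \sum_(x <- take k p) x)%N.
  have -> : (k * c = \sum_(x <- take k p) c)%N.
    by rewrite big_const_seq iter_addn_0 count_predT size_take size_tuple kN mulnC.
  rewrite big_seq [leqRHS]big_seq; apply: leq_sum => x /(nthP 0%N) [i].
  rewrite size_take size_tuple kN => ik <-; rewrite nth_take // /c.
  by apply: gt; rewrite ?inE ?size_tuple ?(ltnW ik) ?(ltn_trans ik).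
by rewrite !sumnE; lia.
Qed.

Lemma count_sorted_prefix (s : seq nat) (k c : nat) : sorted geq s -> (0 < c)%N ->
  (\sum_(i < k) (c <= nth 0 s i) = minn k (count (leq c) s))%N.
Proof.
move=> ss c0; elim: s k ss => [|x s IH] k ss.
  by rewrite minn0 big1 // => i _; rewrite nth_nil leqNgt c0.
have ss' := path_sorted ss.
case: k => [|k]; first by rewrite big_ord0 min0n.
rewrite big_ord_recl /= (IH k ss'); case: (leqP c x) => [cx|xc]; first by rewrite !add1n minnSS.
suff -> : count (leq c) s = 0%N by rewrite !minn0.
apply/eqP; rewrite -leqn0 leqNgt -has_count; apply/hasP => -[y ys cy].
have /allP/(_ y ys) /= := order_path_min geq_trans ss; lia.
Qed.

(** Both halves decrease, so the entries that are at least [c] fill an initial segment of each. As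
    [c > 0], the padding zeros are not counted, and the formula also holds for [k > N]. *)
Lemma prefix_count_sp N L k c : (sp_length L <= N)%N -> (0 < c)%N ->
  prefix_count (sp_comp N L) k c =
    if (k <= sp_fermionic_degree L)%N then minn k (sp_fermi_count c L)
    else minn (sp_fermi_count c L + (k - sp_fermionic_degree L)) (count (leq c) (sp_seq L)).
Proof.
move=> le c0; rewrite /prefix_count /prefix_sum.
have E k' : (k' <= N)%N -> (\sum_(p < N | (p < k')%N) (c <= tnth (sp_comp N L) p) =
    \sum_(i < k') (c <= nth 0 (sp_seq L) i))%N.
  move=> kN; rewrite (eq_bigr (fun p : 'I_N => (c <= nth 0 (sp_seq L) p)%N : nat)) => [|p _]; last first.
    by rewrite tnth_mktuple.
  by rewrite (big_ord_widen _ (fun i => (c <= nth 0 (sp_seq L) i)%N : nat) kN).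
have H k' : (\sum_(i < k') (c <= nth 0 (sp_seq L) i) =
    if (k' <= sp_fermionic_degree L)%N then minn k' (sp_fermi_count c L)
    else minn (sp_fermi_count c L + (k' - sp_fermionic_degree L)) (count (leq c) (sp_seq L)))%N.
  case: leqP => [km|mk].
    rewrite -(count_sorted_prefix _ (sp_a_geq L) c0); apply: eq_bigr => i _.
    by rewrite /sp_seq nth_cat (leq_trans (ltn_ord i) km).
  transitivity (\sum_(i < sp_fermionic_degree L + (k' - sp_fermionic_degree L))
      (c <= nth 0 (sp_seq L) i))%N; first by rewrite subnKC // ltnW.
  rewrite big_split_ord /=.
  rewrite (eq_bigr (fun i : 'I_(sp_fermionic_degree L) => (c <= nth 0 (sp_a L) i)%N : nat)) => [|i _]; last first.
    by rewrite /sp_seq nth_cat ltn_ord.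
  rewrite (count_sorted_prefix _ (sp_a_geq L) c0).
  rewrite (eq_bigr (fun i : 'I_(k' - sp_fermionic_degree L) => (c <= nth 0 (sp_s L) i)%N : nat)) => [|i _]; last first.
    by rewrite /sp_seq nth_cat ltnNge leq_addr /= addKn.
  rewrite (count_sorted_prefix _ (sp_s_sorted L) c0) /sp_seq count_cat.
  have : (sp_fermi_count c L <= sp_fermionic_degree L)%N by apply: count_size.
  rewrite /sp_fermi_count; lia.
case: (leqP k N) => [kN|Nk]; first by rewrite E.
rewrite (eq_bigl (fun p : 'I_N => (p < N)%N)) => [|p]; last by rewrite !ltn_ord (ltn_trans _ Nk).
rewrite E // H.
have l1 : (sp_fermi_count c L <= sp_fermionic_degree L)%N by apply: count_size.
have l2 : (count (leq c) (sp_s L) <= size (sp_s L))%N by apply: count_size.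
move: le l1 l2; rewrite /sp_length /sp_seq size_cat count_cat -/(sp_fermionic_degree L) -/(sp_fermi_count c L).
move=> le l1 l2; case: (leqP N _) => ?; case: (leqP k _) => ?; lia.
Qed.

(** If the parts differ as multisets, the excesses give dominance. If they agree, so do the total
    counts, and the prefix counts are then monotone in the fermionic counts, so that
    [bruhat_of_prefix_count] applies. *)
Lemma sp_le_intro O L : sp_degree O = sp_degree L ->
  sp_fermionic_degree O = sp_fermionic_degree L ->
  (forall c, sp_excess c O <= sp_excess c L)%N ->
  ((forall c, sp_excess c O = sp_excess c L) ->
     forall c, sp_fermi_count c O <= sp_fermi_count c L)%N ->
  sp_le O L.
Proof.
move=> ed ef ex fe; split=> //; set N := maxn _ _ => /=.
have NO : (sp_length O <= N)%N by rewrite leq_maxl.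
have NL : (sp_length L <= N)%N by rewrite leq_maxr.
have exc X c : (sp_length X <= N)%N ->
    (\sum_(x <- comp_plus (sp_comp N X)) (x - c) = sp_excess c X)%N.
  by move=> NX; rewrite (perm_big _ (comp_plus_perm _)) /= sum_sp_comp.
have smn X : (sp_length X <= N)%N -> sumn (comp_plus (sp_comp N X)) = sp_degree X.
  by move=> NX; rewrite sumnE (perm_big _ (comp_plus_perm _)) /= (sum_sp_comp (F := id)) // /sp_degree sumnE.
have [e|ne] := eqVneq (comp_plus (sp_comp N L)) (comp_plus (sp_comp N O)); last first.
  left; split; first exact/eqP.
  apply: dominates_excess; [exact: comp_plus_sorted | by rewrite !smn |].
  by move=> c; rewrite !exc.
right; split=> //.
have pe : perm_eq (sp_comp N L) (sp_comp N O).
  by rewrite -(permPl (comp_plus_perm _)) e comp_plus_perm.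
have exE c : sp_excess c O = sp_excess c L by rewrite -!exc // e.
apply: bruhat_of_prefix_count => // k c; case: (posnP c) => [->|c0].
  by rewrite /prefix_count; apply: leq_sum => p _.
have cE : count (leq c) (sp_seq O) = count (leq c) (sp_seq L).
  have F X : (sp_length X <= N)%N -> count (leq c) (sp_seq X) = count (leq c) (sp_comp N X).
    move=> NX; rewrite -!sum1_count big_mkcond [RHS]big_mkcond /=.
    by rewrite (sum_sp_comp (F := fun x => if (c <= x)%N then 1%N else 0%N)) //= leqn0 gtn_eqF.
  by rewrite !F //; apply/esym/seq.permP.
rewrite !prefix_count_sp // ef cE; have := fe exE c; case: (leqP k _) => _; lia.
Qed.

(* The excesses determine the multiset of all parts, the fermionic counts that
   of the fermionic ones. *)
Lemma sp_invariants_inj O L :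
  sp_fermionic_degree O = sp_fermionic_degree L ->
  (forall c, sp_excess c O = sp_excess c L) ->
  (forall c, sp_fermi_count c O = sp_fermi_count c L) -> O = L.
Proof.
move=> ef ex fe.
have cm (s : seq nat) x : (count_mem x s + count (leq x.+1) s = count (leq x) s)%N.
  by elim: s => //= y s <-; lia.
have ea : sp_a O = sp_a L.
  apply: (sorted_eq geq_trans geq_anti (sp_a_geq O) (sp_a_geq L)).
  apply/allP => x _ /=; apply/eqP.
  have fe' c : count (leq c) (sp_a O) = count (leq c) (sp_a L) := fe c.
  by apply: (@addIn (count (leq x.+1) (sp_a L))); rewrite [RHS]cm -fe' cm fe'.
have gt (s : seq nat) c : (\sum_(x <- s) (x - c.+1) + count (leq c.+1) s = \sum_(x <- s) (x - c))%N.
  by elim: s => [|y s IH]; rewrite ?big_nil // !big_cons /= -IH; lia.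
apply: superpart_eq => //.
apply: (sorted_eq geq_trans geq_anti (sp_s_sorted O) (sp_s_sorted L)).
apply/allP => x _ /=; apply/eqP; case: (posnP x) => [->|x0].
  by rewrite (count_memPn (sp_s_pos O)) (count_memPn (sp_s_pos L)).
have c1 c : count (leq c.+1) (sp_s O) = count (leq c.+1) (sp_s L).
  have := gt (sp_seq O) c; have := gt (sp_seq L) c; rewrite -!/(sp_excess _ _) !ex /sp_seq !count_cat ea.
  by lia.
rewrite -(prednK x0).
by apply: (@addIn (count (leq x.-1.+2) (sp_s L))); rewrite [RHS]cm -c1 cm c1.
Qed.

End SuperpartOrder.

(** * Symmetric superfunctions *)

Section MonomialAction.
Implicit Types (s t g : nat -> nat) (M : smonom) (I J : {fset nat}) (b : {cmonom nat}).

Lemma cmonomP b b' : (forall i, b i = b' i) -> b = b'.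
Proof. by move=> h; apply/eqP/cmP. Qed.

Lemma expcmnE (k n i : nat) : (expcmn (ucm k) n : {cmonom nat}) i = ((k == i) * n)%N.
Proof.
rewrite /expcmn; case: n => [|n]; first by rewrite /= onecmE muln0.
rewrite iteropS; elim: n => [|n IH]; first by rewrite /= ucmE muln1.
by rewrite iterS mulcmE IH ucmE [RHS]mulnS.
Qed.

Lemma big_mmulE (T : Type) (r : seq T) (P : pred T) (F : T -> {cmonom nat}) i :
  (\big[mmul/mone]_(x <- r | P x) F x) i = (\sum_(x <- r | P x) F x i)%N.
Proof.
by apply: (big_morph (fun b : {cmonom nat} => b i)) => [x y|]; rewrite ?cmM ?cm1.
Qed.

Lemma sum_finsupp b (F : nat -> nat -> nat) (r : seq nat) : uniq r ->
  {subset finsupp b <= r} -> (forall k, F k 0 = 0)%N ->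
  (\sum_(k <- finsupp b) F k (b k) = \sum_(k <- r) F k (b k))%N.
Proof.
move=> ur sub F0; rewrite [RHS](bigID (mem (finsupp b))) /= [X in (_ + X)%N]big1 ?addn0.
  rewrite -[RHS]big_filter; apply/perm_big/uniq_perm; rewrite ?fset_uniq ?filter_uniq //.
  by move=> k; rewrite mem_filter; case: (boolP (k \in finsupp b)) => //= /sub ->.
by move=> k; rewrite -cmE_eq0 => /eqP ->.
Qed.

Lemma perm_smonom2 s g M i : cancel s g -> cancel g s ->
  (perm_smonom s M).2 i = M.2 (g i).
Proof.
move=> sg gs; rewrite /perm_smonom /= big_mmulE.
under eq_bigr do rewrite expcmnE.
rewrite (@sum_finsupp M.2 (fun k x => (s k == i) * x)%N (undup (g i :: finsupp M.2))).
- rewrite (bigD1_seq (g i)) ?undup_uniq ?mem_undup ?mem_head //= gs eqxx mul1n.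
  rewrite big1 ?addn0 // => k nk; case: eqP => // ski.
  by case/eqP: nk; rewrite -ski sg.
- exact: undup_uniq.
- by move=> k ks; rewrite mem_undup inE ks orbT.
by move=> k; rewrite muln0.
Qed.

Lemma mem_perm_smonom s g M i : cancel s g -> cancel g s ->
  (i \in (perm_smonom s M).1) = (g i \in M.1).
Proof.
move=> sg gs; rewrite /perm_smonom /=; apply/imfsetP/idP => /= [[k kM ->]|giM].
  by rewrite sg.
by exists (g i); rewrite ?gs.
Qed.

Lemma perm_smonomK s g : cancel s g -> cancel g s ->
  cancel (perm_smonom s) (perm_smonom g).
Proof.
move=> sg gs M; rewrite [RHS]surjective_pairing [LHS]surjective_pairing; congr (_, _).
  by apply/fsetP => i; rewrite (mem_perm_smonom _ _ gs sg) (mem_perm_smonom _ _ sg gs) sg.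
by apply: cmonomP => i; rewrite (perm_smonom2 _ _ gs sg) (perm_smonom2 _ _ sg gs) sg.
Qed.

Lemma perm_smonom_comp s t M : bijective s -> bijective t ->
  perm_smonom t (perm_smonom s M) = perm_smonom (t \o s) M.
Proof.
move=> [g sg gs] [h th ht].
have c1 : cancel (t \o s) (g \o h) by apply: can_comp.
have c2 : cancel (g \o h) (t \o s) by apply: can_comp.
rewrite [RHS]surjective_pairing [LHS]surjective_pairing; congr (_, _).
  by apply/fsetP => i; rewrite (mem_perm_smonom _ _ th ht) (mem_perm_smonom _ _ sg gs) (mem_perm_smonom _ _ c1 c2).
by apply: cmonomP => i; rewrite (perm_smonom2 _ _ th ht) (perm_smonom2 _ _ sg gs) (perm_smonom2 _ _ c1 c2).
Qed.

Lemma perm_seriesE s g f N : cancel s g -> cancel g s ->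
  perm_series s f N =
    (-1) ^+ perm_theta_inv s (perm_smonom g N).1 * f (perm_smonom g N).
Proof.
move=> sg gs; rewrite /perm_series.
rewrite (_ : [set M | perm_smonom s M = N] = [set perm_smonom g N]) ?fsbig_set1 //.
apply/seteqP; split=> M /= => [<-|->]; first by rewrite (perm_smonomK sg gs).
by rewrite (perm_smonomK gs sg).
Qed.

Lemma finitary_id : finitary_perm id.
Proof. by split; [exists id | rewrite (_ : [set i | _] = set0) //; apply/seteqP; split]. Qed.

Lemma finitary_comp s t : finitary_perm s -> finitary_perm t -> finitary_perm (t \o s).
Proof.
move=> [bs fs] [bt ft]; split; first exact: bij_comp.
apply: (sub_finite_set (B := [set i | s i <> i] `|` [set i | t i <> i])); last by rewrite finite_setU.
move=> i /= h; case: (pselect (s i = i)) => [e|]; last by left.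
by right; move: h; rewrite e.
Qed.

Lemma finitary_inv s g : cancel s g -> cancel g s -> finitary_perm s -> finitary_perm g.
Proof.
move=> sg gs [_ fs]; split; first by exists s.
apply: sub_finite_set fs => i /= h e; apply: h.
by rewrite -{1}e sg.
Qed.

Lemma odd_sum_eq (T : eqType) (r : seq T) (F G : T -> nat) :
  (forall x, x \in r -> odd (F x) = odd (G x)) ->
  odd (\sum_(x <- r) F x) = odd (\sum_(x <- r) G x).
Proof.
elim: r => [|x r IH] h; first by rewrite !big_nil.
rewrite !big_cons !oddD h ?mem_head // IH // => y yr; apply: h.
by rewrite inE yr orbT.
Qed.

(** Collects the two orders of an unordered pair, so that signs can be compared pair by pair. *)
Lemma sum_pairs (r : seq nat) (h : nat -> nat -> nat) : (forall i, h i i = 0%N) ->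
  (\sum_(i <- r) \sum_(j <- r) h i j
    = \sum_(i <- r) \sum_(j <- r) (i < j) * (h i j + h j i))%N.
Proof.
move=> h0.
transitivity (\sum_(i <- r) \sum_(j <- r) ((i < j) * h i j + (j < i) * h i j))%N.
  apply: eq_bigr => i _; apply: eq_bigr => j _.
  by case: (ltngtP i j) => [_|_|->]; rewrite ?mul1n ?mul0n ?addn0 ?h0.
under eq_bigr do rewrite big_split /=.
rewrite big_split /= [X in (_ + X)%N]exchange_big /= -big_split /=.
apply: eq_bigr => i _; rewrite -big_split /=; apply: eq_bigr => j _.
by rewrite -mulnDr.
Qed.

Lemma sign_oddP (R : pzRingType) m n : odd m = odd n -> (-1) ^+ m = (-1) ^+ n :> R.
Proof. by move=> e; rewrite -signr_odd e signr_odd. Qed.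

(** A pair is inverted by the composite if and only if exactly one of the two steps inverts it. *)
Lemma perm_theta_inv_comp s t I : injective s -> injective t ->
  odd (perm_theta_inv (t \o s) I)
    = odd (perm_theta_inv s I + perm_theta_inv t [fset s i | i in I]%fset).
Proof.
move=> si ti; rewrite /perm_theta_inv.
rewrite [X in (_ + X)%N]big_imfset /=; last by move=> x y _ _; apply: si.
under [X in odd (_ + X)]eq_bigr => i _.
  rewrite big_imfset /=; last by move=> x y _ _; apply: si.
over.
rewrite [X in odd X = _]sum_pairs; last by move=> i; rewrite ltnn.
rewrite [X in _ = odd (X + _)]sum_pairs; last by move=> i; rewrite ltnn.
rewrite [X in _ = odd (_ + X)]sum_pairs; last by move=> i; rewrite ltnn.
rewrite -big_split /=; apply: odd_sum_eq => i _; rewrite -big_split /=; apply: odd_sum_eq => j _.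
case: (ltngtP i j) => // ij.
have nij : s i != s j by rewrite (inj_eq si) neq_ltn ij.
have ntij : t (s i) != t (s j) by rewrite (inj_eq ti).
by case: (ltngtP (s i) (s j)) nij => //= _ _; case: (ltngtP (t (s i)) (t (s j))) ntij.
Qed.

(** The pairs inside [I] and inside [J] agree on both sides. A pair across is out of order after [s]
    if and only if either it was so before or [s] inverts it, but not both. This makes the action of
    [s] compatible with products of thetas. *)
Lemma perm_theta_inv_union s I J : injective s -> [disjoint I & J]%fset ->
  odd (perm_theta_inv s (I `|` J)%fset + theta_inv I J)
  = odd (perm_theta_inv s I + perm_theta_inv s J
         + theta_inv [fset s i | i in I]%fset [fset s j | j in J]%fset).
Proof.
move=> si dIJ; rewrite /perm_theta_inv /theta_inv.
have bU (F : nat -> nat) : (\sum_(i <- (I `|` J)%fset) F i = \sum_(i <- I) F i + \sum_(i <- J) F i)%N.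
  rewrite -big_cat /=; apply/perm_big/uniq_perm; rewrite ?fset_uniq //.
    rewrite cat_uniq !fset_uniq andbT /=; apply/hasPn => x xJ; apply/negP => xI.
    by move/fdisjointP: dIJ => /(_ x xI); rewrite xJ.
  by move=> x; rewrite mem_cat inE.
rewrite bU; under eq_bigr do rewrite bU; under [X in (_ + X + _)%N]eq_bigr do rewrite bU.
rewrite !big_split /= [X in _ = odd (_ + X)]big_imfset /=; last by move=> x y _ _; apply: si.
under [X in _ = odd (_ + _ + X)]eq_bigr => i _.
  rewrite big_imfset /=; last by move=> x y _ _; apply: si.
over.
rewrite [X in odd (_ + (X + _) + _) = _]exchange_big /=.
set A := (\sum_(i <- I) \sum_(j <- I) _)%N; set D := (\sum_(i <- J) \sum_(j <- J) _)%N.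
set B := (\sum_(i <- I) \sum_(j <- J) _)%N; set C := (\sum_(j <- I) \sum_(i <- J) _)%N.
set E := (\sum_(i <- I) \sum_(j <- J) _)%N; set F := (\sum_(i <- I) \sum_(j <- J) _)%N.
suff h : odd (B + C + E) = odd F.
  by move: h; rewrite !oddD; do 6!case: (odd _).
rewrite /B /C /E /F -!big_split /=; apply: odd_sum_eq => i iI.
rewrite -!big_split /=; apply: odd_sum_eq => j jJ.
have nij : i != j by apply/eqP => e; move/fdisjointP: dIJ => /(_ i iI); rewrite e jJ.
have nsij : s i != s j by rewrite (inj_eq si).
by case: (ltngtP i j) nij => //= _ _; case: (ltngtP (s i) (s j)) nsij.
Qed.

End MonomialAction.

Lemma Qbeta_char0 n : n.+1%:R != 0 :> Qbeta.
Proof.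
rewrite -(rmorph_nat (@tofrac {poly rat})) tofrac_eq0 -polyC_natr polyC_eq0.
by rewrite Num.Theory.pnatr_eq0.
Qed.

(** * Symmetric superfunctions and leading monomials *)

Section SymmetricSeries.
Implicit Types (s t g : nat -> nat) (M N : smonom) (I J : {fset nat}) (b : {cmonom nat}) (L O : superpart).

Lemma sym_perm_smonom f s M : sym_superfun f -> finitary_perm s ->
  f (perm_smonom s M) = (-1) ^+ perm_theta_inv s M.1 * f M.
Proof.
move=> [_ fsym] fs; have [[g sg gs] _] := fs.
by rewrite -{1}(fsym s fs) (perm_seriesE _ _ sg gs) (perm_smonomK sg gs).
Qed.

Definition adj i (k : nat) : nat := if k == i then i.+1 else if k == i.+1 then i else k.

Lemma adjK i : involutive (adj i).
Proof.
move=> k; rewrite /adj; case: (k =P i) => [->|ki]; first by rewrite eqxx gtn_eqF.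
case: (k =P i.+1) => [->|ki1]; first by rewrite eqxx.
by move/eqP: ki => /negbTE ->; move/eqP: ki1 => /negbTE ->.
Qed.

Lemma adj_finitary i : finitary_perm (adj i).
Proof.
split; first exact: (inv_bij (@adjK i)).
apply: (sub_finite_set (B := [set` [:: i; i.+1]])); last exact: finite_seq.
by move=> k /=; rewrite !inE /adj; case: eqP => // _; case: eqP.
Qed.

Lemma perm_theta_inv_adj i I :
  perm_theta_inv (adj i) I = ((i \in I) && (i.+1 \in I))%N.
Proof.
rewrite /perm_theta_inv.
have E x y : ((x < y) && (adj i y < adj i x) = (x == i) && (y == i.+1))%N.
  rewrite /adj; case: (x =P i) => [->|xi]; case: (y =P i) => [->|yi];
    case: (x =P i.+1) => // xi1; case: (y =P i.+1) => // yi1; lia.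
under eq_bigr do under eq_bigr do rewrite E.
have S (k : nat) : (\sum_(j <- I) (j == k) = (k \in I))%N.
  by rewrite -(count_uniq_mem k (fset_uniq I)) -sum1_count [RHS]big_mkcond.
under eq_bigr => x _.
  rewrite (eq_bigr (fun y : nat => (x == i) * (y == i.+1))%N); last by move=> y _; rewrite mulnb.
  rewrite -big_distrr /= S; over.
by rewrite -big_distrl /= S mulnb.
Qed.

Lemma lead2 L i : (leading_smonom L).2 i = nth 0%N (sp_seq L) i.
Proof.
rewrite /leading_smonom /= big_mmulE.
under eq_bigr do rewrite expcmnE.
have [lti|le] := ltnP i (sp_length L).
  rewrite (bigD1 (Ordinal lti)) //= eqxx mul1n big1 ?addn0 // => k nk.
  by rewrite -val_eqE /= in nk; rewrite (negbTE nk).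
rewrite big1 ?nth_default // => k _; case: eqP => // e.
by move: le; rewrite -e leqNgt ltn_ord.
Qed.

Lemma lead1 L i : (i \in (leading_smonom L).1) = (i < sp_fermionic_degree L)%N.
Proof.
apply/imfsetP/idP => /= [[k]|lti]; first by rewrite mem_iota => /andP [_ lt] ->.
by exists i; rewrite // mem_iota.
Qed.

Lemma nth_filter_pos (r : seq nat) k : sorted geq r ->
  nth 0%N [seq x <- r | (0 < x)%N] k = nth 0%N r k.
Proof.
elim: r k => // x r IH k sr; have sr' := path_sorted sr.
have /allP mn := order_path_min geq_trans sr.
rewrite /=; case: (posnP x) => [x0|x0]; last by case: k => //= k; apply: IH.
have -> : [seq y <- r | (0 < y)%N] = [::].
  by apply/eqP; rewrite -size_eq0 size_filter -leqn0 leqNgt -has_count; apply/hasP => -[y /mn /=]; lia.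
rewrite nth_nil; case: k => //= k; apply/esym.
have [lt|le] := ltnP k (size r); last by rewrite nth_default.
by have := mn _ (mem_nth 0%N lt) => /=; lia.
Qed.

Lemma fset_iota I : (forall i, i.+1 \in I -> i \in I) ->
  forall i, (i \in I) = (i < #|` I|)%N.
Proof.
move=> cl.
have dn i j : (i <= j)%N -> j \in I -> i \in I.
  elim: j => [|j IH]; first by rewrite leqn0 => /eqP ->.
  by rewrite leq_eqVlt => /orP [/eqP ->//|]; rewrite ltnS => /IH h /cl.
have up k : (forall i, (i < k)%N -> i \in I) -> (k <= #|` I|)%N.
  move=> h; rewrite -(size_iota 0 k); apply: uniq_leq_size; first exact: iota_uniq.
  by move=> i; rewrite mem_iota => /andP [_]; apply: h.
move=> i; apply/idP/idP => [iI|].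
  by apply: up => j ji; apply: dn iI.
apply: contraLR => nI; rewrite -leqNgt -[leqRHS](size_iota 0); apply: uniq_leq_size.
  exact: fset_uniq.
by move=> j jI; rewrite mem_iota /= add0n ltnNge; apply: contra nI => /dn; apply.
Qed.

Lemma sorted_map_iota (F : nat -> nat) (r : rel nat) a n :
  (forall i, (a <= i)%N -> (i.+1 < a + n)%N -> r (F i) (F i.+1)) ->
  sorted r [seq F i | i <- iota a n].
Proof.
elim: n a => // n IH a h /=; have := IH a.+1; case: n {IH} h => //= n h IH.
by rewrite h ?IH //; first (move=> i ai lt; apply: h); lia.
Qed.

Lemma lead_exists M :
  (forall i, i.+1 \in M.1 -> i \in M.1 /\ (M.2 i.+1 < M.2 i)%N) ->
  (forall i, i \notin M.1 -> (M.2 i.+1 <= M.2 i)%N) ->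
  exists L, M = leading_smonom L.
Proof.
move=> h1 h2; pose m := #|` M.1|.
have memI i : (i \in M.1) = (i < m)%N by apply: fset_iota => j /h1 [].
(* [B] exceeds every index with a positive exponent, so that [B] entries from index [m] on exhaust
   the bosonic parts. *)
pose B := (\sum_(k <- finsupp M.2) k.+1)%N.
have bB i : (B <= i)%N -> M.2 i = 0%N.
  move=> Bi; apply/eqP; rewrite cmE_eq0; apply/negP => iS.
  by move: Bi; rewrite /B (big_rem i) //=; lia.
pose a := [seq M.2 i | i <- iota 0 m].
pose sl := [seq M.2 i | i <- iota m B].
have sa : sorted gtn a.
  by apply: sorted_map_iota => i _; rewrite add0n -memI => /h1 [].
have ssl : sorted geq sl.
  by apply: sorted_map_iota => i mi _; apply: h2; rewrite memI -leqNgt.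
pose sl' := [seq x <- sl | (0 < x)%N].
have sp : is_superpart (a, sl').
  apply/and3P; split=> //=; last by rewrite mem_filter.
  by apply: sorted_filter => //; apply: geq_trans.
exists (Superpart sp); rewrite [LHS]surjective_pairing [RHS]surjective_pairing; congr (_, _).
  by apply/fsetP => i; rewrite lead1 memI /sp_fermionic_degree /sp_a /= size_map size_iota.
apply: cmonomP => i; rewrite lead2 /sp_seq /sp_a /sp_s /= nth_cat size_map size_iota.
case: ltnP => [im|mi]; first by rewrite (nth_map 0%N) ?size_iota // nth_iota.
rewrite nth_filter_pos //; have [lt|le] := ltnP (i - m) B.
  by rewrite (nth_map 0%N) ?size_iota // nth_iota // subnKC.
by rewrite nth_default ?size_map ?size_iota // bB //; lia.
Qed.

(** Adjacent exchanges change a value only by a sign and sort the monomial into leading form. Equal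
    exponents at two neighbouring thetas make the value equal to its negative. *)
Lemma sym_superfun_eq0 f : sym_superfun f ->
  (forall L, f (leading_smonom L) = 0) -> forall M, f M = 0.
Proof.
move=> fsym f0.
have nz2 : 2%:R != 0 :> Qbeta := Qbeta_char0 1.
have step i M : f (perm_smonom (adj i) M) = 0 -> f M = 0.
  rewrite (sym_perm_smonom _ fsym (adj_finitary i)) => /eqP.
  by rewrite mulf_eq0 signr_eq0 => /eqP.
(* With [D] above all exponents, sorting by this weight puts the indices that carry a theta
   first. *)
pose w D M k := ((k \in M.1) * D + M.2 k)%N.
have wadj D M i k : w D (perm_smonom (adj i) M) k = w D M (adj i k).
  by rewrite /w (mem_perm_smonom _ _ (@adjK i) (@adjK i)) (perm_smonom2 _ _ (@adjK i) (@adjK i)).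
suff H D B n M : (forall k, (M.2 k < D)%N) -> (forall k, (B <= k)%N -> w D M k = 0%N) ->
    (\sum_(k < B) k * w D M k < n)%N -> f M = 0.
  move=> M; pose D := (monalg.mdeg M.2).+1.
  pose B := (\sum_(k <- finsupp M.2) k.+1 + \sum_(k <- M.1) k.+1)%N.
  apply: (H D B _ M _ _ (ltnSn _)) => k.
    rewrite ltnS monalg.mdegE; case: (boolP (k \in finsupp M.2)) => [kM|]; first by rewrite (big_rem k) //= leq_addr.
    by rewrite -cmE_eq0 => /eqP ->.
  move=> Bk; rewrite /w; apply/eqP; rewrite addn_eq0 muln_eq0; apply/andP; split.
    rewrite orbC /=; case: (boolP (k \in M.1)) => // kM.
    by move: Bk; rewrite /B [X in (_ + X)%N](big_rem k) //=; lia.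
  rewrite cmE_eq0; apply/negP => kM.
  by move: Bk; rewrite /B [X in (X + _)%N](big_rem k) //=; lia.
elim: n M => // n IH M hD hB lt.
case: (pselect (exists i, (w D M i < w D M i.+1)%N)) => [[i wi]|nw].
  apply: (step i).
  have iB : (i.+1 < B)%N by rewrite ltnNge; apply/negP => /hB e; rewrite e in wi.
  apply: IH => [k|k Bk|].
  - by rewrite (perm_smonom2 _ _ (@adjK i) (@adjK i)).
  - by rewrite wadj hB // /adj; case: eqP => [ki|_]; [|case: eqP => [ki|_]]; lia.
  rewrite ltnS in lt; apply: leq_trans lt.
  have iB' : (i < B)%N by apply: ltnW.
  rewrite (bigD1 (Ordinal iB)) // (bigD1 (Ordinal iB')) /=; last by rewrite -val_eqE /= ltn_eqF.
  rewrite [leqRHS](bigD1 (Ordinal iB)) // [X in (_ <= _ + X)%N](bigD1 (Ordinal iB')) /=; last by rewrite -val_eqE /= ltn_eqF.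
  rewrite !wadj (eq_bigr (fun k : 'I_B => k * w D M k)%N) => [|k /andP [k1 k2]]; last first.
    rewrite -val_eqE /= in k1; rewrite -val_eqE /= in k2.
    by rewrite wadj /adj (negbTE k1) (negbTE k2).
  rewrite /adj eqxx (gtn_eqF (ltnSn i)) eqxx; move: wi; rewrite !mulSn.
  move: (w D M i) (w D M i.+1) => x y; move: (\sum_(k < B | _) _)%N => z.
  nia.
have wle i : (w D M i.+1 <= w D M i)%N by rewrite leqNgt; apply/negP => h; apply: nw; exists i.
have cl i : i.+1 \in M.1 -> i \in M.1.
  move=> h; apply/negPn/negP => ni; have := wle i; rewrite /w h (negbTE ni) mul1n mul0n add0n.
  by have := hD i; lia.
case: (pselect (exists i, [/\ i \in M.1, i.+1 \in M.1 & M.2 i.+1 = M.2 i])) => [[i [iM i1M e]]|ne].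
  have fixM : perm_smonom (adj i) M = M.
    rewrite [RHS]surjective_pairing [LHS]surjective_pairing; congr (_, _).
      apply/fsetP => k; rewrite (mem_perm_smonom _ _ (@adjK i) (@adjK i)) /adj.
      by case: eqP => [->|_]; rewrite ?iM ?i1M //; case: eqP => [->|_]; rewrite ?iM ?i1M.
    apply: cmonomP => k; rewrite (perm_smonom2 _ _ (@adjK i) (@adjK i)) /adj.
    by case: eqP => [->|_] //; case: eqP => [->|_].
  have := sym_perm_smonom M fsym (adj_finitary i).
  rewrite fixM perm_theta_inv_adj iM i1M expr1 mulN1r => /eqP.
  by rewrite -addr_eq0 -mulr2n -mulr_natl mulf_eq0 (negbTE nz2) => /eqP.
have [|i iM|L ->] := @lead_exists M; last exact: f0.
  move=> i i1M; have iM := cl i i1M; split=> //.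
  have := wle i; rewrite /w iM i1M !mul1n leq_add2l leq_eqVlt => /orP [/eqP e|//].
  by exfalso; apply: ne; exists i.
have i1M : i.+1 \notin M.1 by apply: contra iM; apply: cl.
by have := wle i; rewrite /w (negbTE iM) (negbTE i1M) !mul0n.
Qed.

End SymmetricSeries.

(** * Supermonomials *)

Section Supermonomials.
Implicit Types (s t g : nat -> nat) (M N : smonom) (I J : {fset nat}) (b : {cmonom nat}) (L O : superpart).

Lemma perm_series_lead s M N : bijective s ->
  perm_series s (smonom_series M) N =
    (-1) ^+ perm_theta_inv s M.1 * (N == perm_smonom s M)%:R.
Proof.
move=> [g sg gs]; rewrite (perm_seriesE _ _ sg gs) /smonom_series.
have -> : (perm_smonom g N == M) = (N == perm_smonom s M).
  apply/eqP/eqP => [<-|->]; first by rewrite (perm_smonomK gs sg).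
  by rewrite (perm_smonomK sg gs).
by case: eqP => [->|_]; rewrite ?mulr0 // (perm_smonomK sg gs).
Qed.

(** The fermionic parts are distinct, so the image monomial determines the permutation on the
    indices that carry a theta, and with it the sign. Hence no monomial occurs with both signs among
    the terms of a supermonomial. *)
Lemma lead_stab L s t : finitary_perm s -> finitary_perm t ->
  perm_smonom s (leading_smonom L) = perm_smonom t (leading_smonom L) ->
  perm_theta_inv s (leading_smonom L).1 = perm_theta_inv t (leading_smonom L).1.
Proof.
move=> [[g sg gs] _] [[h th ht] _] e; set M := leading_smonom L in e *.
have st k : k \in M.1 -> s k = t k.
  move=> kM; have : s k \in (perm_smonom s M).1 by rewrite (mem_perm_smonom _ _ sg gs) sg.
  rewrite e (mem_perm_smonom _ _ th ht) => hM.
  have : (perm_smonom s M).2 (s k) = M.2 k by rewrite (perm_smonom2 _ _ sg gs) sg.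
  rewrite e (perm_smonom2 _ _ th ht) !lead2; rewrite !lead1 in kM hM.
  rewrite /sp_seq !nth_cat kM hM => /eqP.
  by rewrite nth_uniq ?sp_a_uniq // => /eqP e2; rewrite -[LHS]ht e2.
rewrite /perm_theta_inv big_seq [RHS]big_seq; apply: eq_bigr => i iM.
by rewrite big_seq [RHS]big_seq; apply: eq_bigr => j jM; rewrite !st.
Qed.

Lemma supermonomial_orbit L s : finitary_perm s ->
  supermonomial L (perm_smonom s (leading_smonom L))
  = (-1) ^+ perm_theta_inv s (leading_smonom L).1.
Proof.
move=> fs; rewrite /supermonomial; set M := perm_smonom s _.
set T := [set _ | _ in _].
pose t0 := perm_series s (smonom_series (leading_smonom L)).
rewrite -(@fsbig_widen _ _ _ _ [set t0] T) => [||t /= [[r fr <-] nt]].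
- by rewrite fsbig_set1 /t0 perm_series_lead ?eqxx ?mulr1 //; case: fs.
- by move=> t /= ->; exists s.
have br : bijective r by case: fr. have bs : bijective s by case: fs.
rewrite perm_series_lead //; case: eqP => [e|_]; last by rewrite mulr0.
case: nt; apply/funext => N.
by rewrite /t0 (perm_series_lead _ N br) (perm_series_lead _ N bs) -/M -e (lead_stab fs fr e).
Qed.

Lemma supermonomial_notin L M :
  (forall s, finitary_perm s -> M <> perm_smonom s (leading_smonom L)) ->
  supermonomial L M = 0.
Proof.
move=> nM; rewrite /supermonomial; apply: fsbig1 => t /= [r fr <-].
rewrite perm_series_lead; last by case: fr.
by case: eqP => [/nM|_]; rewrite ?mulr0 // => /(_ fr).
Qed.

Lemma supermonomialP L M : supermonomial L M != 0 ->
  exists2 s, finitary_perm s & M = perm_smonom s (leading_smonom L).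
Proof.
move=> nz; apply: contrapT => ne; case/eqP: nz; apply: supermonomial_notin => s fs e.
by apply: ne; exists s.
Qed.

Lemma sum_finsupp_perm s g M (F : nat -> nat) : cancel s g -> cancel g s ->
  (\sum_(k <- finsupp (perm_smonom s M).2) F ((perm_smonom s M).2 k)
    = \sum_(k <- finsupp M.2) F (M.2 k))%N.
Proof.
move=> sg gs; have -> : finsupp (perm_smonom s M).2 = [fset s k | k in finsupp M.2]%fset.
  apply/fsetP => k; rewrite -cmE_neq0 (perm_smonom2 _ _ sg gs) cmE_neq0.
  apply/idP/imfsetP => /= [gk|[j jM ->]]; first by exists (g k); rewrite ?gs.
  by rewrite sg.
rewrite big_imfset /=; last by move=> x y _ _; apply: (can_inj sg).
by apply: eq_bigr => k _; rewrite (perm_smonom2 _ _ sg gs) sg.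
Qed.

Lemma sum_fset_perm s g M (F : nat -> nat) : cancel s g -> cancel g s ->
  (\sum_(k <- (perm_smonom s M).1) F ((perm_smonom s M).2 k)
    = \sum_(k <- M.1) F (M.2 k))%N.
Proof.
move=> sg gs; have -> : (perm_smonom s M).1 = [fset s k | k in M.1]%fset by [].
rewrite big_imfset /=.
  by apply: eq_bigr => k _; rewrite (perm_smonom2 _ _ sg gs) sg.
by move=> x y _ _; apply: (can_inj sg).
Qed.

Lemma smonom_degree_perm s M : bijective s -> smonom_degree (perm_smonom s M) = smonom_degree M.
Proof.
move=> [g sg gs]; rewrite /smonom_degree !monalg.mdegE (sum_finsupp_perm _ id sg gs).
by rewrite card_imfset //; apply: (can_inj sg).
Qed.

Lemma supermonomial_sym L : sym_superfun (supermonomial L).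
Proof.
split=> [|r fr].
  exists (smonom_degree (leading_smonom L)) => M /supermonomialP [s [bs _] ->].
  by rewrite smonom_degree_perm.
apply/funext => N; have [[g rg gr] _] := fr; rewrite (perm_seriesE _ _ rg gr).
have [z|nz] := eqVneq (supermonomial L (perm_smonom g N)) 0.
  rewrite z mulr0; apply/esym/supermonomial_notin => s fs e; move/eqP: z; apply/negP.
  have fg : finitary_perm g := finitary_inv rg gr fr.
  rewrite e perm_smonom_comp; [|by case: fs|by case: fg].
  by rewrite supermonomial_orbit ?signr_eq0 //; apply: finitary_comp.
have [s fs e] := supermonomialP nz; have bs : bijective s by case: fs.
have br : bijective r by case: fr.
rewrite e supermonomial_orbit //.
have -> : N = perm_smonom (r \o s) (leading_smonom L).
  by rewrite -perm_smonom_comp // -e (perm_smonomK gr rg).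
rewrite supermonomial_orbit; last exact: finitary_comp.
rewrite -exprD; apply: sign_oddP.
by rewrite (perm_theta_inv_comp _ (bij_inj bs) (bij_inj br)) addnC.
Qed.

Definition smonom_excess c M : nat := (\sum_(k <- finsupp M.2) (M.2 k - c))%N.
Definition smonom_fermi c M : nat := (\sum_(k <- M.1) (c <= M.2 k))%N.

Lemma sum_nth_seq (r : seq nat) (F : nat -> nat) b : F 0%N = 0%N ->
  (forall i, b i = nth 0%N r i) ->
  (\sum_(k <- finsupp b) F (b k) = \sum_(x <- r) F x)%N.
Proof.
move=> F0 br; rewrite (@sum_finsupp b (fun _ => F) (iota 0 (size r))) ?iota_uniq //.
  by rewrite [RHS](big_nth 0%N) /index_iota subn0; apply: eq_bigr => i _; rewrite br.
move=> k; rewrite mem_iota /= add0n -cmE_neq0 br => nz.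
by rewrite ltnNge; apply: contra nz => le; rewrite nth_default.
Qed.

Lemma lead_excess c L : smonom_excess c (leading_smonom L) = sp_excess c L.
Proof. by apply: (sum_nth_seq (F := fun x => (x - c)%N)) => // i; apply: lead2. Qed.

Lemma lead_fset L :
  perm_eq (leading_smonom L).1 (iota 0 (sp_fermionic_degree L)).
Proof.
apply: uniq_perm; rewrite ?fset_uniq ?iota_uniq // => i.
by rewrite lead1 mem_iota.
Qed.

Lemma lead_fermi c L : smonom_fermi c (leading_smonom L) = sp_fermi_count c L.
Proof.
rewrite /smonom_fermi (perm_big _ (lead_fset L)) /= /sp_fermi_count -sum1_count.
rewrite [RHS]big_mkcond [RHS](big_nth 0%N) /= /index_iota subn0.
rewrite big_seq [RHS]big_seq; apply: eq_bigr => i; rewrite mem_iota /= add0n => lt.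
by rewrite lead2 /sp_seq nth_cat lt.
Qed.

Lemma lead_degree L : monalg.mdeg (leading_smonom L).2 = sp_degree L.
Proof.
rewrite monalg.mdegE (sum_nth_seq (F := id) (r := sp_seq L)) ?/sp_degree ?sumnE // => i.
exact: lead2.
Qed.

Lemma lead_card L : #|` (leading_smonom L).1| = sp_fermionic_degree L.
Proof. by have /perm_size := lead_fset L; rewrite size_iota. Qed.

Lemma supermonomial_invariants L M : supermonomial L M != 0 ->
  [/\ #|` M.1| = sp_fermionic_degree L, monalg.mdeg M.2 = sp_degree L,
    forall c, smonom_excess c M = sp_excess c L
    & forall c, smonom_fermi c M = sp_fermi_count c L].
Proof.
move=> /supermonomialP [s [[g sg gs] _] ->]; split.
- by rewrite card_imfset ?lead_card //; apply: (can_inj sg).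
- by rewrite monalg.mdegE (sum_finsupp_perm _ id sg gs) -monalg.mdegE lead_degree.
- by move=> c; rewrite /smonom_excess (sum_finsupp_perm _ (fun x => (x - c)%N) sg gs) -lead_excess.
by move=> c; rewrite /smonom_fermi (sum_fset_perm _ (fun x => (c <= x)%N : nat) sg gs) -lead_fermi.
Qed.

(** Degrees, excesses and fermionic counts are constant on orbits and determine a superpartition, so
    an orbit contains a single leading monomial. *)
Lemma supermonomial_lead L O : supermonomial L (leading_smonom O) = (L == O)%:R.
Proof.
have [<-|ne] := eqVneq L O.
  have e : perm_smonom id (leading_smonom L) = leading_smonom L.
    rewrite [RHS]surjective_pairing [LHS]surjective_pairing; congr (_, _).
      by apply/fsetP => i; rewrite (mem_perm_smonom (g := id)).
    by apply: cmonomP => i; rewrite (perm_smonom2 (g := id)).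
  rewrite -e supermonomial_orbit; last exact: finitary_id.
  rewrite /perm_theta_inv big1 ?expr0 // => i _; rewrite big1 // => j _.
  by case: ltngtP.
apply/eqP; apply: contraNT ne => /supermonomial_invariants [c _ e1 e2].
apply/eqP/esym/sp_invariants_inj; first by rewrite -c lead_card.
  by move=> x; rewrite -e1 lead_excess.
by move=> x; rewrite -e2 lead_fermi.
Qed.

Lemma supermonomial_signed L M :
  supermonomial L M = 0 \/ exists n, supermonomial L M = (-1) ^+ n.
Proof.
have [->|/supermonomialP [s fs ->]] := eqVneq (supermonomial L M) 0; first by left.
by right; exists (perm_theta_inv s (leading_smonom L).1); rewrite supermonomial_orbit.
Qed.

End Supermonomials.

(** * Restriction to finitely many variables *)

Section ProductCoefficients.
Variable N : nat.
Implicit Types (I J : {set 'I_N}) (v w : 'X_{1..N}) (f g : superseries) (M : smonom).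
Implicit Types (P Q : {set 'I_N} -> {mpoly Qbeta[N]}).

Definition fsetN I : {fset nat} := [fset val i | i in I]%fset.
Definition cmN v : {cmonom nat} := \big[mmul/mone]_(i < N) expcmn (ucm (val i)) (v i).

Lemma cmN_ord v (i : 'I_N) : cmN v i = v i.
Proof.
rewrite /cmN big_mmulE (bigD1 i) //= expcmnE eqxx mul1n big1 ?addn0 // => k nk.
by rewrite expcmnE val_eqE (negbTE nk).
Qed.

Lemma cmN_out v k : (N <= k)%N -> cmN v k = 0%N.
Proof.
move=> Nk; rewrite /cmN big_mmulE big1 // => i _; rewrite expcmnE.
by case: eqP => // e; have := ltn_ord i; rewrite -e in Nk; rewrite ltnNge Nk.
Qed.

Lemma mem_fsetN I (i : 'I_N) : (val i \in fsetN I) = (i \in I).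
Proof.
apply/imfsetP/idP => /= [[j jI /val_inj -> //]|iI].
by exists i.
Qed.

Lemma fsetN_lt I k : k \in fsetN I -> (k < N)%N.
Proof. by case/imfsetP => /= j _ ->. Qed.

Lemma cmN_of (b : {cmonom nat}) : (forall k, (N <= k)%N -> b k = 0%N) ->
  b = cmN [multinom b (val i) | i < N].
Proof.
move=> h; apply: cmonomP => k; have [lt|le] := ltnP k N; last by rewrite h // cmN_out.
by rewrite (cmN_ord _ (Ordinal lt)) mnmE.
Qed.

Lemma fsetN_of (A : {fset nat}) : (forall k, k \in A -> (k < N)%N) ->
  A = fsetN [set i : 'I_N | val i \in A]%SET.
Proof.
move=> h; apply/fsetP => k; apply/idP/imfsetP => /= [kA|[i + ->]]; last by rewrite inE.
by exists (Ordinal (h k kA)); rewrite ?inE.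
Qed.

Lemma cmN_inj : injective cmN.
Proof. by move=> v w e; apply/mnmP => i; rewrite -!cmN_ord e. Qed.

Lemma fsetN_inj : injective fsetN.
Proof. by move=> I J e; apply/setP => i; rewrite -!mem_fsetN e. Qed.

Lemma cmND v w : cmN (v + w)%MM = mmul (cmN v) (cmN w).
Proof.
apply: cmonomP => k; rewrite cmM; have [lt|le] := ltnP k N; last by rewrite !cmN_out.
by rewrite !(cmN_ord _ (Ordinal lt)) mnmDE.
Qed.

(** [P I] is the coefficient of [theta_I] in [f] after all variables from index [N] on are set to
    zero. *)
Definition represents f P := forall I v, f (fsetN I, cmN v) = (P I)@_v.

Definition ext_mul P Q I : {mpoly Qbeta[N]} :=
  \sum_(J : {set 'I_N} | J \subset I)
    (-1) ^+ theta_inv (fsetN J) (fsetN (I :\: J)) *: (P J * Q (I :\: J)).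

(** A product monomial in the first [N] variables has both factors in these variables, so
    restriction is multiplicative. The decompositions are listed by a subset [J] of [I] and a
    splitting of the exponent vector. *)
Lemma represents_mul f g P Q : represents f P -> represents g Q ->
  represents (series_mul f g) (ext_mul P Q).
Proof.
move=> rf rg I v; rewrite /ext_mul raddf_sum /= /series_mul.
set d := (mdeg v).+1.
under [RHS]eq_bigr do rewrite mcoeffZ (mcoeffM _ _ v) mulr_sumr.
rewrite pair_big_dep /= [RHS]bigfs ?index_enum_uniq //; last by move=> i _; rewrite mem_index_enum.
set A := [set` _].
pose h (x : {set 'I_N} * ('X_{1..N < d} * 'X_{1..N < d})) : smonom * smonom :=
  ((fsetN x.1, cmN x.2.1), (fsetN (I :\: x.1), cmN x.2.2)).
rewrite (_ : [set p : smonom * smonom | _] = h @` A); last first.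
  apply/seteqP; split=> [[[p1 p2] [q1 q2]] /= [dpq [e1 e2]]|[[p1 p2] [q1 q2]] /= [[J [k1 k2]] /andP [JI /eqP vk] [<- <- <- <-]]]; last first.
    split; first by apply/fdisjointP => k /imfsetP [k' /= k'J ->]; rewrite mem_fsetN inE k'J.
    congr (_, _); last by rewrite -cmND vk.
    apply/fsetP => k; rewrite inE; apply/orP/idP => [[]|/imfsetP [i /= iI ->]].
    - by case/imfsetP => /= i iJ ->; rewrite mem_fsetN (fintype.subsetP JI).
    - by case/imfsetP => /= i; rewrite inE => /andP [_ iI] ->; rewrite mem_fsetN.
    by rewrite !mem_fsetN inE iI andbT; case: (i \in J); [left|right].
  have p1N k : k \in p1 -> (k < N)%N by move=> kp; apply: (@fsetN_lt I); rewrite -e1 inE kp.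
  have q1N k : k \in q1 -> (k < N)%N by move=> kp; apply: (@fsetN_lt I); rewrite -e1 inE kp orbT.
  have s2 k : (p2 k + q2 k)%N = cmN v k by rewrite -e2 cmM.
  have p2N k : (N <= k)%N -> p2 k = 0%N by move=> Nk; have := s2 k; rewrite cmN_out //; lia.
  have q2N k : (N <= k)%N -> q2 k = 0%N by move=> Nk; have := s2 k; rewrite cmN_out //; lia.
  pose k1 := [multinom p2 (val i) | i < N]; pose k2 := [multinom q2 (val i) | i < N].
  have vk : v = (k1 + k2)%MM by apply/mnmP => i; rewrite mnmDE !mnmE s2 cmN_ord.
  have d1 : (mdeg k1 < d)%N by rewrite /d vk mdegD ltnS leq_addr.
  have d2 : (mdeg k2 < d)%N by rewrite /d vk mdegD ltnS leq_addl.
  exists ([set i : 'I_N | val i \in p1]%SET, (BMultinom d1, BMultinom d2)) => /=.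
    apply/andP; split; last by apply/eqP; exact: vk.
    apply/fintype.subsetP => i; rewrite inE => ip.
    by rewrite -mem_fsetN -e1 inE ip.
  rewrite /h /= -!cmN_of // -fsetN_of //; congr (_, (_, _)).
  apply/fsetP => k; apply/imfsetP/idP => /= [[i + ->]|kq].
    by rewrite !inE -mem_fsetN -e1 inE => /andP [/negbTE ->].
  exists (Ordinal (q1N k kq)) => //; rewrite !inE /= -(mem_fsetN I) -e1 inE kq orbT andbT.
  by apply/negP => kp; move/fdisjointP: dpq => /(_ k kp); rewrite kq.
rewrite fsbig_image => [|[J [k1 k2]] [J' [k1' k2']] _ _ /= [/fsetN_inj -> /cmN_inj e1 _ /cmN_inj e2]].
  by apply: eq_fsbigr => -[J [k1 k2]] _ /=; rewrite rf rg mulrA.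
by congr (_, (_, _)); apply: val_inj.
Qed.

End ProductCoefficients.

(** * Symmetry and degrees of products and power sums *)

Section SymmetricProducts.
Implicit Types (s t : nat -> nat) (f g : superseries) (M N : smonom) (I J : {fset nat}) (L O : superpart).

Definition bihomog m n (f : superseries) :=
  forall M, f M != 0 -> #|` M.1| = m /\ monalg.mdeg M.2 = n.

Lemma bihomog_bounded m n f : bihomog m n f -> bounded_degree f.
Proof. by move=> h; exists (m + n)%N => M /h [<- <-]. Qed.

Lemma series_mul_neq0 f g M : series_mul f g M != 0 ->
  exists M1 M2, [/\ f M1 != 0, g M2 != 0, [disjoint M1.1 & M2.1]%fset
    & M = ((M1.1 `|` M2.1)%fset, mmul M1.2 M2.2)].
Proof.
move=> nz; apply: contrapT => ne; case/eqP: nz; apply: fsbig1 => -[M1 M2] /= [d e].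
have [z|n1] := eqVneq (f M1) 0; first by rewrite z mul0r mulr0.
have [z|n2] := eqVneq (g M2) 0; first by rewrite z !mulr0.
by case: ne; exists M1, M2; split; [exact: n1|exact: n2|exact: d|exact: esym e].
Qed.

Lemma bihomog_mul m1 n1 m2 n2 f g : bihomog m1 n1 f -> bihomog m2 n2 g ->
  bihomog (m1 + m2) (n1 + n2) (series_mul f g).
Proof.
move=> hf hg M /series_mul_neq0 [M1 [M2 [/hf [<- <-] /hg [<- <-] d ->]]] /=; split.
  by rewrite cardfsU (eqP d) cardfs0 subn0.
by rewrite mdegM.
Qed.

Lemma perm_smonom_mul s t M1 M2 : cancel s t -> cancel t s ->
  perm_smonom s ((M1.1 `|` M2.1)%fset, mmul M1.2 M2.2)
  = (((perm_smonom s M1).1 `|` (perm_smonom s M2).1)%fset,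
     mmul (perm_smonom s M1).2 (perm_smonom s M2).2).
Proof.
move=> sg gs; rewrite [LHS]surjective_pairing; congr (_, _).
  by apply/fsetP => k; rewrite inE !(mem_perm_smonom _ _ sg gs) inE.
by apply: cmonomP => k; rewrite (perm_smonom2 _ _ sg gs) !cmM !(perm_smonom2 _ _ sg gs).
Qed.

(** Permuting both factors reindexes the decompositions of a monomial, and the signs match by
    [perm_theta_inv_union]. *)
Lemma sym_mul f g : sym_superfun f -> sym_superfun g -> sym_superfun (series_mul f g).
Proof.
move=> sf sg; split.
  have [[d1 h1] _] := sf; have [[d2 h2] _] := sg; exists (d1 + d2)%N => M.
  move=> /series_mul_neq0 [M1 [M2 [/h1 le1 /h2 le2 d ->]]].
  rewrite /smonom_degree in le1 le2; rewrite /smonom_degree /= mdegM cardfsU.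
  by rewrite (eqP d) cardfs0; lia.
move=> s fs; apply/funext => N; have [[t st ts] _] := fs.
have si := can_inj st.
rewrite (perm_seriesE _ _ st ts) /series_mul mulr_fsumr.
pose h (p : smonom * smonom) := (perm_smonom t p.1, perm_smonom t p.2).
set D := [set p : smonom * smonom | _]; set D' := [set p : smonom * smonom | _].
have bij : set_bij D' D h.
  have hK : cancel (fun p : smonom * smonom => (perm_smonom s p.1, perm_smonom s p.2)) h.
    by case=> p q; rewrite /h /= !(perm_smonomK st ts).
  have hK' : cancel h (fun p : smonom * smonom => (perm_smonom s p.1, perm_smonom s p.2)).
    by case=> p q; rewrite /h /= !(perm_smonomK ts st).
  have dis p q : [disjoint p.1 & q.1]%fset -> forall r r', cancel r r' -> cancel r' r ->
      [disjoint (perm_smonom r p).1 & (perm_smonom r q).1]%fset.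
    move=> /fdisjointP d r r' rr r'r; apply/fdisjointP => k.
    by rewrite !(mem_perm_smonom _ _ rr r'r) => /d.
  split=> [[p q] [/= d e]|x y _ _ /(can_inj hK') //|[p q] [/= d e]].
    split=> /=; first exact: (dis _ _ d _ _ ts st).
    by rewrite -(perm_smonom_mul _ _ ts st) e.
  exists (perm_smonom s p, perm_smonom s q); last exact: (hK (p, q)).
  split=> /=; first exact: (dis _ _ d _ _ st ts).
  by rewrite -(perm_smonom_mul _ _ st ts) e (perm_smonomK ts st).
rewrite (reindex_fsbig h D' D) //; apply: eq_fsbigr => -[p q] /set_mem [/= d e].
change ((-1) ^+ perm_theta_inv s (perm_smonom t N).1 *
  ((-1) ^+ theta_inv (perm_smonom t p).1 (perm_smonom t q).1 *
    (f (perm_smonom t p) * g (perm_smonom t q))) = (-1) ^+ theta_inv p.1 q.1 * (f p * g q)).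
have -> : f p = (-1) ^+ perm_theta_inv s (perm_smonom t p).1 * f (perm_smonom t p).
  by rewrite -(sym_perm_smonom _ sf fs) (perm_smonomK ts st).
have -> : g q = (-1) ^+ perm_theta_inv s (perm_smonom t q).1 * g (perm_smonom t q).
  by rewrite -(sym_perm_smonom _ sg fs) (perm_smonomK ts st).
have im P : P.1 = [fset s i | i in (perm_smonom t P).1]%fset.
  apply/fsetP => k; apply/idP/imfsetP => [kP|[j jP ->]].
    exists (t k); last by rewrite ts.
    by move: (mem_perm_smonom P (t k) ts st); rewrite ts => ->.
  by move: (mem_perm_smonom P j ts st) => <-.
have dt : [disjoint (perm_smonom t p).1 & (perm_smonom t q).1]%fset.
  apply/fdisjointP => k; rewrite !(mem_perm_smonom _ _ ts st).
  by move/fdisjointP: d => d /d.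
have := perm_theta_inv_union si dt; rewrite -(im p) -(im q).
rewrite -e (perm_smonom_mul _ _ ts st).
set A := perm_theta_inv s _; set B := theta_inv _ _; set C := theta_inv _ _.
set X := perm_theta_inv s _; set Y := perm_theta_inv s _ => /(sign_oddP Qbeta) e2.
have -> : (-1) ^+ A * ((-1) ^+ B * (f (perm_smonom t p) * g (perm_smonom t q)))
  = (-1) ^+ (A + B) * (f (perm_smonom t p) * g (perm_smonom t q)) by rewrite exprD mulrA.
by rewrite e2 !exprD; ring.
Qed.

Section OrbitSums.
Variable (F : nat -> smonom).
Hypothesis Finj : injective F.
Hypothesis Fperm : forall s i, bijective s -> perm_smonom s (F i) = F (s i).
Hypothesis Fcard : forall s i, perm_theta_inv s (F i).1 = 0%N.

(** Common form of [power_sum] and [fermionic_power_sum]: a sum of monomials that are permuted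
    without sign. *)
Definition osum : superseries := fun M => \sum_(i \in [set: nat]) smonom_series (F i) M.

Lemma osum_in i : osum (F i) = 1.
Proof.
rewrite /osum -(@fsbig_widen _ _ _ _ [set i]) // => [|j [_ /= ji]].
  by rewrite fsbig_set1 /smonom_series eqxx.
by rewrite /smonom_series; case: eqP => // /Finj e; case: ji.
Qed.

Lemma osum_neq0 M : osum M != 0 -> exists i, M = F i.
Proof.
move=> nz; apply: contrapT => ne; case/eqP: nz; apply: fsbig1 => i _.
by rewrite /smonom_series; case: eqP => // e; case: ne; exists i.
Qed.

Lemma osum_sym d : (forall i, smonom_degree (F i) = d) -> sym_superfun osum.
Proof.
move=> Fd; split; first by exists d => M /osum_neq0 [i ->]; rewrite Fd.
move=> s fs; apply/funext => N; have [[t st ts] _] := fs.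
rewrite (perm_seriesE _ _ st ts).
have [z|/osum_neq0 [i e]] := eqVneq (osum (perm_smonom t N)) 0.
  rewrite z mulr0; apply/esym/eqP; apply/negPn/negP => /osum_neq0 [i e].
  by move/eqP: z; rewrite e Fperm ?osum_in ?oner_eq0 //; exists s.
rewrite e Fcard osum_in mul1r -[N](perm_smonomK ts st) e Fperm ?osum_in //.
by exists t.
Qed.

End OrbitSums.

Lemma perm_theta_inv0 s : perm_theta_inv s fset0 = 0%N.
Proof. exact: big_seq_fset0. Qed.

Lemma perm_theta_inv1 s i : perm_theta_inv s [fset i]%fset = 0%N.
Proof. by rewrite /perm_theta_inv !big_seq_fset1 ltnn. Qed.

Lemma perm_smonomX s (A : bool) i n : bijective s ->
  perm_smonom s ((if A then [fset i] else fset0)%fset, expcmn (ucm i) n)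
  = ((if A then [fset s i] else fset0)%fset, expcmn (ucm (s i)) n).
Proof.
move=> [t st ts]; rewrite [LHS]surjective_pairing; congr (_, _).
  apply/fsetP => k; rewrite (mem_perm_smonom _ _ st ts) /=; case: A; rewrite !inE //.
  by apply/eqP/eqP => [<-|->]; rewrite ?ts ?st.
apply: cmonomP => k; rewrite (perm_smonom2 _ _ st ts) /= !expcmnE.
by congr (nat_of_bool _ * n)%N; apply/eqP/eqP => [->|<-]; rewrite ?ts ?st.
Qed.

Lemma mdeg_expcmn i n : monalg.mdeg (expcmn (ucm i) n : {cmonom nat}) = n.
Proof.
rewrite monalg.mdegE (@sum_finsupp _ (fun _ => id) [:: i]) // ?big_seq1 ?expcmnE ?eqxx ?mul1n //.
move=> k; rewrite -cmE_neq0 expcmnE inE; case: (i =P k) => [->|_]; first by rewrite eqxx.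
by rewrite mul0n eqxx.
Qed.

Definition fpow n i : smonom := ([fset i]%fset, expcmn (ucm i) n).
Definition bpow n i : smonom := (fset0, expcmn (ucm i) n).

Lemma fpow_inj n : injective (fpow n).
Proof. by move=> i j [/fsetP/(_ i)]; rewrite !inE eqxx => /esym/eqP. Qed.

Lemma bpow_inj n : (0 < n)%N -> injective (bpow n).
Proof.
move=> n0 i j [/(congr1 (fun b : {cmonom nat} => b i))]; rewrite !expcmnE eqxx.
by case: (j =P i) => // _; lia.
Qed.

Lemma fermionic_power_sum_sym n : sym_superfun (fermionic_power_sum n).
Proof.
apply: (@osum_sym (fpow n) (@fpow_inj n) _ _ n.+1) => [s i bs|s i|i].
- exact: (perm_smonomX true).
- exact: perm_theta_inv1.
by rewrite /smonom_degree /= cardfs1 mdeg_expcmn.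
Qed.

Lemma power_sum_sym n : (0 < n)%N -> sym_superfun (power_sum n).
Proof.
move=> n0; apply: (@osum_sym (bpow n) (bpow_inj n0) _ _ n) => [s i bs|s i|i].
- exact: (perm_smonomX false).
- exact: perm_theta_inv0.
by rewrite /smonom_degree /= ?cardfs0 mdeg_expcmn.
Qed.

Lemma fermionic_power_sum_bihomog n : bihomog 1 n (fermionic_power_sum n).
Proof. by move=> M /(@osum_neq0 (fpow n)) [i ->] /=; rewrite cardfs1 mdeg_expcmn. Qed.

Lemma power_sum_bihomog n : bihomog 0 n (power_sum n).
Proof. by move=> M /(@osum_neq0 (bpow n)) [i ->] /=; rewrite ?cardfs0 mdeg_expcmn. Qed.

Lemma series1_bihomog : bihomog 0 0 series1.
Proof.
move=> M; rewrite /series1 /smonom_series; case: (M =P _) => [-> _|]; last by rewrite eqxx.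
by rewrite cardfs0 monalg.mdeg1.
Qed.

Lemma series1_sym : sym_superfun series1.
Proof.
split=> [|s fs]; first exact: bihomog_bounded series1_bihomog.
have [bs _] := fs; apply/funext => N; rewrite /series1 perm_series_lead // perm_theta_inv0 mul1r.
have [t st ts] := bs; rewrite /smonom_series; congr ((_ == _)%:R).
rewrite [LHS]surjective_pairing; congr (_, _).
  by apply/fsetP => k; rewrite (mem_perm_smonom _ _ st ts) /= !inE.
by apply: cmonomP => k; rewrite (perm_smonom2 _ _ st ts) /= !cm1.
Qed.

Lemma sp_power_sum_sym L : sym_superfun (sp_power_sum L).
Proof.
apply: sym_mul.
  elim/big_rec: _ => [|n f _ sf]; first exact: series1_sym.
  by apply: sym_mul => //; apply: fermionic_power_sum_sym.
rewrite big_seq; elim/big_rec: _ => [|n f ns sf]; first exact: series1_sym.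
apply: sym_mul => //; apply: power_sum_sym; rewrite lt0n.
by apply: contraNneq (sp_s_pos L) => <-.
Qed.

Lemma sp_power_sum_bihomog L :
  bihomog (sp_fermionic_degree L) (sp_degree L) (sp_power_sum L).
Proof.
rewrite /sp_degree /sp_fermionic_degree /sp_seq sumn_cat -[size _]addn0; apply: bihomog_mul.
  elim: (sp_a L) => [|n s IH]; rewrite ?big_nil ?big_cons; first exact: series1_bihomog.
  exact: (bihomog_mul (@fermionic_power_sum_bihomog n) IH).
elim: (sp_s L) => [|n s IH]; rewrite ?big_nil ?big_cons; first exact: series1_bihomog.
exact: (bihomog_mul (@power_sum_bihomog n) IH).
Qed.

End SymmetricProducts.

(** * Alternants and their pairing *)

Section Alternant.
Variables (K : fieldType) (N : nat).
Implicit Types (i j : 'I_N) (I J : {set 'I_N}) (v w : 'X_{1..N}) (s t : seq nat) (p q : {mpoly K[N]}).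

(* The coefficient of [theta_I] in the product of the fermionic power sums [s]. *)
Fixpoint alt s I : {mpoly K[N]} :=
  if s is a :: s' then
    \sum_(i in I) (-1) ^+ theta_inv (fsetN [set i]%SET) (fsetN (I :\ i)) *:
      ('X_i ^+ a * alt s' (I :\ i))
  else (I == finset.set0)%:R.

Lemma mcoeffXM i a p v :
  ('X_i ^+ a * p)@_v = if (a <= v i)%N then p@_(upd1 v i (v i - a)) else 0.
Proof.
pose L : {mpoly K[N]} -> K^o := fun p => ('X_i ^+ a * p)@_v.
pose R : {mpoly K[N]} -> K^o := fun p => if (a <= v i)%N then p@_(upd1 v i (v i - a)) else 0.
have Ll : linear L by move=> c r s; rewrite /L mulrDr -scalerAr mcoeffD mcoeffZ.
have Rl : linear R.
  by move=> c r s; rewrite /R; case: ifP => _; rewrite ?scaler0 ?addr0 // mcoeffD mcoeffZ.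
pose L' := HB.pack_for {linear {mpoly K[N]} -> K^o} L (GRing.isLinear.Build _ _ _ _ L Ll).
pose R' := HB.pack_for {linear {mpoly K[N]} -> K^o} R (GRing.isLinear.Build _ _ _ _ R Rl).
apply: (@mpoly_lin_ext _ _ _ L' R') => w; rewrite /= /L /R mpolyXn -mpolyXD !mcoeffX.
have [av|va] := leqP a (v i).
  congr ((_ : bool)%:R); apply/eqP/eqP => [<-|->]; apply/mnmP => k.
    by rewrite upd1E !mnmDE !mulmnE !mnm1E eqxx [i == k]eq_sym; case: (k =P i) => [->|_]; lia.
  by rewrite mnmDE mulmnE mnm1E upd1E [i == k]eq_sym; case: (k =P i) => [->|_]; lia.
case: eqP => // e; move: va; rewrite -e mnmDE mulmnE mnm1E eqxx; lia.
Qed.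

Lemma alt_support s I v : (alt s I)@_v != 0 ->
  [/\ forall j, j \in I -> v j \in s, forall j, j \notin I -> v j = 0%N
    & mdeg v = sumn s].
Proof.
elim: s I v => [|a s IH] I v /=.
  case: (I =P finset.set0) => [->|_]; last by rewrite mcoeff0 eqxx.
  rewrite -[true%:R]/(1 : {mpoly K[N]}) mcoeff1; case: (v =P 0%MM) => [-> _|]; last by rewrite eqxx.
  by split=> [j|j _|]; rewrite ?inE ?mnm0E ?mdeg0.
move=> /mcoeff_sum_neq0 [i iI]; rewrite mcoeffZ mcoeffXM mulf_eq0 signr_eq0 /=.
case: (leqP a (v i)) => [av|_]; last by rewrite eqxx.
move=> /IH [h1 h2 h3]; have vi : v i = a.
  by have := h2 i; rewrite upd1E eqxx !inE eqxx /= => /(_ isT); lia.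
split=> [j jI|j jI|].
- rewrite inE; case: (j =P i) => [->|/eqP ji]; first by rewrite vi eqxx.
  by have := h1 j; rewrite upd1E (negbTE ji) !inE ji jI /= => -> //; rewrite orbT.
- have ji : j != i by apply: contraNneq jI => ->.
  by have := h2 j; rewrite upd1E (negbTE ji) !inE ji (negbTE jI) /= => /(_ isT).
rewrite -h3 !mdegE (bigD1 i) //= [in RHS](bigD1 i) //= upd1E eqxx vi subnn add0n.
by congr (_ + _)%N; apply: eq_bigr => j /negbTE ji; rewrite upd1E ji.
Qed.

Definition dot p q : K := \sum_(v <- msupp p) p@_v * q@_v.

Lemma dotC p q : dot p q = dot q p.
Proof.
pose F r v : K^o := r@_v; have -> : dot p q = mlin (F q) p by [].
have -> : dot q p = mlin (F p) q by [].
rewrite !(@mlin_wide _ _ _ _ (undup (msupp p ++ msupp q))) ?undup_uniq //.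
- by apply: eq_bigr => v _; rewrite /F /GRing.scale /= mulrC.
- by move=> v; rewrite mem_undup mem_cat => ->; rewrite orbT.
by move=> v; rewrite mem_undup mem_cat => ->.
Qed.

Lemma dot_sumr (T : Type) (r : seq T) (P : pred T) (F : T -> {mpoly K[N]}) p :
  dot p (\sum_(t <- r | P t) F t) = \sum_(t <- r | P t) dot p (F t).
Proof.
rewrite /dot; under eq_bigr do rewrite raddf_sum /= mulr_sumr.
by rewrite exchange_big.
Qed.

Lemma dotZr a p q : dot p (a *: q) = a * dot p q.
Proof.
by rewrite /dot mulr_sumr; apply: eq_bigr => v _; rewrite mcoeffZ mulrCA.
Qed.

Lemma dot_eq0 p q : (forall v, p@_v != 0 -> q@_v = 0) -> dot p q = 0.
Proof.
move=> h; rewrite /dot big1 // => v _.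
by have [->|/h ->] := eqVneq p@_v 0; rewrite ?mul0r ?mulr0.
Qed.

Lemma dotX p v : dot p 'X_[v] = p@_v.
Proof. by rewrite dotC /dot msuppX big_seq1 mcoeffX eqxx mul1r. Qed.

Lemma dotXM i a p q : dot ('X_i ^+ a * p) ('X_i ^+ a * q) = dot p q.
Proof.
rewrite [LHS]dotC {1}[p]mpolyE mulr_sumr dot_sumr; apply: eq_bigr => v _.
rewrite -scalerAr dotZr mpolyXn -mpolyXD dotX -mpolyXn mcoeffXM; congr (_ * _).
rewrite mnmDE mulmnE mnm1E eqxx mul1n leq_addr; congr (q@__).
apply/mnmP => k; rewrite upd1E mnmDE mulmnE mnm1E [i == k]eq_sym.
by case: (k =P i) => [->|_]; rewrite ?mul1n ?mul0n //; lia.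
Qed.

(** Both alternants are expanded along their largest part. A monomial of such a term has its unique
    maximum on [I] at the chosen index, so only terms with the same index and the same largest part
    pair nontrivially. The signs square to 1 and all indices of [I] contribute equally, whence the
    factorial. *)
Lemma dot_alt s t I : sorted gtn s -> sorted gtn t -> size s = #|I| -> size t = #|I| ->
  dot (alt s I) (alt t I) = (s == t)%:R * ((#|I|)`!)%:R.
Proof.
have gtn_trans : transitive gtn by move=> x y z /= h1 h2; apply: ltn_trans h2 h1.
elim: s t I => [|a s IH] [|c t] I.
- move=> _ _ /esym/eqP; rewrite cards_eq0 => /eqP -> _.
  have e : (true%:R : {mpoly K[N]}) = 'X_[0%MM] by rewrite mpolyX0.
  by rewrite /= eqxx cards0 fact0 mulr1 e dotX mcoeffX eqxx.
- by move=> _ _ /= <-.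
- by move=> _ _ /= h1 h2; rewrite -h2 in h1.
move=> ss st szs szt.
have smalls : {in s, forall x, (x < a)%N} by apply/allP; apply: order_path_min ss.
have smallt : {in t, forall x, (x < c)%N} by apply/allP; apply: order_path_min st.
have card i : i \in I -> #|I :\ i| = #|I|.-1 by move=> iI; rewrite (cardsD1 i I) iI.
have suppi b r i v : i \in I -> {in r, forall x, (x < b)%N} ->
    ('X_i ^+ b * alt r (I :\ i))@_v != 0 -> forall j, j \in I -> (v j <= b)%N /\ (v j = b -> j = i).
  move=> iI sm; rewrite mcoeffXM; case: (leqP b (v i)) => [bv|_]; last by rewrite eqxx.
  move=> /alt_support [h1 h2 _] j jI; case: (j =P i) => [->|/eqP ji].
    by have := h2 i; rewrite upd1E eqxx !inE eqxx /= => /(_ isT) h; split=> //; lia.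
  have := h1 j; rewrite upd1E (negbTE ji) !inE ji jI /= => /(_ isT)/sm lt.
  by split=> [|e]; [lia|exfalso; lia].
have dot0 i j : i \in I -> j \in I -> (a != c) || (i != j) ->
    dot ('X_i ^+ a * alt s (I :\ i)) ('X_j ^+ c * alt t (I :\ j)) = 0.
  move=> iI jI ne; apply: dot_eq0 => v nz1; apply/eqP/negPn/negP => nz2.
  have h1 := suppi _ _ _ _ iI smalls nz1; have h2 := suppi _ _ _ _ jI smallt nz2.
  have vi : v i = a.
    move: nz1; rewrite mcoeffXM; case: (leqP a (v i)) => [av _|_]; last by rewrite eqxx.
    by have := (h1 i iI).1; lia.
  have vj : v j = c.
    move: nz2; rewrite mcoeffXM; case: (leqP c (v j)) => [av _|_]; last by rewrite eqxx.
    by have := (h2 j jI).1; lia.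
  have ac : a = c by have := (h1 j jI).1; have := (h2 i iI).1; lia.
  by move: ne; rewrite ac eqxx /= -((h1 j jI).2 _) ?eqxx // vj.
rewrite /= dot_sumr (eq_bigr (fun j => (a == c)%:R * ((s == t)%:R * ((#|I|.-1)`!)%:R))) => [|j jI].
  rewrite sumr_const -szs /= eqseq_cons factS natrM -mulr_natl -mulnb natrM; ring.
rewrite dotZr dotC dot_sumr (bigD1 j) //= [X in _ + X]big1 ?addr0 => [|i /andP [iI ij]]; last first.
  by rewrite dotZr dotC dot0 ?mulr0 // ij orbT.
rewrite dotZr dotC mulrA -expr2 sqrr_sign mul1r.
have [ac|nac] := eqVneq a c; last by rewrite dot0 ?nac // mul0r.
rewrite ac dotXM mul1r IH ?card //; first exact: path_sorted ss.
- exact: path_sorted st.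
- by rewrite -szs.
by rewrite -szt.
Qed.

Section Lift.
Variables (b : K).
Local Notation FF := {malg K[fidx N]}.

Definition monom_lift s : {mpoly K[N]} -> FF :=
  mlin (fun v => monalg.mkmalgU ((v, s) : fidx N) 1 : FF).

HB.instance Definition _ s := GRing.Linear.on (monom_lift s).

Lemma mcoeff_monom_lift s p v t : (monom_lift s p)@[((v, t) : fidx N)] = (s == t)%:R * p@_v.
Proof.
rewrite /monom_lift /mlin raddf_sum /=; have [->|st] := eqVneq s t; last first.
  rewrite mul0r big1 // => w _; rewrite monalg.mcoeffZ mcoeffU.
  by case: eqP => [[_ e]|_]; rewrite ?mulr0 //; move: st; rewrite e eqxx.
rewrite mul1r [in RHS](mpolyE p) raddf_sum /=; apply: eq_bigr => w _.
by rewrite monalg.mcoeffZ mcoeffU mcoeffZ mcoeffX xpair_eqE eqxx andbT.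
Qed.

Lemma phi_monom_lift s p : phi (monom_lift s p) = p * psums K N s.
Proof.
rewrite /monom_lift /mlin [in RHS](mpolyE p) (linear_sum (@phi K N)) mulr_suml /=; apply: eq_bigr => v _.
by rewrite linearZ /= /phi flinU -scalerAl.
Qed.

Lemma supported_monom_lift (P : fidx N -> Prop) s p :
  (forall v, p@_v != 0 -> P (v, s)) -> supported P (monom_lift s p).
Proof.
move=> h [v t]; rewrite mcoeff_monom_lift; case: (s =P t) => [<-|_]; last by rewrite mul0r eqxx.
by rewrite mul1r; apply: h.
Qed.

Lemma wform_monom_lift s t p q : wform (wt b) (monom_lift s p) (monom_lift t q)
  = (s == t)%:R * (b ^- size s * (zee s)%:R) * dot p q.
Proof.
rewrite {1}/monom_lift {1}/mlin wform_sum /dot mulr_sumr; apply: eq_bigr => v _.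
rewrite wformZ {1}/wform msuppU oner_eq0 big_seq_fset1 mcoeffUU mul1r mcoeff_monom_lift /wt /=.
rewrite [t == s]eq_sym; move: (s == t) => c; ring.
Qed.

End Lift.
End Alternant.

(** * Coefficients of the power sums *)

Section PowerSumCoefficients.
Variable N : nat.
Implicit Types (i j : 'I_N) (I J : {set 'I_N}) (v w : 'X_{1..N}) (s t : seq nat).
Implicit Types (f g : superseries) (P Q : {set 'I_N} -> {mpoly Qbeta[N]}) (L : superpart).

Lemma eq_represents f P Q : P =1 Q -> represents f P -> represents f Q.
Proof. by move=> e r I v; rewrite r e. Qed.

Lemma fsetN0 : fsetN (@finset.set0 'I_N) = fset0.
Proof. by apply/fsetP => k; apply/imfsetP; rewrite inE => -[j /=]; rewrite inE. Qed.

Lemma fsetN1 i : fsetN [set i]%SET = [fset val i]%fset.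
Proof.
apply/fsetP => k; rewrite inE; apply/imfsetP/eqP => /= [[j + ->]|->]; first by rewrite inE => /eqP ->.
by exists i; rewrite ?inE.
Qed.

Lemma cmNX i n : cmN (U_(i) *+ n)%MM = expcmn (ucm (val i)) n.
Proof.
apply: cmonomP => k; rewrite expcmnE; have [lt|le] := ltnP k N.
  by rewrite (cmN_ord _ (Ordinal lt)) mulmnE mnm1E -val_eqE.
by rewrite cmN_out //; case: eqP => // e; move: le; rewrite -e leqNgt ltn_ord.
Qed.

Lemma cmN0 : cmN (0%MM : 'X_{1..N}) = mone.
Proof.
apply: cmonomP => k; rewrite cm1; have [lt|le] := ltnP k N; last by rewrite cmN_out.
by rewrite (cmN_ord _ (Ordinal lt)) mnm0E.
Qed.

Lemma represents_series1 : represents series1 (@alt Qbeta N [::]).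
Proof.
move=> I v; rewrite /series1 /smonom_series xpair_eqE -fsetN0 -cmN0 (inj_eq (@fsetN_inj N)).
rewrite (inj_eq (@cmN_inj N)) /=; case: (I == _); last by rewrite mcoeff0.
have -> : (true%:R : {mpoly Qbeta[N]}) = 'X_[0%MM] by rewrite mpolyX0.
by rewrite mcoeffX eq_sym.
Qed.

Lemma theta_inv0r (A : {fset nat}) : theta_inv A fset0 = 0%N.
Proof. by rewrite /theta_inv big1 // => i _; rewrite big_seq_fset0. Qed.

Lemma ext_mul_set0 P (q : {mpoly Qbeta[N]}) I :
  ext_mul P (fun J => (J == finset.set0)%:R *: q) I = P I * q.
Proof.
rewrite /ext_mul (bigD1 I) //= big1 ?addr0 => [|J /andP [JI nJ]].
  by rewrite finset.setDv eqxx scale1r fsetN0 theta_inv0r expr0 scale1r.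
have -> : (I :\: J == finset.set0) = false.
  apply/negbTE; apply: contra nJ; rewrite finset.setD_eq0 => IJ.
  by rewrite finset.eqEsubset JI.
by rewrite scale0r mulr0 scaler0.
Qed.

Lemma ext_mul_set1 n Q I :
  ext_mul (fun J => \sum_(i | J == [set i]%SET) 'X_i ^+ n) Q I =
  \sum_(i in I) (-1) ^+ theta_inv (fsetN [set i]%SET) (fsetN (I :\ i)) *: ('X_i ^+ n * Q (I :\ i)).
Proof.
rewrite /ext_mul; under eq_bigr do rewrite mulr_suml scaler_sumr.
rewrite (exchange_big_dep (mem I)) /=; last first.
  by move=> J i JI /eqP eJ; move: JI; rewrite eJ finset.sub1set.
apply: eq_bigr => i iI; rewrite (big_pred1 [set i]%SET) // => J /=.
by case: (J =P _) => [->|_]; rewrite ?andbF ?andbT // finset.sub1set.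
Qed.

Lemma represents_fermionic n :
  represents (fermionic_power_sum n) (fun I => \sum_(i | I == [set i]%SET) 'X_i ^+ n).
Proof.
move=> I v; rewrite raddf_sum /=.
under eq_bigr do rewrite mpolyXn mcoeffX.
have valE i : I = [set i]%SET -> v = (U_(i) *+ n)%MM -> fermionic_power_sum n (fsetN I, cmN v) = 1.
  move=> -> ->; rewrite fsetN1 cmNX; exact: (@osum_in (fpow n) (@fpow_inj n)).
have [z|/(@osum_neq0 (fpow n)) [k e]] := eqVneq (fermionic_power_sum n (fsetN I, cmN v)) 0.
  rewrite z big1 // => i /eqP eI; case: eqP => // ev.
  by have := valE i eI (esym ev); rewrite z => /esym/eqP; rewrite oner_eq0.
case: e => e1 e2; have kN : (k < N)%N by apply: (@fsetN_lt N I); rewrite e1 inE.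
have eI : I = [set Ordinal kN]%SET by apply: (@fsetN_inj N); rewrite fsetN1.
have ev : v = (U_(Ordinal kN) *+ n)%MM by apply: (@cmN_inj N); rewrite cmNX.
rewrite (valE _ eI ev) (big_pred1 (Ordinal kN)) => [|i]; first by rewrite ev eqxx.
by rewrite eI /= (inj_eq (@finset.set1_inj _)) eq_sym.
Qed.

Lemma represents_bosonic n : (0 < n)%N ->
  represents (power_sum n) (fun I => (I == finset.set0)%:R *: psum Qbeta N n).
Proof.
move=> n0 I v; rewrite mcoeffZ /psum raddf_sum /=.
under eq_bigr do rewrite mpolyXn mcoeffX.
have valE i : I = finset.set0 -> v = (U_(i) *+ n)%MM -> power_sum n (fsetN I, cmN v) = 1.
  move=> -> ->; rewrite fsetN0 cmNX; exact: (@osum_in (bpow n) (bpow_inj n0)).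
have [z|/(@osum_neq0 (bpow n)) [k e]] := eqVneq (power_sum n (fsetN I, cmN v)) 0.
  rewrite z; case: (I =P finset.set0) => [eI|_]; last by rewrite mul0r.
  rewrite big1 ?mulr0 // => i _; case: eqP => // ev.
  by have := valE i eI (esym ev); rewrite z => /esym/eqP; rewrite oner_eq0.
case: e => e1 e2.
have kN : (k < N)%N.
  rewrite ltnNge; apply/negP => Nk; have : cmN v k = 0%N by rewrite cmN_out.
  by rewrite e2 expcmnE eqxx mul1n; lia.
have eI : I = finset.set0 by apply: (@fsetN_inj N); rewrite fsetN0.
have ev : v = (U_(Ordinal kN) *+ n)%MM by apply: (@cmN_inj N); rewrite cmNX.
rewrite (valE _ eI ev) eI eqxx mul1r (bigD1 (Ordinal kN)) //= {1}ev eqxx big1 ?addr0 // => i ni.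
case: eqP => // /(congr1 (fun w : 'X_{1..N} => w i)).
by rewrite ev !mulmnE !mnm1E eqxx eq_sym (negbTE ni); lia.
Qed.

Lemma represents_fermionic_prod s :
  represents (\big[series_mul/series1]_(n <- s) fermionic_power_sum n) (@alt Qbeta N s).
Proof.
elim: s => [|n s IH]; first by rewrite big_nil; apply: represents_series1.
rewrite big_cons; apply: eq_represents (represents_mul (represents_fermionic n) IH) => I.
by rewrite ext_mul_set1.
Qed.

Lemma represents_bosonic_prod s : 0%N \notin s ->
  represents (\big[series_mul/series1]_(n <- s) power_sum n)
    (fun I => (I == finset.set0)%:R *: psums Qbeta N s).
Proof.
elim: s => [|n s IH]; rewrite ?inE ?negb_or.
  move=> _; rewrite big_nil; apply: eq_represents represents_series1 => I.
  by rewrite /psums big_nil /= scaler_nat.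
rewrite eq_sym -lt0n => /andP [n0 s0]; rewrite big_cons.
apply: eq_represents (represents_mul (represents_bosonic n0) (IH s0)) => I.
by rewrite ext_mul_set0 psums_cons scalerAl.
Qed.

(** The bosonic factor has no theta, so the exterior product reduces to a product of an alternant
    with power sums. *)
Lemma represents_sp_power_sum L :
  represents (sp_power_sum L) (fun I => alt Qbeta (sp_a L) I * psums Qbeta N (sp_s L)).
Proof.
apply: eq_represents (represents_mul (represents_fermionic_prod _) (represents_bosonic_prod (sp_s_pos L))).
by move=> I; rewrite ext_mul_set0.
Qed.

End PowerSumCoefficients.

(** * The eigenbasis *)

Section PosetTriangular.
Variables (K : fieldType) (k : nat) (le : rel 'I_k).
Hypotheses (le_refl : reflexive le) (le_trans : transitive le) (le_anti : antisymmetric le).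
Implicit Types (i j l : 'I_k) (v : 'rV[K]_k) (A C : 'M[K]_k).

Definition triangular_for A := forall i j, A i j != 0 -> le j i.

(** [j] is a maximal element of the support of [v], found as one with the largest down-set. For
    triangular [A] the coordinate [j] of the product receives nothing from the rest of the support;
    the choice of [j] depends on [v] alone. *)
Lemma max_coordinate v : v != 0 -> exists2 j, v 0 j != 0 &
  forall A, triangular_for A -> (v *m A) 0 j = v 0 j * A j j.
Proof.
move=> /rV0Pn [j0 vj0]; pose h j := #|[set l | le l j]%SET|.
case: (@arg_maxnP _ j0 (fun j => v 0 j != 0) h vj0) => j vj jmax; exists j => // A tA.
rewrite mxE (bigD1 j) //= big1 ?addr0 // => i ij.
have [->|vi] := eqVneq (v 0 i) 0; first by rewrite mul0r.
have [->|Aij] := eqVneq (A i j) 0; first by rewrite mulr0.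
have ji := tA _ _ Aij; have : (h i <= h j)%N := jmax i vi.
rewrite leqNgt => /negP [].
apply: proper_card; apply/properP; split.
  by apply/fintype.subsetP => l; rewrite !inE => lj; apply: le_trans ji.
exists i; rewrite !inE ?le_refl //; apply/negP => le_ij.
by move/eqP: ij; apply; apply: le_anti; rewrite le_ij ji.
Qed.

Lemma unitriangular_unit C : triangular_for C -> (forall i, C i i = 1) -> C \in unitmx.
Proof.
move=> tC C1; rewrite unitmxE unitfE; apply/det0P => -[v /max_coordinate [j vj h] e].
by have := h C tC; rewrite e mxE C1 mulr1 => e2; move: vj; rewrite -e2 eqxx.
Qed.

(* Replacing the rows of [A - A i i] outside the down-set of [i] by those of the
   identity makes column [i] vanish; a kernel vector is the eigenvector. *)
Lemma triangular_eigenvector A i : triangular_for A ->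
  (forall j, j != i -> A j j != A i i) ->
  exists v, [/\ v 0 i = 1, forall j, v 0 j != 0 -> le j i & v *m A = A i i *: v].
Proof.
move=> tA dA; pose M := \matrix_(l, j) (if le l i then A l j - A i i *+ (l == j) else (l == j)%:R).
have : \det M == 0.
  rewrite (expand_det_col _ i) big1 // => l _; rewrite mxE.
  have [li|nli] := boolP (le l i); last first.
    by case: (l =P i) nli => [->|_]; rewrite ?le_refl // mul0r.
  have [->|nl] := eqVneq l i; first by rewrite mulr1n subrr mul0r.
  have [->|/tA il] := eqVneq (A l i) 0; first by rewrite mulr0n subrr mul0r.
  by case/eqP: nl; apply: le_anti; rewrite li il.
case/det0P => v v0 vM.
have supp j : v 0 j != 0 -> le j i.
  move=> vj; apply/negPn/negP => nji; have /matrixP/(_ 0 j) := vM.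
  rewrite !mxE (bigD1 j) //= mxE (negbTE nji) eqxx mulr1 big1 ?addr0 => [e|l lj].
    by rewrite e eqxx in vj.
  rewrite mxE (negbTE lj) mulr0n subr0; case: ifP => li; last by rewrite mulr0.
  have [->|/tA jl] := eqVneq (A l j) 0; first by rewrite mulr0.
  by case/negP: nji; apply: le_trans jl li.
have vA : v *m A = A i i *: v.
  apply/matrixP => z j; rewrite {z}ord1; have /matrixP/(_ 0 j) := vM; rewrite !mxE => e.
  apply/eqP; rewrite -subr_eq0 -{}[X in _ == X]e; apply/eqP.
  have -> : A i i * v 0 j = \sum_l v 0 l * (A i i *+ (l == j)).
    rewrite (bigD1 j) //= eqxx mulr1n big1 ?addr0 1?mulrC // => l /negbTE ->.
    by rewrite mulr0n mulr0.
  rewrite -sumrB; apply: eq_bigr => l _; rewrite mxE -mulrBr.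
  have [->|/supp ->] := eqVneq (v 0 l) 0; first by rewrite !mul0r.
  by [].
(* At a maximal index of the support the eigenvalue is the diagonal entry there; as the other
   diagonal entries differ from [A i i], this index is [i]. *)
have vi : v 0 i != 0.
  have [j vj h] := max_coordinate v0; have := h A tA; rewrite vA mxE mulrC => e.
  have := mulfI vj e => /esym/eqP; apply: contraTneq => vi0.
  by apply: dA; apply: contraNneq vj => ->; rewrite vi0.
exists ((v 0 i)^-1 *: v); split=> [|j|]; first by rewrite mxE mulVf.
  by rewrite mxE mulf_eq0 negb_or => /andP [_ /supp].
by rewrite -scalemxAl vA !scalerA mulrC.
Qed.

End PosetTriangular.

(** The multiplicity of [x] is the digit of [B ^ x], and the bounds on the sizes prevent carries.
    The residue modulo [B] gives the number of zeros; the quotient is the same sum for the list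
    without its zeros and with the other entries lowered by one. *)
Lemma sum_digits_perm B (s t : seq nat) : (size s < B)%N -> (size t < B)%N ->
  (\sum_(x <- s) B ^ x = \sum_(x <- t) B ^ x)%N -> perm_eq s t.
Proof.
have [n] := ubnP (sumn s + size s)%N; elim: n s t => // n IH s t sn sB tB e.
pose down (r : seq nat) := [seq x.-1 | x <- r & (0 < x)%N].
have split r : (\sum_(x <- r) B ^ x = count_mem 0 r + B * \sum_(x <- down r) B ^ x)%N.
  elim: r => [|[|x] r IHr]; rewrite ?big_nil ?muln0 //= big_cons IHr /down /= ?addnA //.
  by rewrite big_cons /= expnS mulnDr; lia.
have cB r : (size r < B)%N -> (count_mem 0%N r < B)%N by apply: leq_ltn_trans; apply: count_size.
have B0 : (0 < B)%N by lia.
have [e0 e1] : count_mem 0%N s = count_mem 0%N t /\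
    (\sum_(x <- down s) B ^ x = \sum_(x <- down t) B ^ x)%N.
  move: e; rewrite (split s) (split t) ![(B * _)%N]mulnC => e; split.
    by have := congr1 (modn^~ B) e; rewrite /= ![(_ + _ * B)%N]addnC !modnMDl !modn_small ?cB.
  by have := congr1 (divn^~ B) e; rewrite /= ![(_ + _ * B)%N]addnC !divnMDl ?B0 // !divn_small ?cB // !addn0.
have szd r : (size (down r) + count_mem 0%N r = size r)%N.
  rewrite size_map size_filter addnC -(count_predC (pred1 0%N)); congr (_ + _)%N.
  by apply: eq_count => x; rewrite /= lt0n.
have sumd r : (sumn (down r) + size (down r) = sumn r)%N.
  by elim: r => [|[|x] r IHr] //=; rewrite /down /= -/(down r); lia.
have back r : perm_eq r (nseq (count_mem 0%N r) 0%N ++ map succn (down r)).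
  elim: r => [|[|x] r IHr] //=; rewrite /down /= ?perm_cons //.
  by rewrite perm_sym perm_catC /= perm_cons perm_catC perm_sym.
have [s0|s0] := posnP (size s).
  rewrite (size0nil s0) in e *; move: e; rewrite big_nil => /esym/eqP.
  by rewrite sum_nat_seq_eq0 => /allP h; case: t tB h {e0 e1} => // x t _ /(_ x (mem_head _ _)); rewrite /= expn_eq0; lia.
have pd : perm_eq (down s) (down t).
  apply: IH => //; have := szd s; have := szd t; have := sumd s; rewrite ?size_map; try lia.
apply: perm_trans (back s) _; rewrite perm_sym; apply: perm_trans (back t) _.
by rewrite -e0 perm_cat2l perm_map // perm_sym.
Qed.

Lemma rat_interpolation (h : nat -> rat) n :
  exists f : {poly rat}, forall k, (k < n)%N -> f.[k%:R] = h k.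
Proof.
elim: n => [|n [f hf]]; first by exists 0.
pose q : {poly rat} := \prod_(j < n) ('X - (nat_of_ord j)%:R%:P).
have q0 k : (k < n)%N -> q.[k%:R] = 0.
  by move=> kn; rewrite horner_prod (bigD1 (Ordinal kn)) //= hornerXsubC subrr mul0r.
have qn : q.[n%:R] != 0.
  rewrite horner_prod; apply/prodf_neq0 => j _; rewrite hornerXsubC subr_eq0 Num.Theory.eqr_nat.
  by rewrite gtn_eqF.
exists (f + ((h n - f.[n%:R]) / q.[n%:R]) *: q) => k; rewrite ltnS leq_eqVlt hornerD hornerZ.
case/orP => [/eqP ->|kn]; first by rewrite divfK // addrCA subrr addr0.
by rewrite (q0 k kn) mulr0 addr0 hf.
Qed.

(** * Bases of the superfunctions, sector by sector *)

Section SectorBases.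
Implicit Types (L O : superpart) (f g : superseries) (m n : nat).

Lemma sym_linear a f g : sym_superfun f -> sym_superfun g -> sym_superfun (a *: f + g).
Proof.
move=> [[d1 h1] sf] [[d2 h2] sg]; split.
  exists (d1 + d2)%N => M nz; have [z|/h1 le] := eqVneq (f M) 0; last exact: leq_trans le (leq_addr _ _).
  apply: leq_trans (leq_addl _ _); apply: h2; apply: contraNneq nz => z2.
  by rewrite -[(a *: f + g) M]/(a *: f M + g M) z z2 scaler0 addr0.
move=> s fs; apply/funext => N; have [[t st ts] _] := fs.
rewrite -{2}(sf s fs) -{2}(sg s fs) -[RHS]/(a *: perm_series s f N + perm_series s g N).
rewrite !(perm_seriesE _ _ st ts) -[(a *: f + g) _]/(a * f _ + g _) -[a *: _]/(a * _).
by rewrite mulrDr mulrCA.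
Qed.

Lemma sym0 : sym_superfun 0.
Proof.
split; first by exists 0%N => M; rewrite -[(0 : superseries) M]/(0 : Qbeta^o) eqxx.
by move=> s [[t st ts] _]; apply/funext => N; rewrite (perm_seriesE _ _ st ts) mulr0.
Qed.

Lemma sym_sum (T : Type) (r : seq T) (P : pred T) (c : T -> Qbeta) (B : T -> superseries) :
  (forall t, P t -> sym_superfun (B t)) -> sym_superfun (\sum_(t <- r | P t) c t *: B t).
Proof.
move=> h; elim/big_rec: _ => [|t f Pt sf]; first exact: sym0.
by apply: sym_linear => //; apply: h.
Qed.

Lemma sym_ext f g : sym_superfun f -> sym_superfun g ->
  (forall L, f (leading_smonom L) = g (leading_smonom L)) -> f = g.
Proof.
move=> sf sg e; have sfg := sym_linear (-1) sg sf.
have z := sym_superfun_eq0 sfg; apply/funext => M; apply/eqP; rewrite -subr_eq0 addrC; apply/eqP.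
rewrite -scaleN1r; apply: (z _ M) => L.
by rewrite -[LHS]/(-1 *: g (leading_smonom L) + f (leading_smonom L)) e scaleN1r addNr.
Qed.

Definition in_sec m n L := (sp_fermionic_degree L == m) && (sp_degree L == n).

Lemma sp_length_bound L : (sp_length L <= sp_fermionic_degree L + sp_degree L)%N.
Proof.
rewrite /sp_length size_cat leq_add2l /sp_degree /sp_seq sumn_cat; apply: leq_trans (leq_addl _ _).
have := sp_s_pos L; elim: (sp_s L) => //= x r IH; rewrite inE negb_or eq_sym -lt0n => /andP [x0 /IH]; lia.
Qed.

(** A superpartition of degree [(n|m)] has at most [m + n] parts, none above [n]. It is read off
    from a tuple by discarding the zeros from position [m] on. *)
Lemma sector_exists m n : exists s : seq superpart, uniq s /\ forall L, (L \in s) = in_sec m n L.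
Proof.
pose F (v : (m + n).-tuple 'I_n.+1) : option superpart :=
  insub (take m (map val v), [seq x <- drop m (map val v) | (0 < x)%N]).
pose s := undup [seq L <- pmap F (enum {: (m + n).-tuple 'I_n.+1}) | in_sec m n L].
exists s; split=> [|L]; first exact: undup_uniq.
rewrite mem_undup mem_filter; case: (boolP (in_sec m n L)) => //= /andP [/eqP fL /eqP dL].
have sz : (size (sp_s L) <= n)%N by have := sp_length_bound L; rewrite /sp_length size_cat -/(sp_fermionic_degree L) fL dL leq_add2l.
have lt x : x \in sp_seq L -> (x < n.+1)%N.
  rewrite ltnS -dL /sp_degree; elim: (sp_seq L) => //= y r IH; rewrite inE => /orP [/eqP ->|/IH]; lia.
have ltn i : (nth 0%N (sp_seq L) i < n.+1)%N.
  by have [/(mem_nth 0%N)/lt//|le] := ltnP i (size (sp_seq L)); rewrite nth_default.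
pose v := [tuple Ordinal (ltn i) | i < m + n].
have valv : map val v = sp_seq L ++ nseq (n - size (sp_s L)) 0%N.
  apply: (@eq_from_nth _ 0%N) => [|i].
    rewrite size_map size_tuple !size_cat size_nseq -/(sp_fermionic_degree L) fL; lia.
  rewrite size_map size_tuple => im; rewrite (nth_map ord0) ?size_tuple //.
  rewrite -(tnth_nth _ _ (Ordinal im)) tnth_mktuple /= nth_cat nth_nseq if_same.
  by case: ltnP => // le; rewrite nth_default.
rewrite mem_pmap; apply/mapP; exists v; first by rewrite mem_enum.
have sa : size (sp_a L) = m by [].
rewrite /F valv /sp_seq -catA take_size_cat // drop_size_cat // filter_cat.
have -> : [seq x <- nseq (n - size (sp_s L)) 0%N | (0 < x)%N] = [::].
  by elim: (n - _)%N.
have -> : [seq x <- sp_s L | (0 < x)%N] = sp_s L.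
  apply/all_filterP/allP => x xs; rewrite lt0n; apply: contraNneq (sp_s_pos L) => <- //.
by rewrite cats0 -surjective_pairing valK.
Qed.

Definition sector m n : seq superpart := xget [::] [set s | uniq s /\ forall L, (L \in s) = in_sec m n L].

Lemma sectorP m n : uniq (sector m n) /\ forall L, (L \in sector m n) = in_sec m n L.
Proof. by apply: (@xgetPex _ [::] [set s | uniq s /\ _]); apply: sector_exists. Qed.

Lemma sector_uniq m n : uniq (sector m n). Proof. by case: (sectorP m n). Qed.
Lemma mem_sector m n L : (L \in sector m n) = in_sec m n L. Proof. by case: (sectorP m n). Qed.

Definition dsec m n : nat := size (sector m n).
Definition nsec m n (i : 'I_(dsec m n)) : superpart := tnth (in_tuple (sector m n)) i.

Lemma nsec_in m n (i : 'I_(dsec m n)) : in_sec m n (nsec i).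
Proof. by rewrite -mem_sector mem_tnth. Qed.

Lemma nsec_inj m n : injective (@nsec m n).
Proof. by apply/tuple_uniqP; apply: sector_uniq. Qed.

Lemma nsec_ex m n L : in_sec m n L -> exists i, L = @nsec m n i.
Proof. by rewrite -mem_sector => /(tnthP (in_tuple _)). Qed.

Lemma sum_nsec m n (F : superpart -> Qbeta) (r : seq superpart) : uniq r ->
  (forall L, L \in r -> ~~ in_sec m n L -> F L = 0) ->
  (forall L, in_sec m n L -> L \notin r -> F L = 0) ->
  \sum_(L <- r) F L = \sum_(i < dsec m n) F (nsec i).
Proof.
move=> ur h1 h2; rewrite -(big_tnth _ _ (sector m n) xpredT F).
rewrite (bigID (in_sec m n)) /= [X in _ + X]big1_seq ?addr0; last by move=> L /andP [nL Lr]; apply: h1.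
rewrite [RHS](bigID (mem r)) /= [X in _ = _ + X]big1_seq ?addr0; last first.
  by move=> L /andP [nL]; rewrite mem_sector => Ls; apply: h2.
rewrite -big_filter -[RHS]big_filter; apply/perm_big/uniq_perm; rewrite ?filter_uniq ?sector_uniq //.
by move=> L; rewrite !mem_filter mem_sector andbC.
Qed.

Section Basis.
Variable B : superpart -> superseries.
Hypothesis Bsym : forall L, sym_superfun (B L).
Hypothesis Bsec : forall L O, B L (leading_smonom O) != 0 ->
  in_sec (sp_fermionic_degree O) (sp_degree O) L.

(** A symmetric superfunction is determined by its values at leading monomials, see [sym_ext]; these
    are its coordinates in supermonomials. *)
Definition lead_matrix m n : 'M[Qbeta]_(dsec m n) :=
  \matrix_(i, j) B (nsec i) (leading_smonom (nsec j)).

Hypothesis Bunit : forall m n, lead_matrix m n \in unitmx.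

Lemma eval_combination (c : {fsfun superpart -> Qbeta with 0}) m n (j : 'I_(dsec m n)) :
  (\sum_(L <- finsupp c) c L *: B L) (leading_smonom (nsec j))
  = ((\row_i c (nsec i)) *m lead_matrix m n) 0 j.
Proof.
rewrite fct_sumE mxE.
have [/eqP e1 /eqP e2] := andP (nsec_in j).
pose F L := c L * B L (leading_smonom (nsec j)).
rewrite -[LHS]/(\sum_(L <- finsupp c) F L) (@sum_nsec m n F).
- by apply: eq_bigr => i _; rewrite !mxE.
- exact: fset_uniq.
- move=> L _ nL; rewrite /F; have [->|/Bsec] := eqVneq (B L (leading_smonom (nsec j))) 0.
    by rewrite mulr0.
  by rewrite e1 e2 (negbTE nL).
by move=> L _ nL; rewrite /F fsfun_dflt // mul0r.
Qed.

Lemma combination_inj (c d : {fsfun superpart -> Qbeta with 0}) :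
  \sum_(L <- finsupp c) c L *: B L = \sum_(L <- finsupp d) d L *: B L -> c = d.
Proof.
move=> e; apply/fsfunP => L.
have [i ->] : exists i, L = @nsec (sp_fermionic_degree L) (sp_degree L) i.
  by apply: nsec_ex; rewrite /in_sec !eqxx.
set m := sp_fermionic_degree L in i *; set n := sp_degree L in i *.
have : (\row_i c (nsec i)) *m lead_matrix m n = (\row_i d (nsec i)) *m lead_matrix m n.
  by apply/matrixP => z j; rewrite {z}ord1 -!eval_combination e.
move=> /(congr1 (mulmx^~ (invmx (lead_matrix m n)))); rewrite /= !mulmxK //.
by move=> /matrixP/(_ 0 i); rewrite !mxE.
Qed.

Lemma unit_basis : is_basis sym_superfun B.
Proof.
split=> // f sf; have [[d fd] _] := sf.
pose cf m n := (\row_j f (leading_smonom (nsec j))) *m invmx (lead_matrix m n).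
(* At most one index satisfies the condition; the sum recovers the position of [L] in its sector. *)
pose c1 m n L : Qbeta := \sum_(i < dsec m n | nsec i == L) cf m n 0 i.
pose c0 L := c1 (sp_fermionic_degree L) (sp_degree L) L.
have c0E m n (i : 'I_(dsec m n)) : c0 (nsec i) = cf m n 0 i.
  have [/eqP e1 /eqP e2] := andP (nsec_in i).
  by rewrite /c0 e1 e2 /c1 (big_pred1 i) // => j; rewrite (inj_eq (@nsec_inj m n)).
pose D := [fset L in flatten [seq sector m n | m <- iota 0 d.+1, n <- iota 0 d.+1]]%fset.
pose c : {fsfun superpart -> Qbeta with 0} := [fsfun L in D => c0 L | 0].
have cE L : c L = c0 L.
  rewrite /c fsfunE; case: ifP => // /negbT nD; apply/esym.
  rewrite /c0 /c1 big1 // => i _; rewrite /cf mxE big1 // => j _.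
  set m := sp_fermionic_degree L in i j *; set n := sp_degree L in i j *.
  have [/eqP e1 /eqP e2] := andP (nsec_in j).
  rewrite mxE; have [->|/fd] := eqVneq (f (leading_smonom (nsec j))) 0; first by rewrite mul0r.
  rewrite /smonom_degree lead_card lead_degree e1 e2 => le.
  case/negP: nD; rewrite in_fset; apply: (introT flattenP).
  exists (sector m n); last by rewrite mem_sector /in_sec !eqxx.
  apply/allpairsP; exists (m, n); split=> //; rewrite mem_iota add0n leq0n ltnS /=; lia.
have fc : f = \sum_(L <- finsupp c) c L *: B L.
  apply: sym_ext => // [|L]; first by apply: sym_sum.
  have [j ->] : exists i, L = @nsec (sp_fermionic_degree L) (sp_degree L) i.
    by apply: nsec_ex; rewrite /in_sec !eqxx.
  rewrite eval_combination.
  have -> : \row_i c (nsec i) = cf (sp_fermionic_degree L) (sp_degree L).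
    by apply/matrixP => z i; rewrite {z}ord1 mxE cE c0E.
  by rewrite mulmxKV // mxE.
exists c; split=> // c' e; apply: combination_inj; by rewrite -fc.
Qed.

End Basis.
End SectorBases.

(** * The polynomials of a sector *)

Section SectorPolynomials.
Variables (m n : nat).
(** The parts of a superpartition of degree [(n|m)] fit into [m + n] variables; the additional one
    provides a variable of index [m] also for [n = 0]. *)
Local Notation N := (m + n).+1.
Implicit Types (L O : superpart) (F : superseries) (v w : 'X_{1..N}) (i j : 'I_N).

Definition fermi_set : {set 'I_N} := [set i : 'I_N | (i < m)%N]%SET.
Definition sec_monom v : smonom := (fsetN fermi_set, cmN v).
Definition lead_exp L : 'X_{1..N} := [multinom nth 0%N (sp_seq L) i | i < N].

Lemma mem_fermi k : (k \in fsetN fermi_set) = (k < m)%N.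
Proof.
apply/imfsetP/idP => /= [[i + ->]|km]; first by rewrite inE.
have kN : (k < N)%N by lia.
by exists (Ordinal kN); rewrite ?inE.
Qed.

Lemma lead_sec_monom L : in_sec m n L -> leading_smonom L = sec_monom (lead_exp L).
Proof.
move=> /andP [/eqP fL /eqP dL]; rewrite [LHS]surjective_pairing; congr (_, _).
  by apply/fsetP => k; rewrite lead1 mem_fermi fL.
apply: cmonomP => k; rewrite lead2; have [lt|le] := ltnP k N; first by rewrite (cmN_ord _ (Ordinal lt)) mnmE.
rewrite cmN_out // nth_default //; apply: leq_trans (sp_length_bound L) _.
by rewrite fL dL; lia.
Qed.

Lemma sum_cmN v (G : nat -> nat) : G 0%N = 0%N ->
  (\sum_(k <- finsupp (cmN v)) G (cmN v k) = \sum_(i < N) G (v i))%N.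
Proof.
move=> G0; rewrite (@sum_finsupp _ (fun _ => G) (index_iota 0 N)) ?iota_uniq //.
  by rewrite big_mkord; apply: eq_bigr => i _; rewrite cmN_ord.
move=> k; rewrite -cmE_neq0 mem_index_iota /=; apply: contraR; rewrite -leqNgt => le.
by rewrite cmN_out.
Qed.

Lemma sec_monom_excess c v : smonom_excess c (sec_monom v) = excess c v.
Proof. exact: (sum_cmN v (G := fun x => (x - c)%N)). Qed.

Lemma sec_monom_degree v : monalg.mdeg (sec_monom v).2 = mdeg v.
Proof. by rewrite monalg.mdegE (sum_cmN v (G := id)) // mdegE. Qed.

Lemma fermi_perm : perm_eq (fsetN fermi_set) (iota 0 m).
Proof.
apply: uniq_perm; rewrite ?fset_uniq ?iota_uniq // => k.
by rewrite mem_fermi mem_iota.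
Qed.

Lemma sec_monom_fermi c v : smonom_fermi c (sec_monom v) = fermi_count m c v.
Proof.
rewrite /smonom_fermi (perm_big _ fermi_perm) /= -[m in iota 0 m]subn0 -/(index_iota 0 m).
have mN : (m <= N)%N by lia.
rewrite big_mkord (big_ord_widen _ (fun k => (c <= cmN v k)%N : nat) mN) /fermi_count.
by apply: eq_bigr => i _; rewrite cmN_ord.
Qed.

Lemma sec_monom_card v : #|` (sec_monom v).1| = m.
Proof. by have /perm_size := fermi_perm; rewrite size_iota. Qed.

(* The coefficient of [theta_1 ... theta_m], in degree at most [n]. *)
Definition rho F : {mpoly Qbeta[N]} :=
  \sum_(v : 'X_{1..N < n.+1}) F (sec_monom v) *: 'X_[v].

Lemma rho_sum (T : Type) (r : seq T) (c : T -> Qbeta) (B : T -> superseries) :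
  rho (\sum_(t <- r) c t *: B t) = \sum_(t <- r) c t *: rho (B t).
Proof.
rewrite /rho; under [RHS]eq_bigr do rewrite scaler_sumr.
rewrite [RHS]exchange_big /=; apply: eq_bigr => v _; rewrite fct_sumE scaler_suml.
by apply: eq_bigr => t _; rewrite scalerA.
Qed.

Lemma rhoP F v : bihomog m n F -> (rho F)@_v = F (sec_monom v).
Proof.
move=> hF; have [lt|le] := ltnP (mdeg v) n.+1.
  by rewrite /rho (mcoeff_mpoly (fun v => F (sec_monom v))).
rewrite /rho raddf_sum /= big1 => [|w _]; last first.
  rewrite mcoeffZ mcoeffX; case: eqP => [e|_]; last by rewrite mulr0.
  by have := bmdeg w; rewrite e ltnNge le.
apply/esym; have [//|/hF [_]] := eqVneq (F (sec_monom v)) 0.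
by rewrite sec_monom_degree; lia.
Qed.

Lemma rho_in_sector F : sym_superfun F -> bihomog m n F -> in_sector m (rho F).
Proof.
move=> sF hF i j ij.
have nij : i != j by apply/eqP => e; move: ij; rewrite e; lia.
have act v : (j < m)%N || (m <= i)%N ->
    sec_monom (upd2 v i j (v j) (v i)) = perm_smonom (adj i) (sec_monom v).
  move=> c; rewrite [RHS]surjective_pairing; congr (_, _).
    apply/fsetP => k; rewrite (mem_perm_smonom _ _ (@adjK i) (@adjK i)) !mem_fermi /adj.
    by case: (k =P i :> nat) => [->|_]; [|case: (k =P i.+1) => [->|_]]; lia.
  apply: cmonomP => k; rewrite (perm_smonom2 _ _ (@adjK i) (@adjK i)) /adj /=.
  case: (k =P i :> nat) => [->|ki]; first by rewrite -ij !cmN_ord upd2E eqxx.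
  case: (k =P i.+1) => [->|ki1]; first by rewrite -ij !cmN_ord upd2E eq_sym (negbTE nij) eqxx.
  have [lt|le] := ltnP k N; last by rewrite !cmN_out.
  rewrite !(cmN_ord _ (Ordinal lt)) upd2E -!val_eqE /=.
  by move/eqP: ki => /negbTE ->; rewrite ij; move/eqP: ki1 => /negbTE ->.
have co v : (j < m)%N || (m <= i)%N -> (msym (tperm i j) (rho F))@_v =
    (-1) ^+ ((i < m)%N && (i.+1 < m)%N) * (rho F)@_v.
  move=> c; rewrite mcoeff_sym tperm_upd2 //  (rhoP _ hF) (rhoP _ hF) act //.
  by rewrite (sym_perm_smonom _ sF (adj_finitary i)) perm_theta_inv_adj !mem_fermi.
split=> c; apply/mpolyP => v; rewrite co ?c ?orbT // ?mcoeffN.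
  have im : (i < m)%N by lia.
  by rewrite im -ij c expr1 mulN1r.
by rewrite [(i < m)%N]ltnNge c /= expr0 mul1r.
Qed.

Lemma sector_lead_exp v : sector_lead m v -> mdeg v = n ->
  exists2 L, in_sec m n L & v = lead_exp L.
Proof.
move=> sl dv; have [i|i|L e] := @lead_exists (sec_monom v).
- rewrite !mem_fermi => im; split; first by lia.
  have iN : (i < N)%N by lia. have i1N : (i.+1 < N)%N by lia.
  rewrite (cmN_ord v (Ordinal iN)) (cmN_ord v (Ordinal i1N)).
  by apply: (sl (Ordinal iN) (Ordinal i1N) erefl).1.
- rewrite mem_fermi -leqNgt => mi; have [i1N|le] := ltnP i.+1 N; last by rewrite (cmN_out v le).
  have iN : (i < N)%N by lia.
  rewrite (cmN_ord v (Ordinal iN)) (cmN_ord v (Ordinal i1N)).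
  by apply: (sl (Ordinal iN) (Ordinal i1N) erefl).2.
have iL : in_sec m n L.
  by rewrite /in_sec -lead_card -lead_degree -e sec_monom_card sec_monom_degree dv !eqxx.
exists L => //; apply: (@cmN_inj N); have := lead_sec_monom iL; rewrite -e.
by case.
Qed.

Lemma lead_exp_excess c L : in_sec m n L -> excess c (lead_exp L) = sp_excess c L.
Proof. by move=> iL; rewrite -sec_monom_excess -lead_sec_monom // lead_excess. Qed.

Lemma lead_exp_fermi c L : in_sec m n L -> fermi_count m c (lead_exp L) = sp_fermi_count c L.
Proof. by move=> iL; rewrite -sec_monom_fermi -lead_sec_monom // lead_fermi. Qed.

Lemma supermonomial_bihomog L : in_sec m n L -> bihomog m n (supermonomial L).
Proof.
by move=> /andP [/eqP fL /eqP dL] M /supermonomial_invariants [-> -> _ _].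
Qed.

Lemma mcoeff_rho_sum (c : 'I_(dsec m n) -> Qbeta) v :
  (\sum_j c j *: rho (supermonomial (nsec j)))@_v
    = \sum_j c j * supermonomial (nsec j) (sec_monom v).
Proof.
rewrite raddf_sum; apply: eq_bigr => j _.
by rewrite -(rhoP _ (supermonomial_bihomog (nsec_in j))); apply: mcoeffZ.
Qed.

(** The relation [lower] read on superpartitions; within a sector it implies [sp_le] by
    [sp_le_intro]. *)
Definition below O L : Prop := (forall c, sp_excess c O <= sp_excess c L)%N /\
  ((forall c, sp_excess c O = sp_excess c L) ->
   forall c, sp_fermi_count c O <= sp_fermi_count c L)%N.

Section Hamiltonian.
Variables (b : Qbeta) (f g : {poly Qbeta}).
Local Notation H := (hamiltonian m b f g).

Definition ham_matrix : 'M[Qbeta]_(dsec m n) :=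
  \matrix_(i, j) (H (rho (supermonomial (nsec i))))@_(lead_exp (nsec j)).

Lemma ham_rho_support L w : in_sec m n L -> (H (rho (supermonomial L)))@_w != 0 ->
  exists2 v, supermonomial L (sec_monom v) != 0 & lower m w v.
Proof.
move=> iL; have hL := supermonomial_bihomog iL.
rewrite [rho _]mpolyE linear_sum => /mcoeff_sum_neq0 [v _].
rewrite linearZ mcoeffZ rhoP //.
have [z|nz] := eqVneq (supermonomial L (sec_monom v)) 0; first by rewrite z mul0r eqxx.
have [z|nz2 _] := eqVneq (H 'X_[v])@_w 0; first by rewrite z mulr0 eqxx.
by exists v; [exact: nz|exact: (trig_hamiltonian nz2)].
Qed.

(** Both sides satisfy [in_sector], so it suffices to compare coefficients at sorted exponents. In
    degree [n] these belong to superpartitions, and in other degrees both sides vanish. *)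
Lemma ham_rho (i : 'I_(dsec m n)) :
  H (rho (supermonomial (nsec i))) = \sum_j ham_matrix i j *: rho (supermonomial (nsec j)).
Proof.
apply/eqP; rewrite -subr_eq0; apply/eqP; apply: (@in_sector0P Qbeta N m) => [||v sv].
- exact: Qbeta_char0 1.
- apply: in_sectorB.
    apply: in_sector_hamiltonian; apply: rho_in_sector; first exact: supermonomial_sym.
    exact/supermonomial_bihomog/nsec_in.
  apply: in_sector_sum => j _; apply: in_sectorZ; apply: rho_in_sector; first exact: supermonomial_sym.
  exact/supermonomial_bihomog/nsec_in.
rewrite mcoeffB mcoeff_rho_sum; apply/eqP; rewrite subr_eq0; apply/eqP.
have [dv|dv] := eqVneq (mdeg v) n.
  have [L iL ->] := sector_lead_exp sv dv; have [l ->] := nsec_ex iL.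
  rewrite (bigD1 l) //= big1 => [|j jl]; last first.
    rewrite -lead_sec_monom ?nsec_in // supermonomial_lead (inj_eq (@nsec_inj m n)).
    by rewrite (negbTE jl) mulr0.
  by rewrite -lead_sec_monom ?nsec_in // supermonomial_lead eqxx mulr1 addr0 mxE.
rewrite big1 => [|j _]; last first.
  have [->|/(supermonomial_bihomog (nsec_in j)) [_]] := eqVneq (supermonomial (nsec j) (sec_monom v)) 0.
    by rewrite mulr0.
  by rewrite sec_monom_degree => e; rewrite e eqxx in dv.
apply/eqP/negPn/negP => /(ham_rho_support (nsec_in i)) [w /(supermonomial_bihomog (nsec_in i)) [_]].
by rewrite sec_monom_degree => e [e2]; rewrite e2 e eqxx in dv.
Qed.

(** Every monomial of a supermonomial has the excesses and fermionic counts of its superpartition,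
    so [lower] on exponents passes to [below]. *)
Lemma ham_matrix_below (i j : 'I_(dsec m n)) : ham_matrix i j != 0 -> below (nsec j) (nsec i).
Proof.
rewrite mxE => /(ham_rho_support (nsec_in i)) [v /supermonomial_invariants [_ _ ex fe] [_ lex lfe]].
have ev c : excess c v = sp_excess c (nsec i) by rewrite -ex sec_monom_excess.
have fv c : fermi_count m c v = sp_fermi_count c (nsec i) by rewrite -fe sec_monom_fermi.
have el c := lead_exp_excess c (nsec_in j); have fl c := lead_exp_fermi c (nsec_in j).
split=> [c|h c]; first by have := lex c; rewrite ev el.
by have := lfe _ c; rewrite fv fl; apply=> x; rewrite ev el.
Qed.

End Hamiltonian.
End SectorPolynomials.

(** * Separation of the eigenvalues *)

Section Eigenvalues.
Variables (m n : nat).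
Local Notation N := (m + n).+1.
Implicit Types (L O : superpart).

Definition const_frac : rat -> Qbeta := @tofrac {poly rat} \o polyC.
HB.instance Definition _ := GRing.RMorphism.on const_frac.

Definition integral_frac (x : Qbeta) := exists q : {poly rat}, x = tofrac q.

(** At [beta = 0] a fermionic part [k] then contributes [N^k] to the eigenvalue, and a bosonic part
    [k] contributes [k g(k - 1) = N^(n + k)]. A sector has at most [m + n < N] parts, none above
    [n], so the digits in base [N] do not overflow and the two kinds use different digits. *)
Lemma digit_polys : exists f g : {poly Qbeta},
  [/\ forall r, integral_frac f`_r, forall r, integral_frac g`_r,
    forall k, (k <= n)%N -> f.[k%:R] = (N ^ k)%:R
    & forall k, (k <= n)%N -> k.+1%:R * g.[k%:R] = (N ^ (n + k.+1))%:R].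
Proof.
have [f0 hf] := rat_interpolation (fun k => (N ^ k)%:R) n.+1.
have [g0 hg] := rat_interpolation (fun k => (N ^ (n + k.+1))%:R / k.+1%:R) n.+1.
have ev (h : {poly rat}) k : (map_poly const_frac h).[k%:R] = const_frac h.[k%:R].
  by rewrite -(rmorph_nat const_frac k) horner_map.
exists (map_poly const_frac f0), (map_poly const_frac g0); split=> [r|r|k kn|k kn].
- by rewrite coef_map; exists (f0`_r)%:P.
- by rewrite coef_map; exists (g0`_r)%:P.
- by rewrite ev hf // rmorph_nat.
by rewrite ev hg // -(rmorph_nat const_frac k.+1) -rmorphM /= mulrC divfK ?rmorph_nat // Num.Theory.pnatr_eq0.
Qed.

(* The summand [n] separates the bosonic parts from the fermionic ones. *)
Definition digits L : seq nat := sp_a L ++ [seq (n + x)%N | x <- sp_s L].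
Definition code L : nat := (\sum_(x <- digits L) N ^ x)%N.

Lemma sp_seq_le L x : in_sec m n L -> x \in sp_seq L -> (x <= n)%N.
Proof.
move=> /andP [_ /eqP <-]; rewrite /sp_degree; elim: (sp_seq L) => //= y r IH.
by rewrite inE => /orP [/eqP ->|/IH]; lia.
Qed.

Lemma code_inj L O : in_sec m n L -> in_sec m n O -> code L = code O -> L = O.
Proof.
move=> iL iO e.
have sz P : in_sec m n P -> (size (digits P) < N)%N.
  move=> /andP [/eqP f /eqP d]; have := sp_length_bound P.
  by rewrite /sp_length /digits !size_cat size_map f d ltnS.
have p := sum_digits_perm (sz L iL) (sz O iO) e.
have lo P : in_sec m n P -> [seq x <- digits P | (x <= n)%N] = sp_a P.
  move=> iP; rewrite filter_cat (_ : [seq x <- map _ _ | _] = [::]).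
    rewrite cats0; apply/all_filterP/allP => x xa; apply: (sp_seq_le iP).
    by rewrite mem_cat xa.
  apply/eqP; rewrite -size_eq0 size_filter -leqn0 leqNgt -has_count; apply/hasP => -[_ /mapP [y yP ->]].
  by case: y yP => [|y]; [move: (sp_s_pos P) => /negP|lia].
have hi P : in_sec m n P -> [seq x <- digits P | (n < x)%N] = [seq (n + x)%N | x <- sp_s P].
  move=> iP; rewrite filter_cat (_ : [seq x <- sp_a P | _] = [::]).
    apply/all_filterP/allP => _ /mapP [y yP ->].
    by case: y yP => [|y]; [move: (sp_s_pos P) => /negP|lia].
  apply/eqP; rewrite -size_eq0 size_filter -leqn0 leqNgt -has_count; apply/hasP => -[x xa].
  by rewrite ltnNge (sp_seq_le iP) // mem_cat xa.
apply: superpart_eq.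
  apply: (sorted_eq geq_trans geq_anti (sp_a_geq L) (sp_a_geq O)).
  by rewrite -(lo L iL) -(lo O iO); apply: perm_filter.
apply: (sorted_eq geq_trans geq_anti (sp_s_sorted L) (sp_s_sorted O)).
apply: (perm_map_inj (@addnI n)).
by rewrite -(hi L iL) -(hi O iO); apply: perm_filter.
Qed.

Section Diagonal.
Variables f g : {poly Qbeta}.
Hypotheses (fint : forall r, integral_frac f`_r) (gint : forall r, integral_frac g`_r).
Hypotheses (fval : forall k, (k <= n)%N -> f.[k%:R] = (N ^ k)%:R)
  (gval : forall k, (k <= n)%N -> k.+1%:R * g.[k%:R] = (N ^ (n + k.+1))%:R).

Lemma eigen_lead L : in_sec m n L -> eigen_leading m f g (lead_exp m n L) = (code L)%:R.
Proof.
move=> iL; have /andP [/eqP fL /eqP dL] := iL.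
have le i : (nth 0%N (sp_seq L) i <= n)%N.
  have [lt|ge] := ltnP i (size (sp_seq L)); last by rewrite nth_default.
  by apply: (sp_seq_le iL); apply: mem_nth.
have mN : (m <= N)%N by lia.
rewrite /code /digits big_cat natrD /= big_map; congr (_ + _).
  rewrite (big_nth 0%N) big_mkord -/(sp_fermionic_degree L) fL natr_sum.
  rewrite (big_ord_widen _ (fun i => (N ^ nth 0%N (sp_a L) i)%:R) mN).
  by apply: eq_bigr => i im; rewrite mnmE fval // /sp_seq nth_cat -/(sp_fermionic_degree L) fL im.
(* The zeros that pad the bosonic parts contribute nothing. *)
pose G x : Qbeta := if x is 0 then 0 else (N ^ (n + x))%:R.
transitivity (\sum_(i < N | (m <= i)%N) G (nth 0%N (sp_seq L) i)).
  apply: eq_bigr => i _; rewrite mnmE; have := le i; case: (nth _ _ _) => [|x] xn; first by rewrite mul0r.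
  by rewrite gval //=; lia.
rewrite -(big_geq_mkord _ _ xpredT (fun i => G (nth 0%N (sp_seq L) i))) -{1}[m]add0n big_addn.
have sl : (size (sp_s L) <= N - m)%N.
  by have := sp_length_bound L; rewrite /sp_length size_cat -/(sp_fermionic_degree L) fL dL; lia.
rewrite (big_cat_nat (n := size (sp_s L))) //= [X in _ + X]big_nat_cond [X in _ + X]big1 ?addr0.
  rewrite [in RHS](big_nth 0%N) natr_sum !big_nat; apply: eq_bigr => i /andP [_ lt].
  rewrite /sp_seq nth_cat -/(sp_fermionic_degree L) fL ifN; last by lia.
  rewrite addnK /G; case E: (nth 0%N (sp_s L) i) => [|x] //.
  by move: (sp_s_pos L); rewrite -E mem_nth.
move=> i /andP [/andP [lei _] _]; rewrite /sp_seq nth_cat -/(sp_fermionic_degree L) fL ifN; last by lia.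
by rewrite addnK nth_default.
Qed.

(** All coefficients involved are polynomials in [beta], so the Hamiltonian may be reduced modulo
    [beta], where monomials are eigenvectors. *)
Lemma ham_matrix_diag (i : 'I_(dsec m n)) :
  exists q : {poly rat}, ham_matrix m n beta f g i i = tofrac ((code (nsec i))%:R + 'X * q).
Proof.
have iS := nsec_in i; set L := nsec i in iS *.
have S1 : integral_frac 1 by exists 1; rewrite rmorph1.
have SB x y : integral_frac x -> integral_frac y -> integral_frac (x - y).
  by move=> [p ->] [q ->]; exists (p - q); rewrite rmorphB.
have SM x y : integral_frac x -> integral_frac y -> integral_frac (x * y).
  by move=> [p ->] [q ->]; exists (p * q); rewrite rmorphM.
have Sb : integral_frac beta by exists 'X.
pose F := supermonomial L; pose ev := @eigen_leading Qbeta N m f g.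
have SF M : integral_frac (F M).
  rewrite /F; have [->|[k ->]] := supermonomial_signed L M; first by exists 0; rewrite rmorph0.
  by exists ((-1) ^+ k); rewrite rmorphXn rmorphN rmorph1.
have [h Sh e] : eq_modb beta integral_frac (hamiltonian m beta f g (rho m n F))
    (\sum_(v : 'X_{1..N < n.+1}) (F (sec_monom v) * ev v) *: 'X_[v]).
  rewrite /rho linear_sum; apply: eq_modb_sum => // v _; rewrite linearZ -scalerA.
  by apply: eq_modbZ => //; apply: eq_modb_hamiltonian.
have [q hq] := Sh (lead_exp m n L); exists q.
rewrite mxE -/L -/F e mcoeffD mcoeffZ hq.
have dl : (mdeg (lead_exp m n L) < n.+1)%N.
  rewrite -sec_monom_degree -lead_sec_monom // lead_degree.
  by case/andP: iS => _ /eqP ->.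
rewrite (mcoeff_mpoly (fun v => F (sec_monom v) * ev v) dl) -lead_sec_monom //.
by rewrite /F supermonomial_lead eqxx mul1r /ev eigen_lead // rmorphD rmorphM rmorph_nat.
Qed.

Lemma ham_matrix_diag_inj (i j : 'I_(dsec m n)) :
  ham_matrix m n beta f g i i = ham_matrix m n beta f g j j -> i = j.
Proof.
have [q ->] := ham_matrix_diag i; have [r ->] := ham_matrix_diag j => /eqP.
rewrite tofrac_eq => /eqP/(congr1 (fun p => p.[0])).
rewrite !hornerD !hornerM !hornerX !mul0r !addr0 -!polyC_natr !hornerC => /eqP.
rewrite Num.Theory.eqr_nat => /eqP e; apply: (@nsec_inj m n); apply: code_inj e; exact: nsec_in.
Qed.

End Diagonal.
End Eigenvalues.

Lemma wformZr (K : fieldType) N (b a : K) (u v : {malg K[fidx N]}) :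
  wform (wt b) u (a *: v) = a * wform (wt b) u v.
Proof. by rewrite [LHS]wformC [LHS]wformZ wformC. Qed.

Lemma fhamiltonian_orthogonal (K : fieldType) N m (b : K) (f g : {poly K}) (i0 : 'I_N) d
    (u v : {malg K[fidx N]}) (x y : K) : b != 0 -> i0 = m :> nat ->
  supported (good m 0 d) u -> supported (good m 0 d) v ->
  fhamiltonian m b f g i0 u = x *: u -> fhamiltonian m b f g i0 v = y *: v ->
  x != y -> wform (wt b) u v = 0.
Proof.
move=> b0 im su sv hu hv xy; have := fhamiltonian_adjoint f g b0 im su sv.
rewrite hu hv wformZr [LHS]wformZ => e; have [//|nz] := eqVneq (wform (wt b) u v) 0.
by move/(mulIf nz)/eqP: e; rewrite (negbTE xy).
Qed.

Lemma beta_neq0 : beta != 0.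
Proof. by rewrite tofrac_eq0 polyX_eq0. Qed.

Lemma power_sum_sec L O : sp_power_sum L (leading_smonom O) != 0 ->
  in_sec (sp_fermionic_degree O) (sp_degree O) L.
Proof. by move=> /sp_power_sum_bihomog []; rewrite lead_card lead_degree /in_sec => -> ->; rewrite !eqxx. Qed.

Lemma supermonomial_sec L O : supermonomial L (leading_smonom O) != 0 ->
  in_sec (sp_fermionic_degree O) (sp_degree O) L.
Proof. by move=> /supermonomial_invariants []; rewrite lead_card lead_degree /in_sec => -> -> _ _; rewrite !eqxx. Qed.

(** * The eigenbasis of a sector *)

Section SectorEigenbasis.
Variables (m n : nat).
Local Notation N := (m + n).+1.
Implicit Types (L O : superpart) (x y : 'rV[Qbeta]_(dsec m n)).

Definition combo (B : superpart -> superseries) x : superseries :=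
  \sum_i x 0 i *: B (nsec i).

Lemma combo_lead (B : superpart -> superseries) x :
  (forall L O, B L (leading_smonom O) != 0 ->
    in_sec (sp_fermionic_degree O) (sp_degree O) L) ->
  (forall j, combo B x (leading_smonom (nsec j)) = (x *m lead_matrix B m n) 0 j)
  /\ forall O, ~~ in_sec m n O -> combo B x (leading_smonom O) = 0.
Proof.
move=> Bsec; split=> [j|O nO]; rewrite /combo fct_sumE.
  by rewrite mxE; apply: eq_bigr => i _; rewrite mxE.
apply: big1 => i _; have [z|/Bsec] := eqVneq (B (nsec i) (leading_smonom O)) 0.
  by rewrite -[LHS]/(x 0 i *: B (nsec i) (leading_smonom O)) z scaler0.
move=> /andP [/eqP e1 /eqP e2]; have /andP [/eqP e3 /eqP e4] := nsec_in i.
by case/negP: nO; rewrite /in_sec -e1 -e2 e3 e4 !eqxx.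
Qed.

Lemma combo_sym (B : superpart -> superseries) x :
  (forall L, sym_superfun (B L)) -> sym_superfun (combo B x).
Proof. by move=> h; apply: sym_sum. Qed.

Lemma combo_eq (B C : superpart -> superseries) x y :
  (forall L, sym_superfun (B L)) -> (forall L, sym_superfun (C L)) ->
  (forall L O, B L (leading_smonom O) != 0 -> in_sec (sp_fermionic_degree O) (sp_degree O) L) ->
  (forall L O, C L (leading_smonom O) != 0 -> in_sec (sp_fermionic_degree O) (sp_degree O) L) ->
  x *m lead_matrix B m n = y *m lead_matrix C m n -> combo B x = combo C y.
Proof.
move=> sB sC hB hC e; apply: sym_ext => [||L]; [exact: combo_sym|exact: combo_sym|].
have [lB oB] := combo_lead x hB; have [lC oC] := combo_lead y hC.
have [/nsec_ex [j ->]|nL] := boolP (in_sec m n L); first by rewrite lB lC e.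
by rewrite oB ?oC.
Qed.

Lemma rho_combo B x : rho m n (combo B x) = \sum_i x 0 i *: rho m n (B (nsec i)).
Proof. exact: rho_sum. Qed.

(** The fermionic power sums are expanded while the bosonic ones stay formal; the result lifts the
    coefficient of [theta_1 ... theta_m]. *)
Definition formal_power_sum L : {malg Qbeta[fidx N]} :=
  monom_lift (sp_s L) (alt Qbeta (sp_a L) (fermi_set m n)).

Lemma card_fermi_set : #|fermi_set m n| = m.
Proof.
have mN : (m <= N)%N by lia.
have e := big_ord_widen _ (fun=> 1%N) mN.
by rewrite -sum1_card -[RHS]card_ord -sum1_card e; apply: eq_bigl => i; rewrite inE.
Qed.

Lemma phi_formal_power_sum L : in_sec m n L ->
  phi (formal_power_sum L) = rho m n (sp_power_sum L).
Proof.
move=> /andP [/eqP fL /eqP dL]; rewrite phi_monom_lift; apply/mpolyP => v; rewrite rhoP.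
  by rewrite -represents_sp_power_sum.
by rewrite -fL -dL; apply: sp_power_sum_bihomog.
Qed.

Lemma supported_formal_power_sum L : in_sec m n L ->
  supported (good m 0 n) (formal_power_sum L).
Proof.
move=> /andP [/eqP fL /eqP dL]; apply: supported_monom_lift => v /alt_support [h1 h2 h3]; split=> /=.
- exact: sp_s_sorted.
- exact: sp_s_pos.
- by move=> j mj; apply: h2; rewrite inE -leqNgt.
by rewrite h3 addn0 -sumn_cat.
Qed.

(** The norm of a power sum without the factor [beta ^- m] of its fermionic parts, which is constant
    on the sector. *)
Definition norm_weight L : Qbeta := beta ^- size (sp_s L) * (sp_z L)%:R.

Lemma norm_weight_neq0 L : norm_weight L != 0.
Proof.
apply: mulf_neq0; first by rewrite invr_eq0; apply: expf_neq0 beta_neq0.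
have : (0 < sp_z L)%N.
  rewrite /sp_z big_seq; apply: prodn_cond_gt0 => k; rewrite mem_undup => ks.
  rewrite muln_gt0 fact_gt0 andbT expn_gt0 lt0n; apply/orP; left.
  by apply: contraNneq (sp_s_pos L) => <-.
by case: (sp_z L) => // z _; apply: Qbeta_char0.
Qed.

(** The factor [m!] is the norm of the alternant. It is constant on the sector, so the form on the
    free module is proportional there to the scalar product. *)
Lemma wform_formal_power_sum L O : in_sec m n L -> in_sec m n O ->
  wform (wt beta) (formal_power_sum L) (formal_power_sum O)
  = (L == O)%:R * ((m`!)%:R * norm_weight L).
Proof.
move=> /andP [/eqP fL _] /andP [/eqP fO _]; rewrite wform_monom_lift dot_alt ?card_fermi_set //; last first.
- exact: sp_a_sorted.
- exact: sp_a_sorted.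
have -> : (L == O) = (sp_s L == sp_s O) && (sp_a L == sp_a O).
  by apply/eqP/andP => [->|[/eqP e1 /eqP e2]]; [rewrite !eqxx|apply: superpart_eq].
rewrite -mulnb natrM /norm_weight /sp_z -/(zee (sp_s L)); ring.
Qed.

Definition formal_combo x := \sum_i x 0 i *: formal_power_sum (nsec i).

Lemma phi_formal_combo x : phi (formal_combo x) = rho m n (combo sp_power_sum x).
Proof.
rewrite rho_combo /formal_combo (linear_sum (@phi Qbeta N)); apply: eq_bigr => i _.
by rewrite linearZ /= phi_formal_power_sum ?nsec_in.
Qed.

Lemma supported_formal_combo x : supported (good m 0 n) (formal_combo x).
Proof.
apply: supported_sum => i _; apply: supportedZ.
exact: supported_formal_power_sum (nsec_in i).
Qed.

Lemma wform_formal_combo x y : wform (wt beta) (formal_combo x) (formal_combo y)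
  = (m`!)%:R * \sum_i x 0 i * y 0 i * norm_weight (nsec i).
Proof.
rewrite /formal_combo [LHS]wform_sum mulr_sumr; apply: eq_bigr => i _.
rewrite [LHS]wformZ wformC [X in _ * X]wform_sum (bigD1 i) //= [X in _ + X]big1 => [|j ji].
  by rewrite [X in _ * (X + _)]wformZ wform_formal_power_sum ?nsec_in // eqxx mul1r addr0; ring.
rewrite [LHS]wformZ wform_formal_power_sum ?nsec_in // (inj_eq (@nsec_inj m n)) (negbTE ji).
by rewrite mul0r mulr0.
Qed.

Lemma formal_combo_inj x : formal_combo x = 0 -> x = 0.
Proof.
move=> e; apply/matrixP => z i; rewrite {z}ord1 [RHS]mxE.
have := wform_formal_combo x (delta_mx 0 i).
rewrite e {1}/wform monalg.msupp0 big_seq_fset0 (bigD1 i) //= big1 => [|j ji].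
  rewrite mxE !eqxx mulr1 addr0 => /esym/eqP; rewrite mulrA mulf_eq0 (negbTE (norm_weight_neq0 _)) orbF.
  rewrite mulf_eq0 => /orP [|/eqP //]; have := fact_gt0 m; case: (m`!)%N => // k _.
  by rewrite (negbTE (Qbeta_char0 k)).
by rewrite mxE (negbTE ji) andbF mulr0 mul0r.
Qed.

(** The lifted power sums are orthogonal with nonzero norms, hence independent, and [phi_inj]
    carries the independence over to the superfunctions. *)
Lemma power_sum_matrix_unit : lead_matrix sp_power_sum m n \in unitmx.
Proof.
rewrite unitmxE unitfE; apply/det0P => -[x x0 xT].
case/eqP: x0; apply: formal_combo_inj.
apply: (phi_inj Qbeta_char0 (m := m) (d := n)); first by lia.
  exact: supported_formal_combo.
have e : combo sp_power_sum x = combo sp_power_sum 0.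
  apply: (combo_eq sp_power_sum_sym sp_power_sum_sym power_sum_sec power_sum_sec).
  by rewrite xT mul0mx.
by rewrite phi_formal_combo e rho_combo big1 // => i _; rewrite mxE scale0r.
Qed.

Lemma supermonomial_matrix : lead_matrix supermonomial m n = 1%:M.
Proof. by apply/matrixP => i j; rewrite !mxE supermonomial_lead (inj_eq (@nsec_inj m n)). Qed.

Lemma power_sum_expansion x :
  combo supermonomial x = combo sp_power_sum (x *m invmx (lead_matrix sp_power_sum m n)).
Proof.
apply: (combo_eq supermonomial_sym sp_power_sum_sym supermonomial_sec power_sum_sec).
by rewrite supermonomial_matrix mulmx1 mulmxKV // power_sum_matrix_unit.
Qed.

Lemma below_le_in_sec L O : in_sec m n L -> in_sec m n O -> below O L -> sp_le O L.
Proof.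
move=> /andP [/eqP fL /eqP dL] /andP [/eqP fO /eqP dO] [ex fe].
by apply: sp_le_intro; rewrite ?fL ?dL ?fO ?dO.
Qed.

Definition below_rel : rel 'I_(dsec m n) := fun j i => `[< below (nsec j) (nsec i) >].

Lemma below_rel_refl : reflexive below_rel.
Proof. by move=> i; apply/asboolP; split. Qed.

Lemma below_rel_trans : transitive below_rel.
Proof.
move=> j i k /asboolP [h1 h2] /asboolP [h3 h4]; apply/asboolP; split=> [c|e c].
  exact: leq_trans (h1 c) (h3 c).
have e1 c' : sp_excess c' (nsec i) = sp_excess c' (nsec j).
  by apply/eqP; rewrite eqn_leq h1 e h3.
have e2 c' : sp_excess c' (nsec j) = sp_excess c' (nsec k) by rewrite -e1 e.
exact: leq_trans (h2 e1 c) (h4 e2 c).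
Qed.

Lemma below_rel_anti : antisymmetric below_rel.
Proof.
move=> i j /andP [/asboolP [h1 h2] /asboolP [h3 h4]]; apply: (@nsec_inj m n).
have e c : sp_excess c (nsec i) = sp_excess c (nsec j) by apply/eqP; rewrite eqn_leq h1 h3.
apply: sp_invariants_inj => [||c]; last by apply/eqP; rewrite eqn_leq h2 // h4.
  by have /andP [/eqP -> _] := nsec_in i; have /andP [/eqP -> _] := nsec_in j.
exact: e.
Qed.

(** The rows of [C] are eigenvectors of [ham_matrix]. Written in power sums they lift to the free
    module, and as [phi] is injective there, the lifts are eigenvectors of [fhamiltonian]; distinct
    eigenvalues make them orthogonal. *)
Lemma sector_eigenbasis : exists C : 'M[Qbeta]_(dsec m n),
  [/\ triangular_for below_rel C, forall i, C i i = 1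
    & forall i j, i != j -> forall X, X = C *m invmx (lead_matrix sp_power_sum m n) ->
        \sum_l X i l * X j l * norm_weight (nsec l) = 0].
Proof.
have [f [g [fint gint fval gval]]] := digit_polys m n.
pose A := ham_matrix m n beta f g.
have tA : triangular_for below_rel A by move=> i j /ham_matrix_below h; apply/asboolP.
have dA i j : j != i -> A j j != A i i.
  by apply: contra_neq => /(ham_matrix_diag_inj fint gint fval gval).
have /choice [c hc] : forall i, exists v : 'rV[Qbeta]_(dsec m n),
    [/\ v 0 i = 1, forall j, v 0 j != 0 -> below_rel j i & v *m A = A i i *: v].
  move=> i; exact: (triangular_eigenvector below_rel_refl below_rel_trans below_rel_anti tA (dA i)).
pose C := \matrix_i c i.
have Crow i : row i C = c i by rewrite rowK.
have CE i j : C i j = c i 0 j by rewrite mxE.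
exists C; split=> [i j|i|i j ij X eX]; rewrite ?CE.
- by have [_ h _] := hc i; apply: h.
- by have [-> _ _] := hc i.
pose i0 : 'I_N := Ordinal (leq_addr n m : (m < N)%N).
pose T := lead_matrix sp_power_sum m n.
pose u l := formal_combo (c l *m invmx T).
have su l : supported (good m 0 n) (u l) by apply: supported_formal_combo.
have eig l : fhamiltonian m beta f g i0 (u l) = A l l *: u l.
  apply/eqP; rewrite -subr_eq0; apply/eqP.
  apply: (phi_inj Qbeta_char0 (m := m) (d := n)); first by lia.
    rewrite -scaleN1r; apply: supportedD; last by apply: supportedZ; apply: supportedZ; apply: su.
    exact: (@supported_fhamiltonian _ _ _ beta f g i0 n erefl _ (su l)).
  rewrite linearB linearZ /= (phi_fhamiltonian f g beta_neq0 (i0 := i0) erefl (su l)).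
  rewrite /u phi_formal_combo -power_sum_expansion rho_combo linear_sum scaler_sumr.
  under eq_bigr do rewrite linearZ /= ham_rho scaler_sumr.
  rewrite exchange_big /= -sumrB big1 // => k _.
  under eq_bigr do rewrite scalerA; rewrite -scaler_suml scalerA -scalerBl.
  have [_ _ /matrixP/(_ 0 k)] := hc l; rewrite !mxE => ->.
  by rewrite subrr scale0r.
have p0 : wform (wt beta) (u i) (u j) = 0.
  apply: (fhamiltonian_orthogonal beta_neq0 _ (su i) (su j) (eig i) (eig j)) => //.
  exact: dA ij.
have := wform_formal_combo (c i *m invmx T) (c j *m invmx T); rewrite [LHS]p0 => /esym/eqP.
rewrite mulf_eq0; have := fact_gt0 m; case: (m`!)%N => // k _; rewrite (negbTE (Qbeta_char0 k)) /= => /eqP.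
have XE l : c l *m invmx T = row l X by rewrite eX row_mul Crow.
by rewrite !XE => e; rewrite -[RHS]e; apply: eq_bigr => l _; rewrite !mxE.
Qed.

End SectorEigenbasis.

(** * The orthogonal basis of all symmetric superfunctions *)

Section JackBasis.
Implicit Types (L O : superpart) (m n : nat).

Definition jack_matrix m n : 'M[Qbeta]_(dsec m n) := sval (cid (sector_eigenbasis m n)).

Definition power_matrix m n : 'M[Qbeta]_(dsec m n) :=
  jack_matrix m n *m invmx (lead_matrix sp_power_sum m n).

Lemma jack_matrix_spec m n : [/\ triangular_for (@below_rel m n) (jack_matrix m n),
  forall i, jack_matrix m n i i = 1
  & forall i j, i != j -> \sum_l power_matrix m n i l * power_matrix m n j l * norm_weight (nsec l) = 0].
Proof.
have [h1 h2 h3] := svalP (cid (sector_eigenbasis m n)).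
by split=> // i j ij; apply: h3.
Qed.

(** The sum has exactly one term, at the position of [L] in its sector. *)
Definition jack L : superseries :=
  \sum_(i < dsec (sp_fermionic_degree L) (sp_degree L) | nsec i == L)
    combo supermonomial (row i (jack_matrix _ _)).

Lemma jackE m n (i : 'I_(dsec m n)) :
  jack (nsec i) = combo supermonomial (row i (jack_matrix m n)).
Proof.
have [/eqP e1 /eqP e2] := andP (nsec_in i).
rewrite /jack e1 e2 (big_pred1 i) // => j; exact: (inj_eq (@nsec_inj m n)).
Qed.

Lemma nsec_own L : exists i, L = @nsec (sp_fermionic_degree L) (sp_degree L) i.
Proof. by apply: nsec_ex; rewrite /in_sec !eqxx. Qed.

Lemma jack_sym L : sym_superfun (jack L).
Proof. by have [i ->] := nsec_own L; rewrite jackE; apply: combo_sym supermonomial_sym. Qed.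

Lemma jack_sec L O : jack L (leading_smonom O) != 0 ->
  in_sec (sp_fermionic_degree O) (sp_degree O) L.
Proof.
have [i eL] := nsec_own L; rewrite {1}eL jackE.
set m := sp_fermionic_degree L in i eL *; set n := sp_degree L in i eL *.
have [_ out] := combo_lead (row i (jack_matrix m n)) supermonomial_sec.
have [/andP [/eqP -> /eqP ->] _|/out ->] := boolP (in_sec m n O); last by rewrite eqxx.
by rewrite /in_sec !eqxx.
Qed.

Lemma jack_lead_matrix m n : lead_matrix jack m n = jack_matrix m n.
Proof.
apply/matrixP => i j; rewrite mxE jackE.
have [-> _] := combo_lead (row i (jack_matrix m n)) supermonomial_sec.
by rewrite supermonomial_matrix mulmx1 mxE.
Qed.

Lemma jack_basis : is_basis sym_superfun jack.
Proof.
apply: (unit_basis jack_sym jack_sec) => m n; rewrite jack_lead_matrix.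
have [h1 h2 _] := jack_matrix_spec m n.
exact: (unitriangular_unit (@below_rel_refl m n) (@below_rel_trans m n) (@below_rel_anti m n) h1 h2).
Qed.

(** The sum over the order is widened to the rest of the sector, where the entries of [jack_matrix]
    outside the order vanish. *)
Lemma jack_triangular L : jack L = supermonomial L
  + \sum_(O \in [set O | sp_lt O L]) jack L (leading_smonom O) *: supermonomial O.
Proof.
have [i eL] := nsec_own L.
set m := sp_fermionic_degree L in i eL *; set n := sp_degree L in i eL *.
have [tC C1 _] := jack_matrix_spec m n.
have leadE j : jack L (leading_smonom (nsec j)) = jack_matrix m n i j.
  by rewrite -jack_lead_matrix mxE -eL.
pose r := [seq O <- sector m n | O != L].
rewrite (@fsbig_fwiden _ _ _ _ r) /=; first last.
- move=> O /= []; rewrite /r mem_filter mem_sector => /andP [OL /nsec_ex [j eO]] nlt.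
  have [z|nz] := eqVneq (jack L (leading_smonom O)) 0; first by rewrite z scale0r.
  case: nlt; split; last by apply/eqP.
  rewrite eO leadE in nz; have /asboolP h := tC _ _ nz.
  by rewrite eO eL; apply: (@below_le_in_sec m n) => //; apply: nsec_in.
- exact: filter_uniq (sector_uniq m n).
- move=> O /= [[dO fO _] OL]; rewrite /r mem_filter mem_sector /in_sec fO dO !eqxx !andbT.
  exact/eqP.
rewrite big_filter [X in _ + X]big_tnth.
rewrite {1}eL jackE /combo (bigD1 i) //= mxE C1 scale1r -eL; congr (_ + _).
rewrite [RHS](_ : _ = \sum_(j < dsec m n | nsec j != L) jack L (leading_smonom (nsec j)) *: supermonomial (nsec j)) //.
apply: eq_big => [j|j _]; last by rewrite leadE mxE.
by rewrite eL (inj_eq (@nsec_inj m n)).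
Qed.

Lemma power_sum_basis : is_basis sym_superfun sp_power_sum.
Proof.
by apply: (unit_basis sp_power_sum_sym power_sum_sec) => m n; apply: power_sum_matrix_unit.
Qed.

Lemma power_sum_coordE m n (x : 'rV[Qbeta]_(dsec m n)) :
  let c := power_sum_coord (combo sp_power_sum x) in
  (forall i, c (nsec i) = x 0 i) /\ forall L, ~~ in_sec m n L -> c L = 0.
Proof.
set F := combo sp_power_sum x; set c := power_sum_coord F => /=.
have cF : F = \sum_(L <- finsupp c) c L *: sp_power_sum L.
  have [_ /(_ F (combo_sym x sp_power_sum_sym)) [d [dP _]]] := power_sum_basis.
  exact: (@xgetPex _ [fsfun] [set c | F = \sum_(L <- finsupp c) c L *: sp_power_sum L] (ex_intro _ d dP)).
have [inF outF] := combo_lead x power_sum_sec.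
have ev m' n' (j : 'I_(dsec m' n')) : F (leading_smonom (nsec j))
    = ((\row_i c (nsec i)) *m lead_matrix sp_power_sum m' n') 0 j.
  by rewrite {1}cF (eval_combination power_sum_sec).
split=> [i|L nL].
  have : \row_i c (nsec i) *m lead_matrix sp_power_sum m n = x *m lead_matrix sp_power_sum m n.
    by apply/matrixP => z j; rewrite {z}ord1; apply: etrans (esym (ev _ _ j)) (inF j).
  move=> /(congr1 (mulmx^~ (invmx (lead_matrix sp_power_sum m n)))).
  by rewrite /= !(mulmxK (power_sum_matrix_unit m n)) => /matrixP/(_ 0 i); rewrite mxE.
have [i eL] := nsec_own L.
set m' := sp_fermionic_degree L in i eL *; set n' := sp_degree L in i eL *.
have : \row_i c (nsec i) *m lead_matrix sp_power_sum m' n' = 0.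
  apply/matrixP => z j; rewrite {z}ord1 -ev [RHS]mxE; apply: outF.
  by have /andP [/eqP e1 /eqP e2] := nsec_in j; move: nL; rewrite /in_sec e1 e2.
move=> /(congr1 (mulmx^~ (invmx (lead_matrix sp_power_sum m' n')))).
by rewrite /= (mulmxK (power_sum_matrix_unit m' n')) mul0mx => /matrixP/(_ 0 i); rewrite !mxE -eL.
Qed.

(** All terms carry the same number of thetas, so the reversal is one sign for the whole sector and
    preserves orthogonality. *)
Lemma theta_reversal_combo m n (x : 'rV[Qbeta]_(dsec m n)) :
  exists k, theta_reversal (combo sp_power_sum x) = combo sp_power_sum ((-1) ^+ k *: x).
Proof.
exists ((m * m.-1)./2); apply/funext => M; rewrite /theta_reversal /combo !fct_sumE.
rewrite mulr_sumr; apply: eq_bigr => i _.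
rewrite -[LHS]/((-1) ^+ (#|` M.1| * #|` M.1|.-1)./2 * (x 0 i * sp_power_sum (nsec i) M)).
rewrite -[RHS]/(((-1) ^+ (m * m.-1)./2 *: x) 0 i * sp_power_sum (nsec i) M) mxE.
have [->|nz] := eqVneq (sp_power_sum (nsec i) M) 0; first by rewrite !mulr0.
have [-> _] := sp_power_sum_bihomog nz.
by have /andP [/eqP -> _] := nsec_in i; rewrite mulrA.
Qed.

Lemma scalar_product_combo m n m' n' (x : 'rV[Qbeta]_(dsec m n)) (y : 'rV[Qbeta]_(dsec m' n')) :
  exists k, scalar_product (combo sp_power_sum x) (combo sp_power_sum y)
   = (-1) ^+ k * \sum_i x 0 i * power_sum_coord (combo sp_power_sum y) (nsec i)
       * (beta ^- sp_length (nsec i) * (sp_z (nsec i))%:R).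
Proof.
have [k e] := theta_reversal_combo x; exists k; rewrite /scalar_product e.
have [cin cout] := power_sum_coordE ((-1) ^+ k *: x).
set c := power_sum_coord (combo _ ((-1) ^+ k *: x)) in cin cout *.
set d := power_sum_coord _.
rewrite (@sum_nsec m n (fun L => c L * d L * (beta ^- sp_length L * (sp_z L)%:R))).
- by rewrite mulr_sumr; apply: eq_bigr => i _; rewrite cin mxE !mulrA.
- exact: fset_uniq.
- by move=> L _ nL; rewrite cout // !mul0r.
by move=> L _ nL; rewrite fsfun_dflt // !mul0r.
Qed.

Lemma jack_power_sum m n (i : 'I_(dsec m n)) :
  jack (nsec i) = combo sp_power_sum (row i (power_matrix m n)).
Proof. by rewrite jackE power_sum_expansion -row_mul. Qed.

(** Within a sector this is the orthogonality of the eigenvectors, up to a sign and the factor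
    [beta ^- m]. For different sectors the coordinates in power sums have disjoint supports. *)
Lemma jack_orthogonal L O : L <> O -> scalar_product (jack L) (jack O) = 0.
Proof.
move=> LO; have [i eL] := nsec_own L.
set m := sp_fermionic_degree L in i eL *; set n := sp_degree L in i eL *.
rewrite {1}eL jack_power_sum.
have [/nsec_ex [j eO]|nO] := boolP (in_sec m n O).
  rewrite eO jack_power_sum.
  have [k ->] := scalar_product_combo (row i (power_matrix m n)) (row j (power_matrix m n)).
  have [cE _] := power_sum_coordE (row j (power_matrix m n)).
  have [_ _ orth] := jack_matrix_spec m n.
  have ij : i != j by apply: contra_notN LO => /eqP e; rewrite eL eO e.
  rewrite (_ : \sum_l _ = beta ^- m * \sum_l power_matrix m n i l * power_matrix m n j l * norm_weight (nsec l)).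
    by rewrite orth // !mulr0.
  rewrite mulr_sumr; apply: eq_bigr => l _; rewrite cE !mxE /norm_weight.
  have -> : sp_length (nsec l) = (m + size (sp_s (nsec l)))%N.
    have /andP [/eqP e _] := nsec_in l.
    by rewrite /sp_length size_cat -/(sp_fermionic_degree _) e.
  rewrite exprD invfM; ring.
have [j eO] := nsec_own O.
rewrite {1}eO jack_power_sum.
have [k ->] := scalar_product_combo (row i (power_matrix m n)) (row j (power_matrix _ _)).
have [_ cout] := power_sum_coordE (row j (power_matrix (sp_fermionic_degree O) (sp_degree O))).
rewrite big1 ?mulr0 // => l _; rewrite cout ?mulr0 ?mul0r //.
by have /andP [/eqP e1 /eqP e2] := nsec_in l; move: nO; rewrite /in_sec e1 e2 eq_sym [n == _]eq_sym.
Qed.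

End JackBasis.

Theorem theorem43 :
  exists J : superpart -> superseries,
    [/\ is_basis sym_superfun J,
        forall L : superpart, exists c : superpart -> Qbeta,
          J L = supermonomial L
                + \sum_(O \in [set O | sp_lt O L]) c O *: supermonomial O
      & forall L O : superpart, L <> O -> scalar_product (J L) (J O) = 0].
Proof.
exists jack; split; first exact: jack_basis.
  by move=> L; exists (fun O => jack L (leading_smonom O)); apply: jack_triangular.
exact: jack_orthogonal.
Qed.
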